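(* Let $\mu$ satisfy the following moment condition: there are constants $1/2<\beta\le 1$, $\rho>1$, $\gamma>1$ and a differentiable function $h_\mu(\xi)\ge 0$, $\xi>0$, such that, as $\xi\to\infty$, $$(\ln m_\xi)''=h_\mu(\xi)+O(\xi^{-\rho}),\qquad h_\mu(\xi)=O(\xi^{-\beta}),\qquad h_\mu'(\xi)=O(\xi^{-\gamma}),$$ and such that $\iota_\mu(x):=\frac12\int_1^x h_\mu(\xi)\,d\xi$ tends to infinity as $x\to\infty$. Let $\sigma=\max\{1/\beta,\,3/(2\gamma)\}$. Then, for every real-valued $f\in F\ell^2_\sigma$, the normalized statistics $$X^{\mathrm{scal}}_{f,n}:=\frac{X_{f,n}-n f_0}{\sqrt{\iota_\mu(2n)}}$$ converge in law, as $n\to\infty$, to a mean zero Gaussian with variance $\sum_{k\in\mathbb Z}k^2|f_k|^2$.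
   Context: Let $\mu$ be a nonzero positive measure on $[0,\infty)$ with no point mass at $0$ and with $m_\xi:=\int_0^\infty r^\xi\,d\mu(r)<\infty$ for all $\xi\ge0$. Let $\mathfrak m$ be the radially symmetric measure on $\mathbb C$ given by $d\mathfrak m(z)=d\mu(r)\,d\theta$, $z=re^{i\theta}$. For $n\ge1$ let $(z_1,\dots,z_n)\in\mathbb C^n$ be random points with joint law $$\mathbb P_{\mathfrak m,n}(z_1,\dots,z_n)=\frac1{Z_{\mathfrak m,n}}\prod_{j<k}|z_j-z_k|^2\prod_{k=1}^n d\mathfrak m(z_k),$$ where $Z_{\mathfrak m,n}$ is the normalizing constant. Functions on the unit circle $\mathbb T$ are identified with $2\pi$-periodic functions of the angle. For such $f$ put $X_{f,n}=\sum_{k=1}^n f(\arg z_k)$, and let $f_k=\frac1{2\pi}\int_0^{2\pi}f(x)e^{ikx}\,dx$ be its Fourier coefficients. $F\ell^2_\sigma$ is the space of all $f\in L^1(\mathbb T)$ with $\|f\|_{F\ell^2_\sigma}=\big(\sum_{n\in\mathbb Z}|f_n|^2(1+|n|)^{2\sigma}\big)^{1/2}<\infty$. *)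

(* Defs.v *)
From HB Require Import structures.
From mathcomp Require Import all_boot all_order all_algebra.
From mathcomp Require Import all_classical all_reals all_analysis.
From mathcomp Require Import measurable_realfun.
From mathcomp Require Import complex.

Set Implicit Arguments.
Unset Strict Implicit.
Unset Printing Implicit Defensive.

Import Order.TTheory GRing.Theory Num.Theory.
Import numFieldNormedType.Exports.
Import ComplexField.Normc.

Local Open Scope classical_set_scope.
Local Open Scope ring_scope.
Local Open Scope complex_scope.

(* Lets the Landau notations accept the filter +oo. *)
Canonical pinfty_filter_on (R : numFieldType) := FilterType (pinfty_nbhs R) _.

Definition c2pair (R : realType) (z : R[i]) :
    (measurableTypeR R * measurableTypeR R)%type := (complex.Re z, complex.Im z).

HB.instance Definition _ (R : realType) := isPointed.Build R[i] 0.

(* The Borel sigma-algebra of C = R^2, i.e. the one transported from R * R. *)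
HB.instance Definition _ (R : realType) :=
  Measurable.copy R[i] (g_sigma_algebra_preimageType (@c2pair R)).

(* The argument in ]-pi, pi] (and pi / 2, irrelevantly, at 0). *)
Definition carg (R : realType) (z : R[i]) : R :=
  let a := acos (complex.Re z / normc z) in
  if 0 <= complex.Im z then a else - a.

Lemma carg_polar (R : realType) (z : R[i]) : z != 0 ->
  z = (normc z * cos (carg z)) +i* (normc z * sin (carg z)).
Proof.
case: z => x y z0; rewrite /carg /=.
set n := Num.sqrt _.
have s0 : 0 <= x ^+ 2 + y ^+ 2 by rewrite addr_ge0 ?sqr_ge0.
have n0 : 0 < n.
  rewrite sqrtr_gt0 lt_neqAle s0 andbT eq_sym paddr_eq0 ?sqr_ge0// !sqrf_eq0.
  by apply: contra z0 => /andP[/eqP-> /eqP->].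
have n2 : n ^+ 2 = x ^+ 2 + y ^+ 2 by rewrite sqr_sqrtr.
have xn : `|x| <= n by rewrite -sqrtr_sqr ler_wsqrtr// lerDl sqr_ge0.
clearbody n; have cin : -1 <= x / n <= 1.
  by rewrite -ler_norml normrM normfV (gtr0_norm n0) ler_pdivrMr ?mul1r.
have sE : n * sin (acos (x / n)) = `|y|.
  rewrite sin_acos// -[LHS]ger0_norm; last first.
    by rewrite mulr_ge0 ?sqrtr_ge0// ltW.
  rewrite -sqrtr_sqr exprMn sqr_sqrtr; last first.
    by rewrite subr_ge0 -real_normK ?num_real// expr_le1// ler_norml.
  rewrite mulrBr mulr1 exprMn exprVn mulrCA mulfV ?sqrf_eq0 ?gt_eqF// mulr1.
  by rewrite n2 addrAC subrr add0r sqrtr_sqr.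
have cE : n * cos (acos (x / n)) = x.
  by rewrite acosK// mulrCA mulfV ?gt_eqF// mulr1.
have [y0|y0] := leP 0 y; first by rewrite cE sE ger0_norm.
by rewrite cosN sinN mulrN cE sE ltr0_norm// opprK.
Qed.

Definition polar (R : realType)
    (p : (measurableTypeR R * measurableTypeR R)%type) : R[i] :=
  (p.1 * cos p.2) +i* (p.1 * sin p.2).

Lemma measurable_polar (R : realType) : measurable_fun setT (@polar R).
Proof.
move=> _ _ [B mB <-]; rewrite setTI setTI.
have mcs (g : R -> R) : continuous g -> measurable_fun setT
    (fun p : measurableTypeR R * measurableTypeR R => p.1 * g p.2 : R).
  move=> cg; apply: measurable_funM; first exact: measurable_fst.
  apply: measurableT_comp; last exact: measurable_snd.
  exact: continuous_measurable_fun.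
rewrite -[X in measurable X]setTI.
have := measurable_fun_pair (mcs _ (@continuous_cos R))
                            (mcs _ (@continuous_sin R)).
exact.
Qed.

Section image_measure.
Context d1 d2 (T1 : measurableType d1) (T2 : measurableType d2) (R : realType).
Variables (m : {finite_measure set T1 -> \bar R}) (f : T1 -> T2).

Definition image_measure (mf : measurable_fun setT f) : set T2 -> \bar R :=
  pushforward m f.

Variable mf : measurable_fun setT f.
Local Notation im := (image_measure mf).

Let im0 : im set0 = 0%E.
Proof. by rewrite /image_measure /pushforward preimage_set0 measure0. Qed.

Let im_ge0 A : (0 <= im A)%E.
Proof. exact: measure_ge0. Qed.

Let im_sigma_additive : semi_sigma_additive im.
Proof.
move=> F mF tF mUF; rewrite /image_measure /pushforward preimage_bigcup.
apply: measure_semi_sigma_additive.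
- by move=> n; rewrite -[X in measurable X]setTI; exact: mf.
- apply/trivIsetP => /= i j _ _ ij; rewrite -preimage_setI.
  by move/trivIsetP : tF => /(_ _ _ _ _ ij) ->//; rewrite preimage_set0.
- by rewrite -preimage_bigcup -[X in measurable X]setTI; exact: mf.
Qed.

HB.instance Definition _ := isMeasure.Build _ _ _ im
  im0 im_ge0 im_sigma_additive.

Let im_fin : fin_num_fun im.
Proof.
move=> A mA; apply: fin_num_measure.
by rewrite -[X in measurable X]setTI; exact: mf.
Qed.

HB.instance Definition _ := Measure_isFinite.Build _ _ _ im im_fin.

End image_measure.

Section finite_product.
Context d1 d2 (T1 : measurableType d1) (T2 : measurableType d2) (R : realType).
Variables (m1 : {finite_measure set T1 -> \bar R})
          (m2 : {finite_measure set T2 -> \bar R}).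

Definition finite_product : set (T1 * T2) -> \bar R := (m1 \x m2)%E.

HB.instance Definition _ := Measure.on finite_product.

Let finite_product_fin : fin_num_fun finite_product.
Proof.
apply: lty_fin_num_fun; rewrite /finite_product -setXTT.
rewrite [ltLHS](product_measure1E m1 m2 measurableT measurableT).
by rewrite lte_mul_pinfty// ?fin_num_measure// ltey_eq fin_num_measure.
Qed.

HB.instance Definition _ :=
  Measure_isFinite.Build _ _ _ finite_product finite_product_fin.

End finite_product.

Section tuple_power.
Context d (T : measurableType d) (R : realType).
Variable m : {finite_measure set T -> \bar R}.

Definition tuple_cons n (p : T * n.-tuple T) : n.+1.-tuple T :=
  [tuple of p.1 :: p.2].

Lemma measurable_tuple_cons n : measurable_fun setT (@tuple_cons n).
Proof. exact: measurable_cons measurable_fst measurable_snd. Qed.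

(* The n-fold product measure of m, on n.-tuple T. *)
Fixpoint tuple_power n : {finite_measure set (n.-tuple T) -> \bar R} :=
  match n with
  | 0 => dirac [tuple]
  | n'.+1 => image_measure (finite_product m (tuple_power n'))
               (@measurable_tuple_cons n')
  end.

End tuple_power.

Section weighted_measure.
Context d (T : measurableType d) (R : realType).
Variables (m : {measure set T -> \bar R}) (w : T -> R).

Definition weighted_measure (mw : measurable_fun setT w)
    (w0 : forall t, 0 <= w t) : set T -> \bar R :=
  fun A => (\int[m]_(t in A) (w t)%:E)%E.

Variables (mw : measurable_fun setT w) (w0 : forall t, 0 <= w t).
Local Notation wm := (weighted_measure mw w0).

Let wm0 : wm set0 = 0%E.
Proof. exact: integral_set0. Qed.

Let wm_ge0 A : (0 <= wm A)%E.
Proof. by apply: integral_ge0 => t _; rewrite lee_fin. Qed.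

Let wm_sigma_additive : semi_sigma_additive wm.
Proof.
apply: (@semi_sigma_additive_nng_induced _ _ _ m (fun t => (w t)%:E)).
  exact/measurable_EFinP.
by move=> t; rewrite lee_fin.
Qed.

HB.instance Definition _ := isMeasure.Build _ _ _ wm
  wm0 wm_ge0 wm_sigma_additive.

End weighted_measure.

Section point_process.
Variable R : realType.
Variable mu : {finite_measure set (measurableTypeR R) -> \bar R}.

(* d theta on [0, 2 pi[ *)
Definition angle_measure : set (measurableTypeR R) -> \bar R :=
  mrestr (@lebesgue_measure R) (measurable_itv `[0, pi *+ 2[%R).

HB.instance Definition _ := Measure.on angle_measure.

Let angle_measure_fin : fin_num_fun angle_measure.
Proof.
apply: lty_fin_num_fun.
rewrite [ltLHS](_ : _ = lebesgue_measure `[0, pi *+ 2[%classic); last first.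
  by rewrite -[in RHS](setTI `[0, pi *+ 2[%classic).
by rewrite lebesgue_measure_itv/=; case: ifPn => //; rewrite ltry.
Qed.

HB.instance Definition _ :=
  Measure_isFinite.Build _ _ _ angle_measure angle_measure_fin.

Definition radial_measure : {finite_measure set R[i] -> \bar R} :=
  image_measure (finite_product mu angle_measure) (@measurable_polar R).

Definition sq_vandermonde n (z : n.-tuple R[i]) : R :=
  \prod_(j < n) \prod_(k < n | (j < k)%N) normc (tnth z j - tnth z k) ^+ 2.

Lemma sq_vandermonde_ge0 n (z : n.-tuple R[i]) : 0 <= sq_vandermonde z.
Proof. by apply: prodr_ge0 => j _; apply: prodr_ge0 => k _; exact: sqr_ge0. Qed.

Lemma measurable_c2pair : measurable_fun setT (@c2pair R).
Proof. by move=> _ B mB; exists B. Qed.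

Lemma measurable_sq_vandermonde n : measurable_fun setT (@sq_vandermonde n).
Proof.
apply: measurable_prod => j _.
have -> : (fun z : n.-tuple R[i] => \prod_(k < n | (j < k)%N)
      normc (tnth z j - tnth z k) ^+ 2) =
    (fun z => \prod_(k < n) if (j < k)%N then
      ((complex.Re (tnth z j) - complex.Re (tnth z k)) ^+ 2 +
       (complex.Im (tnth z j) - complex.Im (tnth z k)) ^+ 2) else 1).
  apply/funext => z; rewrite big_mkcond; apply: eq_bigr => k _.
  case: ifP => // _; case: (tnth z j) (tnth z k) => [a b] [c e] /=.
  by rewrite sqr_sqrtr// addr_ge0 ?sqr_ge0.
apply: measurable_prod => k _; case: (j < k)%N => //.
have mRe i : measurable_fun setT (fun z : n.-tuple R[i] => complex.Re (tnth z i)).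
  exact: (measurableT_comp measurable_fst
    (measurableT_comp measurable_c2pair (measurable_tnth i))).
have mIm i : measurable_fun setT (fun z : n.-tuple R[i] => complex.Im (tnth z i)).
  exact: (measurableT_comp measurable_snd
    (measurableT_comp measurable_c2pair (measurable_tnth i))).
have mX (u v : n.-tuple R[i] -> R) : measurable_fun setT u ->
    measurable_fun setT v -> measurable_fun setT (fun z => (u z - v z) ^+ 2).
  by move=> mu_ mv; exact: measurable_funX (measurable_funB mu_ mv).
exact: measurable_funD (mX _ _ (mRe j) (mRe k)) (mX _ _ (mIm j) (mIm k)).
Qed.

(* The law of (z_1, ..., z_n). [mnormalize] divides by the total mass Z_{m,n};
   its default value (a Dirac mass) is taken only if Z_{m,n} is 0 or +oo, which
   the assumptions on mu rule out. *)
Definition joint_law n : probability (n.-tuple R[i]) R :=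
  mnormalize
    (weighted_measure (tuple_power radial_measure n)
       (@measurable_sq_vandermonde n) (@sq_vandermonde_ge0 n))
    (dirac point).

Definition moment (xi : R) : \bar R :=
  (\int[mu]_(r in `[0%R, +oo[) (r `^ xi)%:E)%E.

Definition ln_moment (xi : R) : R := ln (fine (moment xi)).

End point_process.

Section fourier.
Variable R : realType.
Implicit Types (f : R -> R) (k : int).

(* f_k = (2 pi)^-1 * \int_0^{2 pi} f(x) e^{i k x} dx for real-valued f. *)
Definition fourier_coef f k : R[i] :=
  ((pi *+ 2)^-1 *
     \int[lebesgue_measure]_(x in `[0, pi *+ 2]) (f x * cos (k%:~R * x))) +i*
  ((pi *+ 2)^-1 *
     \int[lebesgue_measure]_(x in `[0, pi *+ 2]) (f x * sin (k%:~R * x))).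

Definition L1_circle f : Prop :=
  periodic f (pi *+ 2) /\
  (@lebesgue_measure R).-integrable `[0, pi *+ 2] (EFin \o f).

Definition Fl2_norm (sigma : R) f : \bar R :=
  poweR (\esum_(k in [set: int])
    (normc (fourier_coef f k) ^+ 2 * (1 + `|k%:~R|) `^ (2 * sigma))%:E)%E 2^-1.

Definition Fl2 (sigma : R) f : Prop :=
  L1_circle f /\ (Fl2_norm sigma f < +oo)%E.

End fourier.

Section statistics.
Variable R : realType.

Definition lin_stat (f : R -> R) n (z : n.-tuple R[i]) : R :=
  \sum_(k < n) f (carg (tnth z k)).

Definition iota_fun (h : R -> R) (x : R) : R :=
  2^-1 * \int[lebesgue_measure]_(xi in `[1, x]) h xi.

(* f_0 is real, since f is. *)
Definition scaled_stat (h f : R -> R) n (z : n.-tuple R[i]) : R :=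
  (lin_stat f z - n%:R * complex.Re (fourier_coef f 0)) /
  Num.sqrt (iota_fun h (2 * n%:R)).

(* [normal_prob] takes a standard deviation, and is not Gaussian at 0. *)
Definition gaussian (m v : R) : probability (measurableTypeR R) R :=
  if v == 0 then (@dirac _ (measurableTypeR R) m R : probability _ _)
  else (normal_prob m (Num.sqrt v) : probability _ _).

Definition cvg_in_law (d : measure_display) (T : nat -> measurableType d)
    (P : forall n, probability (T n) R) (X : forall n, T n -> R)
    (Q : probability (measurableTypeR R) R) : Prop :=
  (forall n, measurable_fun [set: T n] (X n)) /\
  forall g : R -> R, continuous g -> bounded_fun g ->
    ('E_(P n)[g \o X n] @[n --> \oo] --> 'E_Q[g])%E.

Definition limit_variance (f : R -> R) : R :=
  fine (\esum_(k in [set: int])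
    (k%:~R ^+ 2 * normc (fourier_coef f k) ^+ 2)%:E)%E.

End statistics.

(* Main.v *)
(** Write u = f / sqrt(iota(2n)). By Andreief's identity the Laplace transform
    E exp(zeta sum_k u(arg z_k)) of the determinantal process is the determinant
    of the Gram matrix of exp(zeta u) over the orthonormal monomials. In an
    orthonormal basis that diagonalises the compression of u, this determinant is
    exp(zeta tr u) det(1 + S), where tr S is zeta^2 V / 2 up to a small error, V
    being the variance of the statistic, and S is small in Hilbert-Schmidt norm
    because u is uniformly small. Hence det(1 + S) is close to exp(tr S), and a limit L
    of the variances V gives the limit exp(zeta^2 L / 2); imaginary zeta give the
    characteristic function and real zeta give tightness.

    By rotation invariance the variance is diagonal in Fourier modes: the mode k has
    weight |f_k|^2 v_n(k) with
      v_n(k) = min(n, |k|) + sum_(j < n - |k|) (1 - rho(j, j + |k|)^2),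
    and rho(j, j + k)^2 is the exponential of minus a second difference of step k of the
    log moments at 2j. Therefore v_n(k) / iota(2n) tends to k^2 and is
    bounded by a multiple of k^2, and dominated convergence gives
    L = sum_k k^2 |f_k|^2. As sigma >= 1, f agrees almost everywhere with the sum of its
    absolutely convergent Fourier series, which is bounded. *)

Require Import Defs.
From mathcomp Require Import all_boot all_order all_algebra.
From mathcomp Require Import all_classical all_reals all_analysis.
From mathcomp Require Import measurable_realfun complex.
From mathcomp Require Import fingroup perm.
From mathcomp Require Import ring lra.

Set Implicit Arguments.
Unset Strict Implicit.
Unset Printing Implicit Defensive.

Import Order.TTheory GRing.Theory Num.Theory.
Import numFieldNormedType.Exports.
Import ComplexField.Normc.

Local Open Scope classical_set_scope.
Local Open Scope ring_scope.
Local Open Scope complex_scope.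

Local Notation "z ^*" := (conjc z) : ring_scope.

(** * Complex exponential and determinants close to 1 *)

(** Expanding the Gram matrix of exp(zeta u) directly around the identity fails: the squared
    Hilbert-Schmidt norm of the first-order term is in general of order n / iota(2n), not small. In
    the diagonalising basis phi_j, with a_j the mean of u under |phi_j|^2, the factor exp(zeta a_j)
    is pulled out of column j; the linear term of what remains vanishes identically, and Bessel's
    inequality bounds the squared norm of the rest by a multiple of (sup |u|)^2 times the variance.
    A bounded function and convergence of the variance then suffice.

    A second difference of step k is a sum of k^2 second differences of step 1. Each of these, and
    each increment of iota over [2j, 2j + 2], lies within O(j^(-p)) of h(2j) with p = min(rho,
    gamma) > 1, a summable error; hence the factor k^2 and the normalisation iota(2n).

    The function f is controlled only through its Fourier coefficients, so the argument runs for the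
    sum of its Fourier series; Lebesgue-null sets of angles turn out to be invisible to the joint
    law. *)

Section taylor_bounds.
Variable R : realType.
Implicit Types (x y : R) (z w : R[i]).

(** Mean value theorem. Each use raises the order of vanishing at 0 by one, so the Taylor bounds
    below follow by iteration from a bound on the last derivative; the factorials are given up. *)
Lemma le_power_of_derivative (G dG : R -> R) (K : R) (n : nat) :
  0 <= K -> G 0 = 0 -> (forall x, is_derive x 1 G (dG x)) ->
  (forall x, `|x| <= 1 -> `|dG x| <= K * `|x| ^+ n) ->
  forall x, `|x| <= 1 -> `|G x| <= K * `|x| ^+ n.+1.
Proof.
move=> K0 G0 dGP dGK x x1.
have cG a b : {within `[a, b], continuous G}.
  apply: continuous_subspaceT => y.
  exact/differentiable_continuous/derivable1_diffP/ex_derive.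
have step c : `|c| <= `|x| -> `|dG c * x| <= K * `|x| ^+ n.+1.
  move=> cx; rewrite normrM exprSr mulrA ler_wpM2r//.
  rewrite (le_trans (dGK _ (le_trans cx x1)))// ler_wpM2l// lerXn2r ?nnegrE//.
have [x0|x0|->] := ltrgtP x 0; last by rewrite G0 normr0 mulr_ge0// exprn_ge0.
- have [c /itvP cx e] := MVT x0 (fun y _ => dGP y) (cG _ _).
  move: e; rewrite G0 !sub0r mulrN => /oppr_inj ->.
  by apply: step; rewrite !ler0_norm ?lerN2 ?cx// ltW.
- have [c /itvP cx e] := MVT x0 (fun y _ => dGP y) (cG _ _).
  move: e; rewrite G0 !subr0 => ->.
  by apply: step; rewrite !ger0_norm ?cx// ltW.
Qed.

Lemma expR_taylor2 x : `|x| <= 1 ->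
  `|expR x - (1 + x + x ^+ 2 / 2)| <= expR 1 * `|x| ^+ 3.
Proof.
pose K : R := expR 1.
have K0 : 0 <= K by exact: expR_ge0.
have b0 y : `|y| <= 1 -> `|expR y| <= K * `|y| ^+ 0.
  by move=> y1; rewrite mulr1 ger0_norm ?expR_ge0// ler_expR (le_trans (ler_norm _)).
have b1 := @le_power_of_derivative (fun y => expR y - 1) expR K 0 K0.
have {}b1 y : `|y| <= 1 -> `|expR y - 1| <= K * `|y| ^+ 1.
  apply: b1 => //; first by rewrite expR0 subrr.
  by move=> t; apply: is_derive_eq; rewrite subr0.
have b2 := @le_power_of_derivative (fun y => expR y - (1 + y)) (fun y => expR y - 1) K 1 K0.
have {}b2 y : `|y| <= 1 -> `|expR y - (1 + y)| <= K * `|y| ^+ 2.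
  apply: b2 => //; first by rewrite expR0 addr0 subrr.
  by move=> t; apply: is_derive_eq; rewrite add0r.
apply: (@le_power_of_derivative (fun y => expR y - (1 + y + y ^+ 2 / 2))
  (fun y => expR y - (1 + y)) K 2 K0) => //.
  by rewrite expR0 expr0n/= mul0r !addr0 subrr.
move=> t; apply: is_derive_eq.
by rewrite /GRing.scale/=; field.
Qed.

Lemma sin_taylor1 x : `|x| <= 1 -> `|sin x - x| <= `|x| ^+ 3 /\
  `|cos x - 1 + x ^+ 2 / 2| <= `|x| ^+ 4.
Proof.
have b0 y : `|y| <= 1 -> `|- cos y| <= 1 * `|y| ^+ 0.
  by move=> _; rewrite mulr1 normrN ler_norml cos_geN1 cos_le1.
have b1 y : `|y| <= 1 -> `|- sin y| <= 1 * `|y| ^+ 1.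
  move: y; apply: (@le_power_of_derivative (fun y => - sin y) (fun y => - cos y)) => //.
  by rewrite sin0 oppr0.
have b2 y : `|y| <= 1 -> `|cos y - 1| <= 1 * `|y| ^+ 2.
  move: y; apply: (@le_power_of_derivative (fun y => cos y - 1) (fun y => - sin y)) => //.
    by rewrite cos0 subrr.
  by move=> t; apply: is_derive_eq; rewrite subr0.
have b3 y : `|y| <= 1 -> `|sin y - y| <= 1 * `|y| ^+ 3.
  move: y; apply: (@le_power_of_derivative (fun y => sin y - y) (fun y => cos y - 1)) => //.
  by rewrite sin0 subrr.
have b4 y : `|y| <= 1 -> `|cos y - 1 + y ^+ 2 / 2| <= 1 * `|y| ^+ 4.
  move: y; apply: (@le_power_of_derivative (fun y => cos y - 1 + y ^+ 2 / 2)
    (fun y => - (sin y - y))) => //.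
  - by rewrite cos0 expr0n/= mul0r addr0 subrr.
  - move=> t; apply: is_derive_eq.
    by rewrite /GRing.scale/=; field.
  - by move=> y y1; rewrite normrN; exact: b3.
by move=> x1; split; rewrite -[leRHS]mul1r; [exact: b3|exact: b4].
Qed.

End taylor_bounds.

Section cexp.
Variable R : realType.
Implicit Types (x y : R) (z w : R[i]).

Definition cexp z : R[i] :=
  (expR (complex.Re z) * cos (complex.Im z)) +i*
  (expR (complex.Re z) * sin (complex.Im z)).

Lemma cexpD z w : cexp (z + w) = cexp z * cexp w.
Proof.
case: z w => [a b] [c d]; rewrite /cexp/= expRD cosD sinD.
by apply/eqP; rewrite eq_complex/=; apply/andP; split; apply/eqP; ring.
Qed.

Lemma cexp0 : cexp 0 = 1.
Proof. by rewrite /cexp/= expR0 cos0 sin0 mulr0 mulr1. Qed.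

Lemma cexp_sum (I : Type) (r : seq I) (P : pred I) (F : I -> R[i]) :
  cexp (\sum_(i <- r | P i) F i) = \prod_(i <- r | P i) cexp (F i).
Proof. by apply: (big_morph cexp cexpD cexp0). Qed.

Lemma normc_ge0 z : 0 <= normc z.
Proof. by case: z => a b; exact: sqrtr_ge0. Qed.

Lemma normc_sqr z : normc z ^+ 2 = complex.Re z ^+ 2 + complex.Im z ^+ 2.
Proof. by case: z => a b; rewrite sqr_sqrtr// addr_ge0 ?sqr_ge0. Qed.

Lemma norm_Re_le_normc z : `|complex.Re z| <= normc z.
Proof.
by rewrite -sqrtr_sqr -[leRHS]ger0_norm ?normc_ge0// -sqrtr_sqr ler_sqrt ?sqr_ge0//
  normc_sqr lerDl sqr_ge0.
Qed.

Lemma norm_Im_le_normc z : `|complex.Im z| <= normc z.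
Proof.
by rewrite -sqrtr_sqr -[leRHS]ger0_norm ?normc_ge0// -sqrtr_sqr ler_sqrt ?sqr_ge0//
  normc_sqr lerDr sqr_ge0.
Qed.

Lemma normc_le_ReIm z : normc z <= `|complex.Re z| + `|complex.Im z|.
Proof.
rewrite -(@ler_pXn2r _ 2)// ?nnegrE ?normc_ge0 ?addr_ge0//.
rewrite normc_sqr sqrrD !real_normK ?num_real//.
by rewrite addrAC lerDl mulrn_wge0// mulr_ge0.
Qed.

Lemma normcX z n : normc (z ^+ n) = normc z ^+ n.
Proof.
by elim: n => [|n IH]; [rewrite !expr0 normc1|rewrite !exprS normcM IH].
Qed.

Lemma normcR x : normc x%:C = `|x|.
Proof. by rewrite /= expr0n/= addr0 sqrtr_sqr. Qed.

(** Rounded up: the six error terms in the proof below add up to 2 e + 25/4. *)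
Definition cexp_const : R := 4 * expR 1 + 7.

Lemma cexp_taylor2 z : normc z <= 1 ->
  normc (cexp z - (1 + z + z ^+ 2 / 2%:R)) <= cexp_const * normc z ^+ 3.
Proof.
set s := normc z => s1.
have s0 : 0 <= s by exact: normc_ge0.
have := norm_Re_le_normc z; have := norm_Im_le_normc z; rewrite -/s.
case: z @s s0 s1 => x y s s0 s1 ys xs; rewrite /= in ys xs.
have [K0 xs3] : 0 <= expR 1 :> R /\ `|x| ^+ 3 <= s ^+ 3.
  by split; [exact: expR_ge0|rewrite lerXn2r].
have := expR_taylor2 (le_trans xs s1).
set a := expR x - _ => a3; have ax : expR x = 1 + x + x ^+ 2 / 2 + a.
  by rewrite /a; ring.
have [] := sin_taylor1 (le_trans ys s1).
set c := sin y - _; set b := cos y - 1 + _ => c3 b4.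
have cy : sin y = y + c by rewrite /c; ring.
have by_ : cos y = 1 - y ^+ 2 / 2 + b by rewrite /b; ring.
have as3 : `|a| <= expR 1 * s ^+ 3 by rewrite (le_trans a3)// ler_wpM2l.
have cs3 : `|c| <= s ^+ 3 by rewrite (le_trans c3)// lerXn2r.
have bs3 : `|b| <= s ^+ 3.
  rewrite (le_trans b4)// (@le_trans _ _ (s ^+ 4)) ?lerXn2r//.
  by rewrite exprSr ler_piMr// exprn_ge0.
have x1 : `|x| <= 1 := le_trans xs s1.
have E52 : `|1 + x + x ^+ 2 / 2| <= 5 / 2.
  rewrite (le_trans (ler_normD _ _))// (le_trans (lerD (ler_normD _ _) (lexx _)))//.
  rewrite normrM normrX normr1.
  have x2 : `|x| ^+ 2 <= 1 by rewrite expr_le1.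
  by rewrite (ger0_norm (_ : 0 <= 2^-1))//; lra.
have zE : ((x +i* y) ^+ 2 / 2%:R) = ((x ^+ 2 - y ^+ 2) / 2) +i* (x * y).
  rewrite (_ : 2%:R = (2%:R : R)%:C)//; last by rewrite rmorph_nat.
  rewrite -fmorphV expr2; apply/eqP; rewrite eq_complex/=.
  by apply/andP; split; apply/eqP; field.
apply: le_trans (normc_le_ReIm _) _; rewrite zE /= {1}ax {1}by_ {1}ax {1}cy.
set E := 1 + x + x ^+ 2 / 2.
(* Once the Taylor polynomial of degree 2 has cancelled, every remaining term carries one of the
   remainders [a], [b], [c] or is a monomial of degree at least 3 in [x] and [y]. *)
rewrite (_ : _ - _ = E * b + a * cos y - y ^+ 2 / 2 * (x + x ^+ 2 / 2)); last first.
  by rewrite by_ /E; field.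
rewrite (_ : _ * (y + c) - _ = E * c + a * sin y + x ^+ 2 / 2 * y); last first.
  by rewrite cy /E; field.
have s3 : 0 <= s ^+ 3 by rewrite exprn_ge0.
have acos : `|a * cos y| <= expR 1 * s ^+ 3.
  by rewrite normrM (le_trans _ as3)// ler_piMr// ler_norml cos_geN1 cos_le1.
have asin_ : `|a * sin y| <= expR 1 * s ^+ 3.
  by rewrite normrM (le_trans _ as3)// ler_piMr// ler_norml sin_geN1 sin_le1.
have Eb : `|E * b| <= 5 / 2 * s ^+ 3 by rewrite normrM ler_pM.
have Ec : `|E * c| <= 5 / 2 * s ^+ 3 by rewrite normrM ler_pM.
have yx : `|y ^+ 2 / 2 * (x + x ^+ 2 / 2)| <= 3 / 4 * s ^+ 3.
  rewrite normrM normrM normrX (ger0_norm (_ : 0 <= 2^-1))//.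
  have h : `|x + x ^+ 2 / 2| <= 3 / 2 * s.
    rewrite (le_trans (ler_normD _ _))// normrM normrX (ger0_norm (_ : 0 <= 2^-1))//.
    have : `|x| ^+ 2 <= s.
      by rewrite (le_trans _ xs)// expr2 ler_piMr.
    lra.
  have y2 : `|y| ^+ 2 / 2 <= s ^+ 2 / 2 by rewrite ler_wpM2r// lerXn2r.
  have := ler_pM (divr_ge0 (exprn_ge0 2 (normr_ge0 y)) (ler0n _ 2)) (normr_ge0 _) y2 h.
  move=> /le_trans; apply; by rewrite exprSr; lra.
have xy : `|x ^+ 2 / 2 * y| <= 2^-1 * s ^+ 3.
  rewrite normrM normrM normrX (ger0_norm (_ : 0 <= 2^-1))// mulrAC mulrC ler_wpM2l//.
  by rewrite [leRHS]exprSr ler_pM ?exprn_ge0// lerXn2r.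
rewrite /cexp_const.
apply: le_trans (lerD (ler_normB _ _) (ler_normD _ _)) _.
apply: le_trans (lerD (lerD (ler_normD _ _) (lexx _)) (lerD (ler_normD _ _) (lexx _))) _.
have K3 : 0 <= expR 1 * s ^+ 3 by rewrite mulr_ge0.
lra.
Qed.

Lemma cexp_const_ge0 : 0 <= cexp_const.
Proof. by rewrite addr_ge0// mulr_ge0// expR_ge0. Qed.

Lemma cexp_taylor1 z : normc z <= 1 ->
  normc (cexp z - (1 + z)) <= (cexp_const + 1) * normc z ^+ 2.
Proof.
move=> z1; rewrite (_ : _ - _ = (cexp z - (1 + z + z ^+ 2 / 2%:R)) + z ^+ 2 / 2%:R); last first.
  by ring.
have z0 := normc_ge0 z.
apply: le_trans (le_normcD _ _) _; rewrite mulrDl mul1r lerD//.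
  apply: le_trans (cexp_taylor2 z1) _.
  by rewrite ler_wpM2l ?cexp_const_ge0// exprSr ler_piMr// exprn_ge0.
rewrite normcM normcX normcV ler_piMr ?exprn_ge0//.
rewrite (_ : 2%:R = (2%:R : R)%:C); last by rewrite rmorph_nat.
by rewrite normcR ger0_norm// invf_le1// ler1n.
Qed.

End cexp.

Section det_exp.
Local Open Scope sesquilinear_scope.
Variable R : realType.
Local Notation C := R[i].

(** In the expanded product each monomial is replaced by its absolute value, which leads to the
    product of the [1 + normc (mu i)]; then 1 + x <= exp x. *)
Lemma norm_prod1D_sub1 (I : finType) (mu : I -> C) :
  normc (\prod_i (1 + mu i) - 1) <= expR (\sum_i normc (mu i)) - 1.
Proof.
apply: (@le_trans _ _ (\prod_i (1 + normc (mu i)) - 1)); last first.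
  rewrite lerB// expR_sum ler_prod// => i _.
  by rewrite expR_ge1Dx addr_ge0// normc_ge0.
rewrite -!big_enum; elim: (enum I) => [|i s IH]; first by rewrite !big_nil !subrr normc0.
rewrite !big_cons; set P := \prod_(_ <- s) _ in IH *; set Q := \prod_(_ <- s) _ in IH *.
rewrite -[X in normc (X - 1)]/((1 + mu i) * P) -[X in _ <= X - 1]/((1 + normc (mu i)) * Q).
rewrite (_ : _ - 1 = (P - 1) + mu i * (P - 1) + mu i); last by ring.
apply: le_trans (le_normcD _ _) _.
apply: le_trans (lerD (le_normcD _ _) (lexx _)) _; rewrite normcM.
have m0 := normc_ge0 (mu i).
have := ler_wpM2l m0 IH.
lra.
Qed.

Lemma normc_sqr_conj (z : C) : ((normc z) ^+ 2)%:C = z * z^*.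
Proof.
by rewrite normc_sqr; case: z => a b /=; apply/eqP; rewrite eq_complex/=;
  apply/andP; split; apply/eqP; ring.
Qed.

(** The regularised determinant det_2 of 1 + S is compared with 1. Schur triangularisation turns it
    into the product of the (1 + lambda_i) exp(- lambda_i) over the eigenvalues, with factors 1 +
    O(|lambda_i|^2). The constant is 2 (c + 1) + 1: the first part from |1 + lambda| <= 2 and the
    Taylor remainder, the last 1 from the term - lambda^2. *)
Lemma det1D_near_cexp n (S : 'M[C]_n) (h : R) : h <= 1 ->
  \sum_i \sum_j normc (S i j) ^+ 2 <= h ->
  normc (\det (1%:M + S) * cexp (- \tr S) - 1) <=
    expR ((2 * cexp_const R + 3) * h) - 1.
Proof.
move=> h1 Sh; set K : R := _ + 3.
have K0 : 0 <= K by have := @cexp_const_ge0 R; rewrite /K; lra.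
have h0 : 0 <= h.
  by apply: le_trans Sh; apply: sumr_ge0 => i _; apply: sumr_ge0 => j _; exact: sqr_ge0.
have [n0|n0] := posnP n.
  subst n; rewrite det_mx00 /mxtrace big_ord0 oppr0 cexp0 mulr1 subrr normc0.
  by rewrite subr_ge0 -[leLHS]expR0 ler_expR mulr_ge0.
have [P PU /= /is_trig_mxP PT] := Schur S n0.
have Pu := unitarymx_unit PU.
set T := conjmx P S in PT *.
have TE : T = P *m S *m invmx P by rewrite /T conjumx.
clearbody T.
have SE : 1%:M + S = invmx P *m (1%:M + T) *m P.
  by rewrite TE mulmxDr mulmxDl mulmx1 mulVmx// !mulmxA mulVmx// mul1mx mulmxKV.
have detE : \det (1%:M + S) = \prod_i (1 + T i i).
  rewrite SE !det_mulmx mulrAC -det_mulmx mulVmx// det1 mul1r det_trig; last first.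
    apply/is_trig_mxP => i j ij; rewrite !mxE PT// addr0.
    by rewrite -val_eqE/= ltn_eqF.
  by apply: eq_bigr => i _; rewrite !mxE eqxx.
have trE : \tr S = \sum_i T i i.
  by rewrite -[RHS]/(\tr T) TE mxtrace_mulC mulmxA mulVmx// mul1mx.
(* Schur's inequality: the Hilbert-Schmidt norm is unitarily invariant and dominates the
   diagonal. *)
have Th : \sum_i normc (T i i) ^+ 2 <= h.
  apply: le_trans Sh.
  have frob (A : 'M[C]_n) : (\sum_i \sum_j normc (A i j) ^+ 2)%:C = \tr (A *m A ^t*).
    rewrite rmorph_sum; apply: eq_bigr => i _; rewrite rmorph_sum mxE.
    by apply: eq_bigr => j _; rewrite !mxE; exact: normc_sqr_conj.
  have /complexI -> : (\sum_i \sum_j normc (S i j) ^+ 2)%:C =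
      (\sum_i \sum_j normc (T i j) ^+ 2)%:C.
    rewrite !frob TE invmx_unitary// !trmx_mul !map_mxM trmxCK !mulmxA mulmxKtV//.
    have PP : P ^t* *m P = 1%:M by rewrite -invmx_unitary// mulVmx.
    by rewrite -!mulmxA [RHS]mxtrace_mulC -!mulmxA [X in _ *m (_ *m X)](_ : _ = 1%:M) ?mulmx1//.
  apply: ler_sum => i _; rewrite (bigD1 i)//= lerDl sumr_ge0// => j _; exact: sqr_ge0.
rewrite detE trE -sumrN cexp_sum -big_split/=.
rewrite (eq_bigr (fun i => 1 + ((1 + T i i) * cexp (- T i i) - 1))); last first.
  by move=> i _; ring.
apply: le_trans (norm_prod1D_sub1 _) _.
rewrite lerB// ler_expR; apply: (@le_trans _ _ (\sum_i K * normc (T i i) ^+ 2)).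
  apply: ler_sum => i _; set t := T i i.
  have t1 : normc t <= 1.
    rewrite -(@ler_pXn2r _ 2)// ?nnegrE ?normc_ge0// expr1n (le_trans _ h1)//.
    apply: le_trans Th; rewrite (bigD1 i)//= lerDl sumr_ge0// => j _; exact: sqr_ge0.
  have := @cexp_taylor1 R (- t); rewrite normcN => /(_ t1).
  set e := cexp (- t) - _ => eK.
  rewrite (_ : _ - 1 = - t ^+ 2 + (1 + t) * e); last by rewrite /e; ring.
  apply: le_trans (le_normcD _ _) _; rewrite normcN normcX normcM.
  have t2 : normc (1 + t) <= 2.
    by apply: le_trans (le_normcD _ _) _; rewrite normc1; lra.
  have := ler_pM (normc_ge0 _) (normc_ge0 _) t2 eK.
  rewrite /K; lra.
by rewrite -mulr_sumr ler_wpM2l.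
Qed.

End det_exp.

(** * Real and complex integrals *)

Section real_integrals.
Context d (T : measurableType d) (R : realType) (m : {measure set T -> \bar R}).
Implicit Types f g : T -> R.

Definition rintegrable f := m.-integrable [set: T] (EFin \o f).

Lemma rintegrable_measurable f : rintegrable f -> measurable_fun setT f.
Proof. by move=> /integrableP[/measurable_EFinP]. Qed.

Lemma rintegrableD f g : rintegrable f -> rintegrable g ->
  rintegrable (fun x => f x + g x).
Proof. by move=> /integrableD h /h -/(_ measurableT). Qed.

Lemma rintegrableZ (c : R) f : rintegrable f -> rintegrable (fun x => c * f x).
Proof. by move=> /(integrableZl measurableT c). Qed.

Lemma rintegrableN f : rintegrable f -> rintegrable (fun x => - f x).
Proof. by move=> /(rintegrableZ (-1)); under eq_fun do rewrite mulN1r. Qed.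

Lemma rintegrableB f g : rintegrable f -> rintegrable g ->
  rintegrable (fun x => f x - g x).
Proof. by move=> /rintegrableD h /rintegrableN /h. Qed.

Lemma rintegrable_sum (I : Type) (r : seq I) (P : pred I) (F : I -> T -> R) :
  (forall i, P i -> rintegrable (F i)) ->
  rintegrable (fun x => \sum_(i <- r | P i) F i x).
Proof.
move=> iF; have := integrable_sum measurableT r iF.
by congr (integrable _ _ _); apply/funext => x/=; rewrite sumEFin.
Qed.

Lemma Rintegral_sum (I : Type) (r : seq I) (P : pred I) (F : I -> T -> R) :
  (forall i, P i -> rintegrable (F i)) ->
  \int[m]_x (\sum_(i <- r | P i) F i x) = \sum_(i <- r | P i) \int[m]_x F i x.
Proof.
move=> iF; elim: r => [|i r IH].
  under eq_Rintegral do rewrite big_nil.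
  by rewrite big_nil -[X in X = _]/(Rintegral _ _ (cst 0)) Rintegral_cst// mul0r.
rewrite big_cons -IH.
under eq_Rintegral do rewrite big_cons.
case: ifPn => // Pi; rewrite RintegralD//; first exact: iF.
exact: rintegrable_sum.
Qed.

Lemma rintegrableMb f g : rintegrable f -> measurable_fun setT g ->
  (exists B, forall x, `|g x| <= B) -> rintegrable (fun x => f x * g x).
Proof.
move=> fi mg [B gB]; have := integrableMl measurableT fi mg; apply.
exists B; split; first exact: num_real.
by move=> M BM x _; exact: le_trans (gB x) (ltW BM).
Qed.

Lemma rintegrable_le f g : measurable_fun setT f -> rintegrable g ->
  (forall x, `|f x| <= g x) -> rintegrable f.
Proof.
move=> mf ig fg; apply: le_integrable ig => //; first exact/measurable_EFinP.
by move=> x _; rewrite lee_fin (le_trans (fg x))// ler_norm.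
Qed.

Lemma rintegrable_norm f : rintegrable f -> rintegrable (fun x => `|f x|).
Proof. by move=> /integrable_norm. Qed.

End real_integrals.

Section product_integral.
Context d1 d2 (T1 : measurableType d1) (T2 : measurableType d2) (R : realType).
Variables (m1 : {finite_measure set T1 -> \bar R})
          (m2 : {finite_measure set T2 -> \bar R}).

Lemma rintegrable_prod (f : T1 -> R) (g : T2 -> R) :
  rintegrable m1 f -> rintegrable m2 g ->
  rintegrable (finite_product m1 m2) (fun p => f p.1 * g p.2) /\
  \int[finite_product m1 m2]_p (f p.1 * g p.2) =
  \int[m1]_x f x * \int[m2]_y g y.
Proof.
move=> fi gi; have mf := rintegrable_measurable fi.
have mg := rintegrable_measurable gi.
have mfg : measurable_fun setT (fun p : T1 * T2 => (f p.1 * g p.2)%:E).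
  apply/measurable_EFinP; apply: measurable_funM.
    exact: measurableT_comp mf measurable_fst.
  exact: measurableT_comp mg measurable_snd.
have ifg : rintegrable (finite_product m1 m2) (fun p => f p.1 * g p.2).
  apply/(integrable12ltyP m1 m2 mfg).
  rewrite (_ : (fun x => _) = (fun x => `|f x|%:E * \int[m2]_y `|g y|%:E)%E); last first.
    apply/funext => x; rewrite -ge0_integralZl//=.
    - by apply: eq_integral => y _; rewrite normrM.
    - by apply/measurable_EFinP; exact: measurableT_comp.
  have gn := integrable_fin_num measurableT (rintegrable_norm gi).
  rewrite ge0_integralZr//=; last 2 first.
  - by apply/measurable_EFinP; exact: measurableT_comp.
  - by apply: integral_ge0 => y _; rewrite lee_fin.
  apply: lte_mul_pinfty => //.
  - by apply: integral_ge0 => x _; rewrite lee_fin.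
  - exact: integrable_fin_num (rintegrable_norm fi).
  - by rewrite ltey_eq gn.
split => //.
rewrite /Rintegral -(integral12_prod_meas1 ifg) /fubini_F/=.
have ig := integrable_fin_num measurableT gi.
rewrite (_ : (fun x => _) = (fun x => (f x)%:E * (\int[m2]_y g y)%:E)%E); last first.
  apply/funext => x; rewrite /Rintegral fineK//=.
  under eq_integral do rewrite EFinM.
  by rewrite integralZl.
by rewrite integralZr//= fineM// ?integrable_fin_num.
Qed.

End product_integral.

Section image_integral.
Context d1 d2 (T1 : measurableType d1) (T2 : measurableType d2) (R : realType).
Variables (m : {finite_measure set T1 -> \bar R}) (f : T1 -> T2).
Variable mf : measurable_fun setT f.

Lemma rintegrable_image (g : T2 -> R) : measurable_fun setT g ->
  rintegrable m (g \o f) ->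
  rintegrable (image_measure m mf) g /\
  \int[image_measure m mf]_y g y = \int[m]_x g (f x).
Proof.
move=> mg gi; split.
  by apply: (integrable_pushforward mf) => //; exact/measurable_EFinP.
rewrite /Rintegral; congr fine.
by apply: (integral_pushforward mf) => //; exact/measurable_EFinP.
Qed.

End image_integral.

Section complex_integrals.
Context d (T : measurableType d) (R : realType) (m : {measure set T -> \bar R}).
Implicit Types F G : T -> R[i].

Definition cmeasurable F :=
  measurable_fun setT (fun x => complex.Re (F x)) /\
  measurable_fun setT (fun x => complex.Im (F x)).

Definition cintegrable F :=
  rintegrable m (fun x => complex.Re (F x)) /\
  rintegrable m (fun x => complex.Im (F x)).

Definition cint F : R[i] :=
  (\int[m]_x complex.Re (F x)) +i* (\int[m]_x complex.Im (F x)).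

Lemma cintegrable_measurable F : cintegrable F -> cmeasurable F.
Proof. by move=> [a b]; split; exact: (@rintegrable_measurable _ _ _ m). Qed.

Lemma cReD (z w : R[i]) : complex.Re (z + w) = complex.Re z + complex.Re w.
Proof. by case: z w => a b []. Qed.

Lemma cImD (z w : R[i]) : complex.Im (z + w) = complex.Im z + complex.Im w.
Proof. by case: z w => a b []. Qed.

Lemma cReM (z w : R[i]) : complex.Re (z * w) =
  complex.Re z * complex.Re w - complex.Im z * complex.Im w.
Proof. by case: z w => a b []. Qed.

Lemma cImM (z w : R[i]) : complex.Im (z * w) =
  complex.Re z * complex.Im w + complex.Im z * complex.Re w.
Proof. by case: z w => a b []. Qed.

Lemma cRe_sum (I : Type) (r : seq I) (P : pred I) (F : I -> R[i]) :
  complex.Re (\sum_(i <- r | P i) F i) = \sum_(i <- r | P i) complex.Re (F i).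
Proof. by apply: (big_morph (@complex.Re R)) => // z w; exact: cReD. Qed.

Lemma cIm_sum (I : Type) (r : seq I) (P : pred I) (F : I -> R[i]) :
  complex.Im (\sum_(i <- r | P i) F i) = \sum_(i <- r | P i) complex.Im (F i).
Proof. by apply: (big_morph (@complex.Im R)) => // z w; exact: cImD. Qed.

Lemma complexP (z w : R[i]) :
  complex.Re z = complex.Re w -> complex.Im z = complex.Im w -> z = w.
Proof. by case: z w => a b [c e] /= -> ->. Qed.

Lemma eq_cint F G : F =1 G -> cint F = cint G.
Proof. by move=> /funext ->. Qed.

Lemma cintegrable_sum (I : Type) (r : seq I) (P : pred I) (F : I -> T -> R[i]) :
  (forall i, P i -> cintegrable (F i)) ->
  cintegrable (fun x => \sum_(i <- r | P i) F i x) /\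
  cint (fun x => \sum_(i <- r | P i) F i x) = \sum_(i <- r | P i) cint (F i).
Proof.
move=> iF; rewrite /cintegrable /cint.
under eq_fun do rewrite cRe_sum.
under [X in _ /\ rintegrable _ X]eq_fun do rewrite cIm_sum.
split.
  by split; apply: rintegrable_sum => i /iF[].
under [X in _ +i* X]eq_Rintegral do rewrite cIm_sum.
rewrite !Rintegral_sum; [|by move=> i /iF[]..].
by apply: complexP; rewrite /= ?cRe_sum ?cIm_sum.
Qed.

Lemma cintegrableZ (c : R[i]) F : cintegrable F ->
  cintegrable (fun x => c * F x) /\ cint (fun x => c * F x) = c * cint F.
Proof.
move=> [fr fi]; rewrite /cintegrable /cint.
under eq_fun do rewrite cReM.
under [X in _ /\ rintegrable _ X]eq_fun do rewrite cImM.
split.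
  by split; [apply: rintegrableB|apply: rintegrableD]; exact: rintegrableZ.
under [X in _ +i* X]eq_Rintegral do rewrite cImM.
rewrite RintegralB ?RintegralD ?RintegralZl//; try exact: rintegrableZ.
by apply: complexP; rewrite /= ?cReM ?cImM.
Qed.

Lemma cintegrableD F G : cintegrable F -> cintegrable G ->
  cintegrable (fun x => F x + G x) /\ cint (fun x => F x + G x) = cint F + cint G.
Proof.
move=> [fr fi] [gr gi]; rewrite /cintegrable /cint.
under eq_fun do rewrite cReD.
under [X in _ /\ rintegrable _ X]eq_fun do rewrite cImD.
split; first by split; exact: rintegrableD.
under [X in _ +i* X]eq_Rintegral do rewrite cImD.
by rewrite !RintegralD.
Qed.

Lemma cintegrable_conj F : cintegrable F ->
  cintegrable (fun x => (F x)^*) /\ cint (fun x => (F x)^*) = (cint F)^*.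
Proof.
move=> [fr fi]; rewrite /cintegrable /cint.
have rE z : complex.Re (z^* : R[i]) = complex.Re z by case: z.
have iE z : complex.Im (z^* : R[i]) = - complex.Im z by case: z.
under eq_fun do rewrite rE.
under [X in _ /\ rintegrable _ X]eq_fun do rewrite iE.
split; first by split => //; exact: rintegrableN.
under [X in _ +i* X]eq_Rintegral do rewrite iE -mulN1r.
by rewrite RintegralZl// mulN1r.
Qed.

Lemma cmeasurableM F G : cmeasurable F -> cmeasurable G ->
  cmeasurable (fun x => F x * G x).
Proof.
move=> [? ?] [? ?]; split.
  under eq_fun do rewrite cReM.
  by apply: measurable_funB; exact: measurable_funM.
under eq_fun do rewrite cImM.
by apply: measurable_funD; exact: measurable_funM.
Qed.

Lemma cmeasurableD F G : cmeasurable F -> cmeasurable G ->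
  cmeasurable (fun x => F x + G x).
Proof.
move=> [? ?] [? ?]; split.
  by under eq_fun do rewrite cReD; exact: measurable_funD.
by under eq_fun do rewrite cImD; exact: measurable_funD.
Qed.

Lemma cmeasurable_cst c : cmeasurable (cst c).
Proof. by split; exact: measurable_cst. Qed.

Lemma cmeasurable_conj F : cmeasurable F -> cmeasurable (fun x => (F x)^*).
Proof.
move=> [? ?]; split.
  by rewrite (_ : (fun x => _) = (fun x => complex.Re (F x)))//; apply/funext => x; case: (F x).
rewrite (_ : (fun x => _) = (fun x => - complex.Im (F x))); first exact: measurableT_comp.
by apply/funext => x; case: (F x).
Qed.

Lemma cmeasurable_cexp F : cmeasurable F -> cmeasurable (fun x => cexp (F x)).
Proof.
move=> [? ?]; split => /=; apply: measurable_funM.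
- exact: measurableT_comp.
- by apply: measurableT_comp => //; apply: continuous_measurable_fun; exact: continuous_cos.
- exact: measurableT_comp.
- by apply: measurableT_comp => //; apply: continuous_measurable_fun; exact: continuous_sin.
Qed.

Lemma cmeasurable_normc F : cmeasurable F -> measurable_fun setT (fun x => normc (F x)).
Proof.
move=> [mr mi].
rewrite (_ : (fun x => _) = (fun x => Num.sqrt (complex.Re (F x) ^+ 2 + complex.Im (F x) ^+ 2))).
  apply: (@measurableT_comp _ _ _ _ _ _ (@Num.sqrt R)).
    by apply: continuous_measurable_fun; exact: sqrt_continuous.
  by apply: measurable_funD; exact: measurable_funX.
by apply/funext => x; case: (F x).
Qed.

Lemma cintegrable_le F (g : T -> R) : cmeasurable F -> rintegrable m g ->
  (forall x, normc (F x) <= g x) -> cintegrable F.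
Proof.
move=> [mr mi] ig Fg; split; apply: (rintegrable_le _ ig) => // x.
  by apply: (le_trans (norm_Re_le_normc (F x))); exact: Fg.
by apply: (le_trans (norm_Im_le_normc (F x))); exact: Fg.
Qed.

Lemma cintegrable_normc F : cintegrable F -> rintegrable m (fun x => normc (F x)).
Proof.
move=> iF; have [mr mi] := cintegrable_measurable iF.
case: iF => /rintegrable_norm ir /rintegrable_norm ii.
apply: (rintegrable_le _ (rintegrableD ir ii)).
  exact: cmeasurable_normc.
by move=> x; rewrite ger0_norm ?normc_ge0// normc_le_ReIm.
Qed.

Lemma cintegrableMb F G : cintegrable F -> cmeasurable G ->
  (exists B, forall x, normc (G x) <= B) -> cintegrable (fun x => F x * G x).
Proof.
move=> iF mG [B GB].
apply: (@cintegrable_le _ (fun x => B * normc (F x))).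
- by apply: cmeasurableM => //; exact: cintegrable_measurable.
- by apply: rintegrableZ; exact: cintegrable_normc.
- by move=> x; rewrite normcM mulrC ler_wpM2r// normc_ge0.
Qed.

End complex_integrals.

Section complex_product_integral.
Context d1 d2 (T1 : measurableType d1) (T2 : measurableType d2) (R : realType).
Variables (m1 : {finite_measure set T1 -> \bar R})
          (m2 : {finite_measure set T2 -> \bar R}).

Lemma cintegrable_prod (F : T1 -> R[i]) (G : T2 -> R[i]) :
  cintegrable m1 F -> cintegrable m2 G ->
  cintegrable (finite_product m1 m2) (fun p => F p.1 * G p.2) /\
  cint (finite_product m1 m2) (fun p => F p.1 * G p.2) = cint m1 F * cint m2 G.
Proof.
move=> [fr fi] [gr gi]; rewrite /cintegrable /cint.
have [rr rrE] := rintegrable_prod fr gr; have [ri riE] := rintegrable_prod fr gi.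
have [ir irE] := rintegrable_prod fi gr; have [ii iiE] := rintegrable_prod fi gi.
under eq_fun do rewrite cReM.
under [X in _ /\ rintegrable _ X]eq_fun do rewrite cImM.
split.
  by split; [exact: rintegrableB|exact: rintegrableD].
under [X in _ +i* X]eq_Rintegral do rewrite cImM.
by rewrite RintegralB// RintegralD// rrE riE irE iiE.
Qed.

End complex_product_integral.

Section complex_image_integral.
Context d1 d2 (T1 : measurableType d1) (T2 : measurableType d2) (R : realType).
Variables (m : {finite_measure set T1 -> \bar R}) (f : T1 -> T2).
Variable mf : measurable_fun setT f.

Lemma cintegrable_image (G : T2 -> R[i]) : cmeasurable G ->
  cintegrable m (G \o f) ->
  cintegrable (image_measure m mf) G /\
  cint (image_measure m mf) G = cint m (G \o f).
Proof.
move=> [mr mi] [gr gi]; rewrite /cintegrable /cint.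
have [? rE] := rintegrable_image mf mr gr; have [? iE] := rintegrable_image mf mi gi.
by split => //; rewrite rE iE.
Qed.

End complex_image_integral.

Section tuple_power_integral.
Context d (T : measurableType d) (R : realType).
Variable m : {finite_measure set T -> \bar R}.

Lemma cmeasurable_prod_tnth n (F : 'I_n -> T -> R[i]) :
  (forall k, cmeasurable (F k)) ->
  cmeasurable (fun z : n.-tuple T => \prod_k F k (tnth z k)).
Proof.
move=> mF; elim: (index_enum _) => [|k r IH].
  by under eq_fun do rewrite big_nil; exact: cmeasurable_cst.
under eq_fun do rewrite big_cons; apply: cmeasurableM => //.
have [mr mi] := mF k.
by split; [exact: (measurableT_comp mr (measurable_tnth k))|
           exact: (measurableT_comp mi (measurable_tnth k))].
Qed.

(** Fubini along the recursion of [tuple_power]: the head variable is split off. On the empty tuple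
    the measure is a point mass, so the empty product integrates to 1. *)
Lemma cintegrable_tuple_power n (F : 'I_n -> T -> R[i]) :
  (forall k, cintegrable m (F k)) ->
  cintegrable (tuple_power m n) (fun z => \prod_k F k (tnth z k)) /\
  cint (tuple_power m n) (fun z => \prod_k F k (tnth z k)) =
    \prod_k cint m (F k).
Proof.
elim: n F => [|n IH] F iF.
  rewrite big_ord0; under [X in cintegrable _ X]eq_fun do rewrite big_ord0.
  under eq_cint do rewrite big_ord0.
  split; first by split; exact: finite_measure_integrable_cst.
  apply: complexP; rewrite /= -[X in X = _]/(Rintegral _ _ (cst _)) Rintegral_cst//.
    by rewrite mul1r [X in fine X](_ : _ = 1%E)//; exact: diracT.
  by rewrite mul0r.
have [ti tE] := IH (fun k => F (lift ord0 k)) (fun k => iF (lift ord0 k)).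
have [pi pE] := cintegrable_prod (iF ord0) ti.
have mF := cmeasurable_prod_tnth (fun k => cintegrable_measurable (iF k)).
have E : (fun z => \prod_k F k (tnth z k)) \o @tuple_cons _ T n =
  (fun p : T * n.-tuple T => F ord0 p.1 * \prod_k F (lift ord0 k) (tnth p.2 k)).
  apply/funext => -[x z] /=; rewrite big_ord_recl; congr (_ * _).
  by apply: eq_bigr => k _; rewrite /tuple_cons/= !(tnth_nth x).
have [iI iE] := cintegrable_image (@measurable_tuple_cons _ T n)
  (m := finite_product m (tuple_power m n)) mF (eq_ind_r (cintegrable _) pi E).
by split => //; rewrite /= iE E pE tE big_ord_recl.
Qed.

End tuple_power_integral.

(** * Gram matrices and the Laplace transform *)

Section andreief.
Context d (T : measurableType d) (R : realType).
Variable m : {finite_measure set T -> \bar R}.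
Variables (n : nat) (p : 'I_n -> T -> R[i]) (w : T -> R[i]).

(** For orthonormal [p] this is, up to transposition, the matrix of multiplication by [u] compressed
    to the span of [p]. *)
Definition gram (u : T -> R[i]) : 'M[R[i]]_n :=
  \matrix_(i, j) cint m (fun x => p i x * (p j x)^* * u x).

Definition slater (z : n.-tuple T) : R[i] :=
  \det (\matrix_(i, k) p i (tnth z k)).

Hypothesis ip : forall i j, cintegrable m (fun x => p i x * (p j x)^* * w x).

(** Both determinants are expanded over permutations s and t, and each product integrates factor by
    factor. With t = s u the sign of s drops out and the product over k is reindexed by s, so each
    of the n! choices of s contributes the same determinant. *)
Lemma andreief :
  cintegrable (tuple_power m n)
    (fun z => slater z * (slater z)^* * \prod_k w (tnth z k)) /\
  cint (tuple_power m n)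
    (fun z => slater z * (slater z)^* * \prod_k w (tnth z k)) =
  n`!%:R * \det (gram w).
Proof.
pose t2 (s t : {perm 'I_n}) (z : n.-tuple T) : R[i] := \prod_k (p (s k) (tnth z k) *
  (p (t k) (tnth z k))^* * w (tnth z k)).
have it2 (s t : {perm 'I_n}) := cintegrable_tuple_power (fun k => ip (s k) (t k)).
have E : (fun z => slater z * (slater z)^* * \prod_k w (tnth z k)) =
    (fun z => \sum_(s : {perm 'I_n}) \sum_(t : {perm 'I_n}) ((-1) ^+ s * (-1) ^+ t) * t2 s t z).
  apply/funext => z.
  have slE : slater z = \sum_(s : {perm 'I_n}) (-1) ^+ s * \prod_k p (s k) (tnth z k).
    rewrite /slater -det_tr; apply: eq_bigr => s _; congr (_ * _).
    by apply: eq_bigr => k _; rewrite !mxE.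
  rewrite slE rmorph_sum big_distrl big_distrl/=; apply: eq_bigr => s _.
  rewrite big_distrr big_distrl/=; apply: eq_bigr => t _.
  rewrite rmorphM rmorphXn rmorphN1 rmorph_prod.
  by rewrite /t2 !big_split/= mulrACA -!mulrA.
have iZ (s t : {perm 'I_n}) := cintegrableZ ((-1) ^+ s * (-1) ^+ t) (it2 s t).1.
have iS s := cintegrable_sum (index_enum _) (P := predT)
  (fun t _ => (iZ s t).1).
have [iSS iSSE] := cintegrable_sum (index_enum _) (P := predT)
  (fun s _ => (iS s).1).
rewrite E; split => //; rewrite iSSE.
rewrite (eq_bigr (fun=> \det (gram w))); last first.
  move=> s _; rewrite (iS s).2 (reindex (fun u => s * u)%g)/=; last first.
    by exists (fun u => s^-1 * u)%g => u _; rewrite ?mulKg ?mulKVg.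
  apply: eq_bigr => u _; rewrite (iZ s _).2 (it2 s _).2 odd_permM signr_addb.
  rewrite mulrA -expr2 sqrr_sign mul1r; congr (_ * _).
  rewrite [RHS](reindex_perm s)/=; apply: eq_bigr => k _.
  by rewrite !mxE permM.
rewrite sumr_const mulr_natl; congr (_ *+ _).
rewrite (eq_card (B := perm_on [set : 'I_n]%SET)).
  by rewrite card_perm /= cardsE /= card_ord.
move=> s; rewrite [LHS]unfold_in [RHS]unfold_in.
by apply/esym/fintype.subsetP => i _; rewrite finset.in_setT.
Qed.

End andreief.

Section complex_morphisms.
Variable R : realType.
Implicit Types z w : R[i].

Lemma conjcM z w : (z * w)^* = z^* * w^*. Proof. exact: rmorphM. Qed.

Lemma conjcD z w : (z + w)^* = z^* + w^*. Proof. exact: rmorphD. Qed.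

Lemma conjcN z : (- z)^* = - z^*. Proof. exact: rmorphN. Qed.

Lemma conjc_sum (I : Type) (r : seq I) (P : pred I) (F : I -> R[i]) :
  (\sum_(i <- r | P i) F i)^* = \sum_(i <- r | P i) (F i)^*.
Proof. exact: rmorph_sum. Qed.

Lemma realc_sum (I : Type) (r : seq I) (P : pred I) (F : I -> R) :
  (\sum_(i <- r | P i) F i)%:C = \sum_(i <- r | P i) (F i)%:C :> R[i].
Proof. exact: rmorph_sum. Qed.

Lemma realcD (x y : R) : (x + y)%:C = x%:C + y%:C :> R[i]. Proof. exact: rmorphD. Qed.

Lemma realcN (x : R) : (- x)%:C = - x%:C :> R[i]. Proof. exact: rmorphN. Qed.

Lemma realcM (x y : R) : (x * y)%:C = x%:C * y%:C :> R[i]. Proof. exact: rmorphM. Qed.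

Lemma realcX (x : R) n : (x ^+ n)%:C = x%:C ^+ n :> R[i]. Proof. exact: rmorphXn. Qed.

End complex_morphisms.

Arguments cint : simpl never.
Arguments normc : simpl never.
Arguments cexp : simpl never.

Section square_integrable.
Context d (T : measurableType d) (R : realType) (m : {measure set T -> \bar R}).
Implicit Types f g : T -> R[i].

Definition L2c f := cmeasurable f /\ rintegrable m (fun x => normc (f x) ^+ 2).

Definition cdot f g : R[i] := cint m (fun x => f x * (g x)^*).

Arguments cdot : simpl never.

Lemma normc_conj (z : R[i]) : normc z^* = normc z.
Proof. by case: z => a b; rewrite /normc/= sqrrN. Qed.

Lemma L2cD f g : L2c f -> L2c g -> L2c (fun x => f x + g x).
Proof.
move=> [mf sf] [mg sg]; have mfg := cmeasurableD mf mg.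
split => //; apply: (rintegrable_le _ (rintegrableD (rintegrableZ 2 sf) (rintegrableZ 2 sg))).
  by apply: measurable_funX; exact: cmeasurable_normc.
move=> x; rewrite ger0_norm ?sqr_ge0//.
have := le_normcD (f x) (g x).
have := normc_ge0 (f x); have := normc_ge0 (g x); have := normc_ge0 (f x + g x).
set a := normc (f x); set b := normc (g x); set c := normc _ => c0 b0 a0 cab.
have : c ^+ 2 <= (a + b) ^+ 2 by rewrite lerXn2r// nnegrE addr_ge0.
have := sqr_ge0 (a - b); rewrite !sqrrD sqrrN; lra.
Qed.

Lemma L2cM f g : L2c f -> cmeasurable g -> (exists B, forall x, normc (g x) <= B) ->
  L2c (fun x => f x * g x).
Proof.
move=> [mf sf] mg [B gB]; have mfg := cmeasurableM mf mg.
split => //; apply: (rintegrable_le _ (rintegrableZ (B ^+ 2) sf)).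
  by apply: measurable_funX; exact: cmeasurable_normc.
move=> x; rewrite ger0_norm ?sqr_ge0// normcM exprMn mulrC ler_wpM2r ?sqr_ge0//.
have g0 := normc_ge0 (g x).
by rewrite lerXn2r// nnegrE (le_trans g0).
Qed.

Lemma L2cZ (c : R[i]) f : L2c f -> L2c (fun x => c * f x).
Proof.
move=> lf; have := L2cM lf (cmeasurable_cst T c).
rewrite (_ : (fun x => f x * _) = (fun x => c * f x)); last first.
  by apply/funext => x; rewrite mulrC.
by apply; exists (normc c).
Qed.

Lemma L2c_sum (I : Type) (r : seq I) (F : I -> T -> R[i]) :
  (forall i, L2c (F i)) -> L2c (fun x => \sum_(i <- r) F i x).
Proof.
move=> lF; elim: r => [|i r IH].
  under eq_fun do rewrite big_nil; split; first exact: cmeasurable_cst.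
  by under eq_fun do rewrite normc0 expr0n/=; exact: integrable0.
by under eq_fun do rewrite big_cons; exact: L2cD.
Qed.

Lemma cintegrable_cdot f g : L2c f -> L2c g -> cintegrable m (fun x => f x * (g x)^*).
Proof.
move=> [mf sf] [mg sg]; apply: (cintegrable_le _ (rintegrableD sf sg)).
  by apply: cmeasurableM => //; exact: cmeasurable_conj.
move=> x; rewrite normcM normc_conj.
have := sqr_ge0 (normc (f x) - normc (g x)); rewrite sqrrD sqrrN.
have := mulr_ge0 (normc_ge0 (f x)) (normc_ge0 (g x)); lra.
Qed.

Lemma cdot_sumZl n (c : 'I_n -> R[i]) (F : 'I_n -> T -> R[i]) g :
  (forall i, L2c (F i)) -> L2c g ->
  cdot (fun x => \sum_i c i * F i x) g = \sum_i c i * cdot (F i) g.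
Proof.
move=> lF lg; rewrite /cdot.
under eq_cint do rewrite mulr_suml; under eq_cint do under eq_bigr do rewrite -mulrA.
have iF i := cintegrableZ (c i) (cintegrable_cdot (lF i) lg).
rewrite (cintegrable_sum (index_enum _) (P := predT) (fun i _ => (iF i).1)).2.
by apply: eq_bigr => i _; exact: (iF i).2.
Qed.

Lemma cdotC f g : L2c f -> L2c g -> cdot g f = (cdot f g)^*.
Proof.
move=> lf lg; rewrite -(cintegrable_conj (cintegrable_cdot lf lg)).2.
by apply: eq_cint => x; rewrite conjcM conjcK mulrC.
Qed.

Lemma cdot_sumZr n (c : 'I_n -> R[i]) (F : 'I_n -> T -> R[i]) g :
  (forall i, L2c (F i)) -> L2c g ->
  cdot g (fun x => \sum_i c i * F i x) = \sum_i (c i)^* * cdot g (F i).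
Proof.
move=> lF lg; have lS : L2c (fun x => \sum_i c i * F i x).
  by apply: L2c_sum => i; exact: L2cZ.
rewrite cdotC// cdot_sumZl// conjc_sum; apply: eq_bigr => i _.
by rewrite conjcM -cdotC.
Qed.

Lemma cdotDl f g h : L2c f -> L2c g -> L2c h ->
  cdot (fun x => f x + g x) h = cdot f h + cdot g h.
Proof.
move=> lf lg lh; rewrite /cdot; under eq_cint do rewrite mulrDl.
by rewrite (cintegrableD (cintegrable_cdot lf lh) (cintegrable_cdot lg lh)).2.
Qed.

Lemma cdotDr f g h : L2c f -> L2c g -> L2c h ->
  cdot h (fun x => f x + g x) = cdot h f + cdot h g.
Proof.
move=> lf lg lh; rewrite cdotC//; last exact: L2cD.
by rewrite cdotDl// conjcD -!cdotC.
Qed.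

Lemma cdot_self f : L2c f -> cdot f f = (\int[m]_x normc (f x) ^+ 2)%:C.
Proof.
move=> lf; rewrite /cdot /cint; apply: complexP => /=.
  by apply: eq_Rintegral => x _; rewrite -normc_sqr_conj.
rewrite (@eq_Rintegral _ _ _ _ _ (cst 0)); last by move=> x _; rewrite -normc_sqr_conj.
by rewrite Rintegral_cst// mul0r.
Qed.

Lemma bessel n (phi : 'I_n -> T -> R[i]) g : (forall i, L2c (phi i)) -> L2c g ->
  (forall i j, cdot (phi i) (phi j) = (i == j)%:R) ->
  \sum_i normc (cdot (phi i) g) ^+ 2 <= \int[m]_x normc (g x) ^+ 2.
Proof.
move=> lphi lg orth; set s := \sum_i _.
pose c i := cdot (phi i) g.
(* Minus the orthogonal projection of [g] on the span of [phi]; the inequality is the nonnegativity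
   of the squared norm of g + h. *)
pose h x := \sum_i (- (c i)^*) * phi i x.
have lh : L2c h by apply: L2c_sum => i; exact: L2cZ.
have hg : cdot h g = - s%:C.
  rewrite /h cdot_sumZl// /s realc_sum -sumrN; apply: eq_bigr => i _.
  by rewrite normc_sqr_conj mulNr mulrC.
have gh : cdot g h = - s%:C by rewrite cdotC// hg conjcN conjc_real.
have hh : cdot h h = s%:C.
  rewrite {1}/h cdot_sumZl// /s realc_sum; apply: eq_bigr => i _.
  rewrite /h cdot_sumZr// (bigD1 i)// orth eqxx mulr1 big1 ?Monoid.mulm1; last first.
    by move=> j ji; rewrite orth eq_sym (negbTE ji) mulr0.
  by rewrite conjcN conjcK mulrNN mulrC normc_sqr_conj.
have lgh := L2cD lg lh.
have : 0 <= \int[m]_x normc (g x + h x) ^+ 2.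
  by apply: Rintegral_ge0 => x _; exact: sqr_ge0.
have := cdot_self lgh; rewrite cdotDl// !cdotDr// hg gh hh (cdot_self lg).
rewrite addNr addr0 -realcN -realcD => /complexI <-.
by rewrite subr_ge0.
Qed.

End square_integrable.

Lemma normc_sum (R : realType) (I : Type) (r : seq I) (P : pred I) (F : I -> R[i]) :
  normc (\sum_(i <- r | P i) F i) <= \sum_(i <- r | P i) normc (F i).
Proof.
elim/big_rec2: _ => [|i x y _ h]; first by rewrite normc0.
by apply: le_trans (le_normcD _ _) _; rewrite lerD2l.
Qed.

Lemma normc_cexp (R : realType) (z : R[i]) : normc (cexp z) = expR (complex.Re z).
Proof.
rewrite /normc /cexp !exprMn -mulrDr cos2Dsin2 mulr1 sqrtr_sqr.
by rewrite ger0_norm// expR_ge0.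
Qed.

Section gram_change_of_basis.
Local Open Scope sesquilinear_scope.
Context d (T : measurableType d) (R : realType) (m : {finite_measure set T -> \bar R}).
Variables (n : nat) (e : 'I_n -> T -> R[i]).
Hypothesis le : forall i, L2c m (e i).

Lemma gram_dot (u : T -> R[i]) : cmeasurable u -> (exists B, forall x, normc (u x) <= B) ->
  forall i j, gram m e u i j = cdot m (fun x => e i x * u x) (e j).
Proof.
by move=> mu uB i j; rewrite mxE; apply: eq_cint => x; rewrite mulrAC.
Qed.

Definition rotate (P : 'M[R[i]]_n) (i : 'I_n) (x : T) : R[i] := \sum_k P i k * e k x.

Lemma L2c_rotate P i : L2c m (rotate P i).
Proof. by apply: L2c_sum => k; exact: L2cZ. Qed.

Lemma gram_rotate P (u : T -> R[i]) : cmeasurable u -> (exists B, forall x, normc (u x) <= B) ->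
  gram m (rotate P) u = P *m gram m e u *m P ^t*.
Proof.
move=> mu uB; apply/matrixP => i j.
have leu k : L2c m (fun x => e k x * u x) by exact: L2cM.
rewrite mxE (eq_cint m (G := fun x => (\sum_k P i k * (e k x * u x)) * (rotate P j x)^*)); last first.
  move=> x; rewrite mulrAC; congr (_ * _); rewrite mulr_suml.
  by apply: eq_bigr => k _; rewrite mulrA.
rewrite -/(cdot m (fun x => \sum_k P i k * (e k x * u x)) (rotate P j)).
rewrite cdot_sumZl//; last exact: L2c_rotate.
rewrite -mulmxA !mxE; apply: eq_bigr => k _; congr (_ * _).
rewrite /rotate cdot_sumZr// mxE; apply: eq_bigr => l _.
by rewrite gram_dot// !mxE mulrC.
Qed.

End gram_change_of_basis.

(** * Determinant of the Gram matrix of an exponential *)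

Section determinant_estimate.
Local Open Scope sesquilinear_scope.
Context d (T : measurableType d) (R : realType) (m : {finite_measure set T -> \bar R}).
Variables (n : nat) (e : 'I_n -> T -> R[i]) (u : T -> R) (B : R).
Hypothesis le : forall i, L2c m (e i).
Hypothesis orth : gram m e (cst 1) = 1%:M.
Hypothesis mu : measurable_fun setT u.
Hypothesis uB : forall x, `|u x| <= B.

Let uc (x : T) : R[i] := (u x)%:C.

(** For orthonormal [e], the variance of the sum of [u] over the points of the determinantal process
    whose kernel is the projection on the span of [e]. Being made of traces, it does not depend on
    the choice of orthonormal basis. *)
Definition variance_form : R[i] :=
  \tr (gram m e (fun x => uc x ^+ 2)) - \tr (gram m e uc *m gram m e uc).

Let cmeasurable_real (v : T -> R) : measurable_fun setT v -> cmeasurable (fun x => (v x)%:C).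
Proof. by move=> mv; split => //; exact: measurable_cst. Qed.

Let bounded_real (v : T -> R) C : (forall x, `|v x| <= C) ->
  exists C, forall x, normc ((v x)%:C : R[i]) <= C.
Proof. by move=> vC; exists C => x; rewrite normcR. Qed.

Let bounded_1 : exists C : R, forall x : T, normc (cst (1 : R[i]) x) <= C.
Proof. by exists 1 => x; rewrite normc1. Qed.

Lemma gram_real_hermsym : gram m e uc \is hermsymmx.
Proof.
apply/is_hermitianmxP; rewrite expr0 scale1r; apply/matrixP => i j.
rewrite !mxE -[LHS]conjcK; congr conjc.
rewrite -(cintegrable_conj _).2; last first.
  apply: cintegrableMb; [exact: cintegrable_cdot|exact: cmeasurable_real|].
  exact: (bounded_real uB).
by apply: eq_cint => x; rewrite !conjcM conjcK conjc_real [X in X * _]mulrC.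
Qed.

(* Rotating [e] to diagonalise the compression of [u] kills the first-order
   term of the determinant exactly. *)
Lemma diagonalising_basis : exists (phi : 'I_n -> T -> R[i]) (a : 'I_n -> R),
  [/\ forall i, L2c m (phi i),
      forall i j, cdot m (phi i) (phi j) = (i == j)%:R,
      forall i j, gram m phi uc i j = (a i)%:C * (i == j)%:R,
      forall w, cmeasurable w -> (exists C, forall x, normc (w x) <= C) ->
        \det (gram m phi w) = \det (gram m e w) &
      (forall w, cmeasurable w -> (exists C, forall x, normc (w x) <= C) ->
        \tr (gram m phi w) = \tr (gram m e w)) /\
      \tr (gram m e uc *m gram m e uc) = \sum_i ((a i) ^+ 2)%:C].
Proof.
have H := gram_real_hermsym.
have /orthomx_spectralP := hermitian_normalmx H.
set P := spectralmx _; set D := spectral_diag _ => AE.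
have PU : P \is unitarymx := spectral_unitarymx _.
have Pu := unitarymx_unit PU.
have Dreal := hermitian_spectral_diag_real H; rewrite -/D in Dreal.
pose a i := complex.Re (D 0 i).
have DE i : D 0 i = (a i)%:C by rewrite /a RRe_real//; exact: (mxOverP Dreal).
have rotE w : cmeasurable w -> (exists C, forall x, normc (w x) <= C) ->
    gram m (rotate e P) w = P *m gram m e w *m invmx P.
  by move=> mw wB; rewrite invmx_unitary// gram_rotate.
have ucm : cmeasurable uc by exact: cmeasurable_real.
have ucB := bounded_real uB.
exists (rotate e P), a; split.
- by move=> i; exact: L2c_rotate.
- move=> i j; have := rotE _ (cmeasurable_cst T 1) bounded_1.
  rewrite orth mulmx1 mulmxV// => /matrixP /(_ i j); rewrite !mxE => <-.
  by apply: eq_cint => x; rewrite mulr1.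
- move=> i j; rewrite rotE// AE !mulmxA mulmxV// mul1mx mulmxK//.
  by rewrite !mxE DE mulr_natr.
- move=> w mw wB; rewrite rotE// !det_mulmx mulrAC -det_mulmx mulmxV// det1.
  by rewrite mul1r.
- split; first by move=> w mw wB; rewrite rotE// mxtrace_mulC mulmxA mulVmx// mul1mx.
  rewrite AE !mulmxA mulmxK// -!mulmxA mxtrace_mulC -!mulmxA mulmxV// mulmx1.
  rewrite mulmx_diag mxtrace_diag; apply: eq_bigr => i _.
  by rewrite !mxE DE -realcM -expr2.
Qed.

(** In the diagonalising basis exp(zeta a_j) is pulled out of column j of the Gram matrix. What
    remains is 1 + S, where S only sees the Taylor remainder of exp(zeta (u - a_j)) beyond its
    linear part. One factor (u - a_j)^2 is kept to build V and the others are bounded through |u -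
    a_j| <= 2 B: this is where uniform smallness of [u] enters. *)
Lemma det_cexp_estimate (zeta : R[i]) : normc zeta * (2 * B) <= 1 ->
  exists V : R, [/\ variance_form = V%:C, 0 <= V &
  exists S : 'M[R[i]]_n,
  [/\ \det (gram m e (fun x => cexp (zeta * uc x))) =
        cexp (zeta * \tr (gram m e uc)) * \det (1%:M + S),
      \sum_i \sum_j normc (S i j) ^+ 2 <=
        (cexp_const R + 1) ^+ 2 * normc zeta ^+ 4 * (2 * B) ^+ 2 * V &
      normc (\tr S - zeta ^+ 2 / 2%:R * V%:C) <=
        2 * (cexp_const R * normc zeta ^+ 3 * (2 * B) * V)]].
Proof.
move=> zB.
have [phi [a [lphi ophi dphi detE [trE a2]]]] := diagonalising_basis.
have ucm : cmeasurable uc by exact: cmeasurable_real.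
have ucB := bounded_real uB.
have lphiM i (w : T -> R[i]) : cmeasurable w -> (exists C, forall x, normc (w x) <= C) ->
    L2c m (fun x => phi i x * w x) by move=> mw wB; exact: L2cM.
have uc2B : exists C, forall x, normc (uc x ^+ 2) <= C.
  exists (B ^+ 2) => x; rewrite normcX normcR lerXn2r// nnegrE//.
  exact: le_trans (uB x).
have uc2m : cmeasurable (fun x => uc x ^+ 2).
  by under eq_fun do rewrite expr2; exact: cmeasurableM.
have phi1 j : \int[m]_x normc (phi j x) ^+ 2 = 1.
  by have := cdot_self (lphi j); rewrite ophi eqxx => /complexI.
have iX i j w : cmeasurable w -> (exists C, forall x, normc (w x) <= C) ->
    cintegrable m (fun x => phi i x * (phi j x)^* * w x).
  by move=> mw wB; apply: cintegrableMb => //; exact: cintegrable_cdot.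
have gramR j (v : T -> R) C : measurable_fun setT v -> (forall x, `|v x| <= C) ->
    rintegrable m (fun x => normc (phi j x) ^+ 2 * v x) /\
    gram m phi (fun x => (v x)%:C) j j = (\int[m]_x (normc (phi j x) ^+ 2 * v x))%:C.
  move=> mv vC; split.
    by apply: rintegrableMb => //; [exact: (lphi j).2|exists C].
  rewrite mxE; apply: complexP; rewrite /cint/=.
    by apply: eq_Rintegral => x _; rewrite -normc_sqr_conj -realcM.
  rewrite (@eq_Rintegral _ _ _ _ _ (cst 0)); last first.
    by move=> x _; rewrite -normc_sqr_conj -realcM.
  by rewrite Rintegral_cst// mul0r.
have [iu aE] : (forall j, rintegrable m (fun x => normc (phi j x) ^+ 2 * u x)) /\
    (forall j, a j = \int[m]_x (normc (phi j x) ^+ 2 * u x)).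
  split=> j; have [//] := gramR j _ _ mu uB.
  by rewrite dphi eqxx mulr1 => _ /complexI.
have aB j : `|a j| <= B.
  rewrite aE; apply: le_trans (le_normr_Rintegral _ (iu j)) _ => //.
  rewrite -[leRHS]mulr1 -(phi1 j) -RintegralZl//; last exact: (lphi j).2.
  apply: le_Rintegral => //.
  - exact: (rintegrable_norm (iu j)).
  - exact: (rintegrableZ B (lphi j).2).
  - by move=> x _; rewrite normrM mulrC (ger0_norm (sqr_ge0 _)) ler_wpM2r ?sqr_ge0.
have uaB j x : `|u x - a j| <= 2 * B.
  apply: le_trans (ler_normB _ _) _.
  by have := uB x; have := aB j; lra.
have mua j : measurable_fun setT (fun x => u x - a j) by exact: measurable_funB.
have mua2 j : measurable_fun setT (fun x => (u x - a j) ^+ 2) by exact: measurable_funX.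
have ua2B j x : `|(u x - a j) ^+ 2| <= (2 * B) ^+ 2.
  by rewrite normrX lerXn2r// nnegrE// (le_trans _ (uaB j x)).
(* [a j] is the mean of [u] under the probability density |phi_j|^2 and [s2 j] is the corresponding
   variance; the [s2 j] add up to the variance form. *)
pose s2 j := \int[m]_x (normc (phi j x) ^+ 2 * (u x - a j) ^+ 2).
have is2 j : rintegrable m (fun x => normc (phi j x) ^+ 2 * (u x - a j) ^+ 2).
  exact: (gramR j _ _ (mua2 j) (ua2B j)).1.
have vE : variance_form = (\sum_j s2 j)%:C.
  rewrite /variance_form a2 -trE// realc_sum -sumrB; apply: eq_bigr => j _.
  have u2B x : `|u x ^+ 2| <= B ^+ 2.
    by rewrite normrX lerXn2r// nnegrE// (le_trans _ (uB x)).
  have mu2 : measurable_fun setT (fun x => u x ^+ 2) by exact: measurable_funX.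
  have [iu2 ] := gramR j _ _ mu2 u2B.
  rewrite (_ : (fun x => (u x ^+ 2)%:C) = (fun x => uc x ^+ 2)); last first.
    by apply/funext => x; rewrite realcX.
  move=> ->; rewrite -realcN -realcD; congr _%:C.
  have -> : s2 j = \int[m]_x (normc (phi j x) ^+ 2 * u x ^+ 2 -
     (2 * a j) * (normc (phi j x) ^+ 2 * u x) + a j ^+ 2 * normc (phi j x) ^+ 2).
    by apply: eq_Rintegral => x _; ring.
  have iZ1 := rintegrableZ (2 * a j) (iu j).
  have iZ2 := rintegrableZ (a j ^+ 2) (lphi j).2.
  rewrite RintegralD//; last exact: rintegrableB.
  rewrite RintegralB// (RintegralZl _ measurableT (iu j)) (RintegralZl _ measurableT (lphi j).2).
  by rewrite phi1 -aE; ring.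
have V0 : 0 <= \sum_j s2 j.
  by apply: sumr_ge0 => j _; apply: Rintegral_ge0 => x _; rewrite mulr_ge0 ?sqr_ge0.
exists (\sum_j s2 j); split => //.
have z0 := normc_ge0 zeta.
pose z j x : R[i] := zeta * (u x - a j)%:C.
have zE j x : normc (z j x) = normc zeta * `|u x - a j| by rewrite normcM normcR.
have z1 j x : normc (z j x) <= 1.
  by rewrite zE (le_trans _ zB)// ler_wpM2l.
have mz j : cmeasurable (z j).
  by apply: cmeasurableM; [exact: cmeasurable_cst|exact: cmeasurable_real].
pose r j x : R[i] := cexp (z j x) - (1 + z j x).
have r1 j x : normc (r j x) <= (cexp_const R + 1) * normc zeta ^+ 2 * (u x - a j) ^+ 2.
  apply: le_trans (cexp_taylor1 (z1 j x)) _.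
  by rewrite zE exprMn real_normK ?num_real// mulrA.
have mr j : cmeasurable (r j).
  apply: cmeasurableD; first exact: cmeasurable_cexp.
  rewrite (_ : (fun x => _) = (fun x => (-1) * (1 + z j x))); last first.
    by apply/funext => x; rewrite mulN1r.
  apply: cmeasurableM; first exact: cmeasurable_cst.
  by apply: cmeasurableD => //; exact: cmeasurable_cst.
have K0 : 0 <= cexp_const R + 1 by rewrite addr_ge0// cexp_const_ge0.
have rB j : exists C, forall x, normc (r j x) <= C.
  exists ((cexp_const R + 1) * normc zeta ^+ 2 * (2 * B) ^+ 2) => x.
  apply: le_trans (r1 j x) _; rewrite ler_wpM2l//.
    by rewrite mulr_ge0// exprn_ge0.
  by rewrite -[leLHS]ger0_norm ?sqr_ge0.
pose S : 'M[R[i]]_n := \matrix_(i, j) cint m (fun x => phi i x * (phi j x)^* * r j x).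
have iXu i j := iX i j _ ucm ucB.
have iXr i j := iX i j _ (mr j) (rB j).
have i1 i j : cintegrable m (fun x => phi i x * (phi j x)^*) by exact: cintegrable_cdot.
have cexpB (c : R) : exists C, forall x, normc (cexp (zeta * (u x - c)%:C)) <= C.
  exists (expR (normc zeta * (B + `|c|))) => x; rewrite normc_cexp ler_expR.
  apply: le_trans (ler_norm _) _; apply: le_trans (norm_Re_le_normc _) _.
  rewrite normcM normcR ler_wpM2l// (le_trans (ler_normB _ _))//.
  by rewrite lerD2r.
(* The linear part contributes zeta (a_j - a_j) on the diagonal and 0 off it, because [phi]
   diagonalises the compression of [u]. *)
have SE i j : cint m (fun x => phi i x * (phi j x)^* * cexp (z j x)) = (i == j)%:R + S i j.
  rewrite mxE.
  have [iA EA] := cintegrableZ (1 - zeta * (a j)%:C) (i1 i j).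
  have [iB EB] := cintegrableZ zeta (iXu i j).
  have [iAB EAB] := cintegrableD iA iB.
  have [_ E] := cintegrableD iAB (iXr i j).
  rewrite (eq_cint m (G := fun x => (1 - zeta * (a j)%:C) * (phi i x * (phi j x)^*) +
    zeta * (phi i x * (phi j x)^* * uc x) + phi i x * (phi j x)^* * r j x)); last first.
    by move=> x; rewrite /r /z realcD realcN; ring.
  rewrite E EAB EA EB; congr (_ + _).
  have := dphi i j; rewrite mxE => ->; rewrite -/(cdot m (phi i) (phi j)) ophi.
  by have [->|_] := eqVneq i j; rewrite ?mulr0 ?addr0 // !mulr1 subrK.
exists S.
split.
- set w := fun x => cexp (zeta * uc x).
  have mw : cmeasurable w.
    by apply: cmeasurable_cexp; apply: cmeasurableM => //; exact: cmeasurable_cst.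
  have wB : exists C, forall x, normc (w x) <= C.
    by have [C CP] := cexpB 0; exists C => x; have := CP x; rewrite subr0.
  rewrite -detE// -trE//.
  (* In column j, exp(zeta u) is written as exp(zeta (u - a_j)) exp(zeta a_j), which produces the
     diagonal factor on the right. *)
  have -> : gram m phi w = (1%:M + S) *m diag_mx (\row_j cexp (zeta * (a j)%:C)).
    apply/matrixP => i j; rewrite mul_mx_diag 3!mxE [1%:M i j]mxE -SE mxE.
    have zB' : cintegrable m (fun x => phi i x * (phi j x)^* * cexp (z j x)).
      by apply: iX; [exact: cmeasurable_cexp|exact: cexpB].
    rewrite [RHS]mulrC -(cintegrableZ (cexp (zeta * (a j)%:C)) zB').2; apply: eq_cint => x.
    rewrite mulrCA; congr (_ * _); rewrite /w -cexpD /z -mulrDr; congr (cexp (_ * _)).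
    by rewrite -realcD addrC subrK.
  rewrite det_mulmx det_diag mulrC; congr (_ * _).
  rewrite /mxtrace mulr_sumr cexp_sum; apply: eq_bigr => j _.
  by rewrite mxE dphi eqxx mulr1.
- rewrite exchange_big/= mulr_sumr; apply: ler_sum => j _.
  have mrc : cmeasurable (fun x => (r j x)^*) by exact: cmeasurable_conj.
  have rcB : exists C, forall x, normc ((r j x)^*) <= C.
    by have [C CP] := rB j; exists C => x; rewrite normc_conj.
  have lg := lphiM j _ mrc rcB.
  have Sd i : S i j = cdot m (phi i) (fun x => phi j x * (r j x)^*).
    by rewrite mxE; apply: eq_cint => x; rewrite conjcM conjcK mulrA.
  under eq_bigr do rewrite Sd.
  (* Column j of [S] lists coefficients on the orthonormal system [phi] of a single function, so its
     squared norm is bounded by one integral. *)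
  apply: le_trans (bessel lphi lg ophi) _.
  rewrite -RintegralZl//; last exact: is2.
  apply: le_Rintegral => //; [exact: lg.2|exact: (rintegrableZ _ (is2 j))|].
  move=> x _; rewrite normcM normc_conj exprMn [leRHS]mulrCA ler_wpM2l ?sqr_ge0//.
  have := ler_pM (normc_ge0 _) (normc_ge0 _) (r1 j x) (r1 j x).
  rewrite -expr2 => /le_trans; apply.
  set K1 := cexp_const R + 1; set U := (u x - a j) ^+ 2.
  rewrite [leLHS](_ : _ = K1 ^+ 2 * normc zeta ^+ 4 * U * U); last by ring.
  rewrite ler_wpM2r ?sqr_ge0// ler_wpM2l ?mulr_ge0 ?sqr_ge0 ?exprn_ge0//.
  by rewrite -[leLHS]ger0_norm ?sqr_ge0//; exact: ua2B.
- pose K := cexp_const R * normc zeta ^+ 3 * (2 * B).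
  have E j : S j j - zeta ^+ 2 / 2%:R * (s2 j)%:C =
      cint m (fun x => phi j x * (phi j x)^* * (r j x - z j x ^+ 2 / 2%:R)).
    have [iv gv] := gramR j _ _ (mua2 j) (ua2B j).
    have cv : cintegrable m (fun x => phi j x * (phi j x)^* * ((u x - a j) ^+ 2)%:C).
      by apply: iX; [exact: cmeasurable_real|exact: bounded_real (ua2B j)].
    have [iZ iZE] := cintegrableZ (- (zeta ^+ 2 / 2%:R)) cv.
    rewrite /s2 -gv !mxE -mulNr -iZE -(cintegrableD (iXr j j) iZ).2.
    by apply: eq_cint => x; rewrite /z exprMn realcX; ring.
  rewrite /mxtrace realc_sum mulr_sumr -sumrB; under eq_bigr do rewrite E.
  apply: le_trans (normc_sum _ _ _) _.
  rewrite 2!mulr_sumr; apply: ler_sum => j _.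
  have gi := rintegrableZ K (is2 j).
  have Fm : cmeasurable (fun x => phi j x * (phi j x)^* * (r j x - z j x ^+ 2 / 2%:R)).
    have mz2 : cmeasurable (fun x => z j x ^+ 2).
      by under eq_fun do rewrite expr2; exact: cmeasurableM.
    apply: cmeasurableM; first exact: cintegrable_measurable (i1 j j).
    rewrite (_ : (fun x => _) = (fun x => r j x + (- 2%:R^-1) * z j x ^+ 2)); last first.
      by apply/funext => x; rewrite mulNr mulrC.
    apply: cmeasurableD => //; apply: cmeasurableM => //; exact: cmeasurable_cst.
  have FK x : normc (phi j x * (phi j x)^* * (r j x - z j x ^+ 2 / 2%:R)) <=
      K * (normc (phi j x) ^+ 2 * (u x - a j) ^+ 2).
    have := cexp_taylor2 (z1 j x).
    rewrite (_ : _ - _ = r j x - z j x ^+ 2 / 2%:R); last by rewrite /r; ring.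
    move=> h; rewrite !normcM normc_conj -expr2 [leRHS]mulrCA ler_wpM2l ?sqr_ge0//.
    apply: le_trans h _; rewrite zE exprMn [`|_| ^+ 3]exprS real_normK ?num_real//.
    set U := (u x - a j) ^+ 2; set b := `|_|.
    rewrite [leLHS](_ : _ = cexp_const R * normc zeta ^+ 3 * b * U); last by ring.
    rewrite ler_wpM2r ?sqr_ge0// /K ler_wpM2l ?uaB//.
    by rewrite mulr_ge0 ?exprn_ge0// cexp_const_ge0.
  have [iFr iFi] := cintegrable_le Fm gi FK.
  (* Real and imaginary parts are bounded separately by the same quantity, hence the factor 2 in the
     trace estimate. *)
  apply: le_trans (normc_le_ReIm _) _; rewrite mulrDl !mul1r /cint/=.
  rewrite -(RintegralZl _ measurableT (is2 j)); apply: lerD.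
    apply: le_trans (le_normr_Rintegral _ iFr) _ => //.
    apply: le_Rintegral => //; first exact: (rintegrable_norm iFr).
    by move=> x _; apply: le_trans (norm_Re_le_normc _) _; exact: FK.
  apply: le_trans (le_normr_Rintegral _ iFi) _ => //.
  apply: le_Rintegral => //; first exact: (rintegrable_norm iFi).
  by move=> x _; apply: le_trans (norm_Im_le_normc _) _; exact: FK.
Qed.

End determinant_estimate.

Lemma bounded_normc_cst (R : realType) (T : Type) (c : R[i]) :
  exists B, forall x : T, normc (cst c x) <= B.
Proof. by exists (normc c). Qed.

Lemma Rintegral_FTC2 (R : realType) (f F : R -> R) (a b : R) : a < b ->
  continuous f -> (forall x : R, is_derive x 1 F (f x)) ->
  \int[lebesgue_measure]_(x in `[a, b]) f x = F b - F a.
Proof.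
move=> ab cf dF; rewrite /Rintegral (continuous_FTC2 (F := F))//.
- exact: continuous_subspaceT.
- have cF x : {for x, continuous F}.
    exact/differentiable_continuous/derivable1_diffP/ex_derive.
  split; first by move=> x _; apply: ex_derive.
  + by apply: cvg_at_right_filter; exact: cF.
  + by apply: cvg_at_left_filter; exact: cF.
- by move=> x _; rewrite derive1E; apply: derive_val.
Qed.

Lemma cReMl (R : realType) (a : R) (z : R[i]) : complex.Re (a%:C * z) = a * complex.Re z.
Proof. by rewrite cReM/= mul0r subr0. Qed.

Lemma cImMl (R : realType) (a : R) (z : R[i]) : complex.Im (a%:C * z) = a * complex.Im z.
Proof. by rewrite cImM/= mul0r addr0. Qed.

(** * The joint law and the orthonormal monomials *)

Section density.
Context d (T : measurableType d) (R : realType).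
Variables (m nu : {measure set T -> \bar R}) (g : T -> R).
Hypothesis mg : measurable_fun setT g.
Hypothesis g0 : forall x, 0 <= g x.
Hypothesis nuE : forall A, measurable A -> nu A = (\int[m]_(x in A) (g x)%:E)%E.

Import HBNNSimple.

Let integral_density_nnsfun (h : {nnsfun T >-> R}) :
  (\int[nu]_x (h x)%:E = \int[m]_x (h x * g x)%:E)%E.
Proof.
rewrite integralT_nnsfun sintegralE.
have mh r : measurable (h @^-1` [set r]) by [].
transitivity (\int[m]_x (\sum_(r \in range h) (r * (\1_(h @^-1` [set r]) x * g x))%:E))%E;
  last first.
  apply: eq_integral => x _; rewrite fsumEFin//; congr EFin.
  rewrite [in RHS](fimfunE h x) fsbig_finite//= [in RHS]fsbig_finite//= mulr_suml.
  by apply: eq_bigr => r _; rewrite mulrA.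
have hr r : range h r -> 0 <= r by move=> [y _ <-].
rewrite ge0_integral_fsum//; last 2 first.
- move=> r; apply/measurable_EFinP; apply: measurable_funM => //.
  exact: measurable_funM.
- move=> r x _; rewrite lee_fin mulrA; apply: mulr_ge0 => //.
  by have := nnfun_muleindic_ge0 h r x; rewrite lee_fin.
apply: eq_fsbigr => r /set_mem rh.
rewrite nuE// integral_mkcond.
under [in RHS]eq_integral do rewrite EFinM.
rewrite ge0_integralZl//; last 3 first.
- by apply/measurable_EFinP; apply: measurable_funM.
- by move=> x _; rewrite lee_fin mulr_ge0.
- by rewrite lee_fin; exact: hr.
congr (_ * _)%E; apply: eq_integral => x _.
by rewrite patchE indicE; case: ifPn => _; rewrite ?mul1r ?mul0r.
Qed.

Lemma ge0_integral_density (f : T -> \bar R) : measurable_fun setT f ->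
  (forall x, 0 <= f x)%E -> (\int[nu]_x f x = \int[m]_x (f x * (g x)%:E))%E.
Proof.
move=> mf f0; pose h := nnsfun_approx measurableT mf.
have hf x : (EFin \o h n) x @[n --> \oo] --> f x by apply: cvg_nnsfun_approx.
have hnd x : {homo (fun n => (h n x)%:E) : a b / (a <= b)%N >-> (a <= b)%E}.
  by move=> a b ab; rewrite lee_fin; exact/lefP/nd_nnsfun_approx.
transitivity (limn (fun n => \int[nu]_x (h n x)%:E)%E).
  rewrite -monotone_convergence//=.
  - by apply: eq_integral => x _; apply/esym/cvg_lim => //; exact: hf.
  - by move=> n; apply/measurable_EFinP.
  - by move=> n x _; rewrite lee_fin.
transitivity (limn (fun n => \int[m]_x (h n x * g x)%:E)%E).
  by apply: congr_lim; apply/funext => n; exact: integral_density_nnsfun.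
rewrite -monotone_convergence//=.
- apply: eq_integral => x _; apply/cvg_lim => //.
  by under eq_fun do rewrite EFinM; apply: cvgeZr => //; exact: hf.
- by move=> n; apply/measurable_EFinP; apply: measurable_funM.
- by move=> n x _; rewrite lee_fin mulr_ge0.
- by move=> x _ a b ab; rewrite !EFinM lee_wpmul2r ?lee_fin ?g0//; exact: (hnd x).
Qed.

(** Simple functions, monotone limits, then positive and negative parts. It serves three measures
    given by a density: the joint law, the angle measure and the normal law. *)
Lemma rintegral_density (f : T -> R) : measurable_fun setT f ->
  rintegrable m (fun x => f x * g x) ->
  rintegrable nu f /\ \int[nu]_x f x = \int[m]_x (f x * g x).
Proof.
move=> mf ifg; have ifnu : rintegrable nu f.
  apply/integrableP; split; first exact/measurable_EFinP.
  rewrite ge0_integral_density//; last first.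
    by apply: measurableT_comp => //; exact/measurable_EFinP.
  move/integrableP : ifg => [_]; congr (_ < _)%E.
  by apply: eq_integral => x _; rewrite /= normrM (ger0_norm (g0 x)).
split => //; rewrite /Rintegral; congr fine.
rewrite integralE [RHS]integralE; congr (_ - _)%E.
  rewrite ge0_integral_density//; last by apply: measurable_funepos; exact/measurable_EFinP.
  apply: eq_integral => x _.
  by rewrite !funeposE -!EFin_max -EFinM maxr_pMl// mul0r.
rewrite ge0_integral_density//; last by apply: measurable_funeneg; exact/measurable_EFinP.
apply: eq_integral => x _.
by rewrite !funenegE -!EFinN -!EFin_max -EFinM maxr_pMl// mul0r mulNr.
Qed.

End density.

Section joint_law_integral.
Variable R : realType.
Variable mu : {finite_measure set (measurableTypeR R) -> \bar R}.
Variable n : nat.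

Let tp := tuple_power (radial_measure mu) n.
Let Z : R := \int[tp]_z sq_vandermonde z.

Hypothesis iV : rintegrable tp (@sq_vandermonde R n).
Hypothesis Z0 : 0 < Z.

(** Integrability and positivity of the total mass keep [mnormalize] away from its default value,
    the Dirac mass. *)
Lemma joint_lawE (A : set (n.-tuple R[i])) : measurable A ->
  joint_law mu n A = (\int[tp]_(z in A) (sq_vandermonde z / Z)%:E)%E.
Proof.
move=> mA; rewrite /joint_law/= /mnormalize/=.
have ZE : (\int[tp]_z (sq_vandermonde z)%:E = Z%:E)%E.
  by rewrite /Z /Rintegral fineK//; exact: integrable_fin_num.
set W := weighted_measure _ _ _.
have -> : W setT = Z%:E by exact: ZE.
rewrite eqe gt_eqF//=; under eq_integral do rewrite EFinM.
rewrite integralZr//; apply: (integrableS measurableT) => //; exact: iV.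
Qed.

Lemma rintegral_joint_law (f : n.-tuple R[i] -> R) : measurable_fun setT f ->
  (exists B, forall z, `|f z| <= B) ->
  rintegrable (joint_law mu n) f /\
  \int[joint_law mu n]_z f z = Z^-1 * \int[tp]_z (f z * sq_vandermonde z).
Proof.
move=> mf fB.
have ifV : rintegrable tp (fun z => f z * sq_vandermonde z).
  have := rintegrableMb iV mf fB; congr (rintegrable _ _).
  by apply/funext => z; rewrite mulrC.
have iw : rintegrable tp (fun z => f z * (sq_vandermonde z / Z)).
  have := rintegrableZ Z^-1 ifV; congr (rintegrable _ _).
  by apply/funext => z; rewrite mulrC mulrA.
have mw : measurable_fun setT (fun z : n.-tuple R[i] => sq_vandermonde z / Z).
  by apply: measurable_funM => //; exact: measurable_sq_vandermonde.
have w0 (z : n.-tuple R[i]) : 0 <= sq_vandermonde z / Z.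
  by rewrite divr_ge0 ?sq_vandermonde_ge0// ltW.
have [iJ ->] := rintegral_density mw w0 joint_lawE mf iw.
split => //; rewrite -RintegralZl//; apply: eq_Rintegral => z _.
by rewrite mulrA mulrC.
Qed.

End joint_law_integral.

Section almost_everywhere.
Context d (T : measurableType d) (R : realType) (m : {measure set T -> \bar R}).
Variable N : set T.
Hypotheses (mN : measurable N) (N0 : m N = 0%E).

(** [m] is not assumed complete, so measurability of [f] has to be supplied. *)
Lemma rintegrable_ae (f g : T -> R) : measurable_fun setT f ->
  (forall x, ~ N x -> f x = g x) -> rintegrable m g ->
  rintegrable m f /\ \int[m]_x f x = \int[m]_x g x.
Proof.
move=> mf fg ig; have mg := rintegrable_measurable ig.
have ae : ae_eq m setT (EFin \o f) (EFin \o g).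
  exists N; split => // x /= h; apply: contrapT => Nx; apply: h => _.
  by rewrite (fg _ Nx).
have mf' : measurable_fun setT (EFin \o f) by exact/measurable_EFinP.
have mg' : measurable_fun setT (EFin \o g) by exact/measurable_EFinP.
split; last by rewrite /Rintegral; congr fine; exact: ae_eq_integral.
move/integrableP : ig => [_ ig]; apply/integrableP; split => //.
rewrite (ae_eq_integral (abse \o (EFin \o g)))//; try exact: measurableT_comp.
by apply: filterS ae => x /= + Tx => /(_ Tx) [->].
Qed.

Lemma cintegrable_ae (F G : T -> R[i]) : cmeasurable F ->
  (forall x, ~ N x -> F x = G x) -> cintegrable m G ->
  cintegrable m F /\ cint m F = cint m G.
Proof.
move=> [mr mi] FG [gr gi].
have [ir Er] := rintegrable_ae mr (fun x Nx => congr1 (@complex.Re R) (FG x Nx)) gr.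
have [ii Ei] := rintegrable_ae mi (fun x Nx => congr1 (@complex.Im R) (FG x Nx)) gi.
by split => //; rewrite /cint Er Ei.
Qed.

End almost_everywhere.

(** * The argument and its branch *)

Section argument.
Variable R : realType.

(** The residue [s] of [y] in [0, 2 pi[ has cosine 1. Injectivity of the cosine on [0, pi] gives s =
    0 when s <= pi, and the reflection 2 pi - s excludes the other case. *)
Lemma cos_eq1 (y : R) : cos y = 1 -> exists k : int, y = (pi *+ 2) * k%:~R.
Proof.
move=> cy; have p2 : 0 < (pi : R) *+ 2 by rewrite pmulrn_lgt0// pi_gt0.
pose k := Num.floor (y / (pi *+ 2)); pose s := y - (pi *+ 2) * k%:~R.
have cper (m : nat) (x : R) : cos (x + pi *+ 2 * m%:R) = cos x.
  by rewrite mulr_natr (periodicn (@cosD2pi R)).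
have cs : cos s = 1.
  rewrite -cy /s; case: (intP k) => [|m|m]; first by rewrite mulr0 subr0.
    by rewrite -[in RHS](subrK ((pi *+ 2) * m.+1%:~R) y) cper.
  by rewrite mulrNz mulrN opprK cper.
have [s0 s2] : 0 <= s /\ s < pi *+ 2.
  split.
    by rewrite subr_ge0 mulrC -ler_pdivlMr// floor_le_tmp.
  rewrite ltrBlDr -[X in X + _]mulr1 -mulrDr addrC mulrC -ltr_pdivrMr//.
  by rewrite -[1]/(1%:~R) -intrD floorD1_gt.
exists k; apply/eqP; rewrite -subr_eq0 -/s; apply/eqP.
have [sp|sp] := leP s pi.
  by apply: cos_inj; rewrite ?in_itv/= ?s0 ?sp ?lexx ?pi_ge0// cs cos0.
have h : pi *+ 2 - s = 0.
  apply: cos_inj; rewrite ?in_itv/= ?lexx ?pi_ge0// ?subr_ge0 ?(ltW s2)/=.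
    by rewrite lerBlDr mulr2n lerD2l ltW.
  by rewrite cos0 cosB cos2pi sin2pi mul1r mul0r addr0.
by move: s2; rewrite -subr_gt0 h ltxx.
Qed.

Lemma periodicz (V : zmodType) (W : R -> V) (a t : R) (k : int) : periodic W a ->
  W (t + a * k%:~R) = W t.
Proof.
move=> pW; case: (intP k) => [|m|m]; first by rewrite mulr0 addr0.
  by rewrite -pmulrn mulr_natr periodicn.
rewrite mulrNz mulrN -[in RHS](subrK (a * m.+1%:~R) t).
by rewrite -pmulrn mulr_natr periodicn.
Qed.

(** A periodic function does not see the branch: [c] and [t] have the same cosine and sine, so the
    cosine of their difference is 1. *)
Lemma carg_polar_periodic (V : zmodType) (W : R -> V) (r t : R) : periodic W (pi *+ 2) -> 0 < r ->
  W (carg (polar (r, t))) = W t.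
Proof.
move=> pW r0; set z := polar _; set c := carg z.
have nz : normc z = r.
  by rewrite /z /normc /polar/= !exprMn -mulrDr cos2Dsin2 mulr1 sqrtr_sqr gtr0_norm.
have z0 : z != 0.
  by apply: contraTneq r0 => z0; rewrite -nz z0 normc0 ltxx.
have := carg_polar z0; rewrite -/c nz {1}/z /polar/= => -[].
move=> /(mulfI (lt0r_neq0 r0)) ct /(mulfI (lt0r_neq0 r0)) st.
have [k kE] : exists k : int, c - t = (pi *+ 2) * k%:~R.
  by apply: cos_eq1; rewrite cosB -ct -st -!expr2 cos2Dsin2.
by rewrite -[c](subrK t) kE addrC periodicz.
Qed.

Lemma measurable_acos : measurable_fun `[(-1 : R), 1] (@acos R).
Proof.
have oo : measurable_fun `](-1 : R), 1[ (@acos R).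
  apply: open_continuous_measurable_fun; first exact: interval_open.
  by move=> x /set_mem; rewrite /= in_itv/= => x1; exact: continuous_acos.
have -> : `[(-1 : R), 1]%classic = [set -1] `|` (`](-1 : R), 1[ `|` [set 1]).
  by rewrite (@setUitv1 _ _ (BRight (-1)) 1 true) ?bnd_simp ?(@setU1itv _ _ (BRight 1) (-1) false) ?bnd_simp//; lra.
apply/measurable_funU => //; first exact: measurableU.
split; first exact: measurable_fun_set1.
by apply/measurable_funU => //; split => //; exact: measurable_fun_set1.
Qed.

Lemma measurable_ReIm : cmeasurable (@id R[i]).
Proof.
split.
  exact: (measurableT_comp measurable_fst (@measurable_c2pair R)).
exact: (measurableT_comp measurable_snd (@measurable_c2pair R)).
Qed.

Lemma measurable_carg : measurable_fun setT (@carg R).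
Proof.
have [mr mi] := measurable_ReIm.
have mn := cmeasurable_normc measurable_ReIm.
have mV : measurable_fun setT (fun z : R[i] => (normc z)^-1).
  rewrite (_ : (fun z => _) = (fun z : R[i] => normc z `^ (-1))); last first.
    by apply/funext => z; rewrite powR_inv1// normc_ge0.
  exact: (measurableT_comp (measurable_powR (-1)) mn).
have ma : measurable_fun setT (fun z : R[i] => acos (complex.Re z / normc z)).
  apply: (measurable_comp (F := `[(-1 : R), 1])) measurable_acos _ => //.
    move=> _ [z _ <-]; rewrite /= in_itv/= -ler_norml normrM normfV.
    rewrite (ger0_norm (normc_ge0 z)); have [->|z0] := eqVneq z 0.
      by rewrite normc0 invr0 mulr0 ler01.
    rewrite ler_pdivrMr ?mul1r ?norm_Re_le_normc//.
    rewrite lt_neqAle normc_ge0 andbT eq_sym; apply: contra z0 => /eqP.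
    by move=> /eq0_normc ->.
  exact: measurable_funM.
apply: measurable_fun_ifT => //.
- by apply: measurable_fun_ler => //; exact: measurable_cst.
- exact: measurableT_comp.
Qed.

End argument.

(** * Polar coordinates and the Gram matrix of the monomials *)

Section radial_integrals.
Variable R : realType.
Variable mu : {finite_measure set (measurableTypeR R) -> \bar R}.
Hypothesis mu_nonneg : mu `]-oo, 0%R[%classic = 0%E.
Hypothesis mu_no_atom0 : mu [set 0%R] = 0%E.

Local Notation am := (@angle_measure R).

(** The angle measure has the indicator of [0, 2 pi[ as density, and the endpoint 2 pi is
    negligible. *)
Lemma angle_measure_integrable (f : R -> R) : measurable_fun setT f ->
  lebesgue_measure.-integrable `[0, pi *+ 2] (EFin \o f) ->
  rintegrable am f /\
  \int[am]_t f t = \int[lebesgue_measure]_(t in `[0, pi *+ 2]) f t.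
Proof.
move=> mf iDc; set D : set R := `[0, pi *+ 2[%classic.
have mD : measurable D by exact: measurable_itv.
have iD : lebesgue_measure.-integrable D (EFin \o f).
  by apply: integrableS iDc => //; exact: subset_itv_co_cc.
have m1 : measurable_fun setT (\1_D : R -> R) by exact: measurable_indic.
have amE A : measurable A -> am A = (\int[lebesgue_measure]_(x in A) (\1_D x)%:E)%E.
  by move=> mA; rewrite integral_indic// setIC.
have if1 : rintegrable lebesgue_measure (fun x => f x * \1_D x).
  have : lebesgue_measure.-integrable setT ((EFin \o f) \_ D).
    by rewrite -(integrable_mkcond (mu := lebesgue_measure) (EFin \o f) mD).
  congr (integrable _ _ _); apply/funext => x.
  by rewrite patchE /= indicE; case: ifPn => _; rewrite ?mulr1 ?mulr0.
have D0 x : 0 <= \1_D x :> R by rewrite indicE.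
have [iam ->] := @rintegral_density _ (measurableTypeR R) R lebesgue_measure am
  (\1_D) m1 D0 amE f mf if1.
split => //.
rewrite -(Rintegral_itv_bndo_bndc (a := BLeft 0))// [RHS]Rintegral_mkcond.
apply: eq_Rintegral => x _; rewrite patchE indicE.
by case: ifPn => _; rewrite ?mulr1 ?mulr0.
Qed.

Lemma angle_measure_integral (f : R -> R) :
  measurable_fun setT f -> (exists B, forall x, `|f x| <= B) ->
  rintegrable am f /\ lebesgue_measure.-integrable `[0, pi *+ 2] (EFin \o f) /\
  \int[am]_t f t = \int[lebesgue_measure]_(t in `[0, pi *+ 2]) f t.
Proof.
move=> mf [B fB].
have iDc : lebesgue_measure.-integrable `[0, pi *+ 2] (EFin \o f).
  apply: measurable_bounded_integrable => //; last 2 first.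
  - exact: measurable_funTS.
  - exists B; split; first exact: num_real.
    by move=> M BM x _; exact: le_trans (fB x) (ltW BM).
  by rewrite [X in (X < _)%E]lebesgue_measure_itv/=; case: ifPn => // _; rewrite -EFinD ltry.
by have [] := angle_measure_integrable mf iDc.
Qed.

Lemma mu_negative : mu `]-oo, 0%R]%classic = 0%E.
Proof.
rewrite -(@setUitv1 _ _ -oo%O 0 true)// measureU//.
- by rewrite -[RHS]adde0; congr (_ + _)%E.
- by apply/seteqP; split => // x [/=] + x0; rewrite in_itv/= x0 ltxx.
Qed.

(** The polar identities are used for r > 0 only; this disposes of all other pairs (r, t). *)
Lemma radial_ae_pos : finite_product mu am [set p | p.1 <= 0] = 0%E.
Proof.
rewrite (_ : [set p | _] = `]-oo, 0%R]%classic `*` setT); last first.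
  by apply/seteqP; split => [[x y]/= xy|[x y] [/=]]; rewrite ?in_itv//= in_itv/=.
rewrite [LHS](product_measure1E mu am)//.
by rewrite [X in (X * _ = _)%E](_ : _ = 0%E) ?mul0e//; exact: mu_negative.
Qed.

Definition cis (t : R) : R[i] := cexp (0 +i* t).

Lemma cisD s t : cis (s + t) = cis s * cis t.
Proof. by rewrite /cis -cexpD; congr cexp; apply/eqP; rewrite eq_complex/= addr0 !eqxx. Qed.

Lemma cis0 : cis 0 = 1. Proof. exact: cexp0. Qed.

Lemma cis_conj t : (cis t)^* = cis (- t).
Proof. by rewrite /cis /cexp/= cosN sinN expR0 !mul1r. Qed.

Lemma cisX t n : cis t ^+ n = cis (t *+ n).
Proof. by elim: n => [|n IH]; rewrite ?mulr0n ?cis0// exprS mulrS cisD IH. Qed.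

Lemma normc_cis t : normc (cis t) = 1.
Proof. by rewrite normc_cexp/= expR0. Qed.

Lemma polar_cis r t : polar (r, t) = r%:C * cis t :> R[i].
Proof. by rewrite /polar /cis /cexp/= expR0 !mul1r; apply: complexP; rewrite /= ?mul0r ?subr0 ?addr0. Qed.

Definition Mo (k : nat) : R := \int[mu]_r (r ^+ k).

Hypothesis mu_moments : forall xi : R, 0 <= xi -> (moment mu xi < +oo)%E.

Lemma rintegrable_powR_moment (xi : R) : 0 <= xi ->
  rintegrable mu (fun r => r `^ xi * \1_(`[0, +oo[%classic) r) /\
  fine (moment mu xi) = \int[mu]_r (r `^ xi * \1_(`[0, +oo[%classic) r).
Proof.
move=> xi0; pose D : set (measurableTypeR R) := `[0, +oo[%classic.
have mD : measurable D by exact: measurable_itv.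
have mp : measurable_fun setT (fun r : R => (r `^ xi)%:E).
  by apply/measurable_EFinP; exact: measurable_powR.
have iD : mu.-integrable D (fun r => (r `^ xi)%:E).
  apply/integrableP; split; first exact: measurable_funTS.
  have := mu_moments xi0; rewrite /moment; congr (_ < _)%E.
  by apply: eq_integral => r _; rewrite gee0_abs// lee_fin powR_ge0.
have E : (fun r => (r `^ xi)%:E) \_ D = EFin \o (fun r => r `^ xi * \1_D r).
  by apply/funext => r; rewrite patchE /= indicE; case: ifPn => _; rewrite ?mulr1 ?mulr0.
split.
  by have := (integrable_mkcond (mu := mu) _ mD).1 iD; rewrite E.
by rewrite /moment integral_mkcond E.
Qed.

(** [Mo] integrates the integer power over the whole line and [moment] the real power over [0, +oo[;
    the integrands differ on the null set of negative r only. *)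
Lemma rintegrable_Mo k : rintegrable mu (fun r => r ^+ k) /\
  Mo k = fine (moment mu k%:R).
Proof.
have [ik Ek] := rintegrable_powR_moment (ler0n R k).
have mN : measurable (`]-oo, 0%R[%classic : set (measurableTypeR R)).
  exact: measurable_itv.
have mk : measurable_fun setT (fun r : measurableTypeR R => r ^+ k).
  exact: (@measurable_funX _ _ _ _ id).
rewrite Ek; apply: (rintegrable_ae mN mu_nonneg mk _ ik) => r.
rewrite /= in_itv/= => /negP; rewrite -leNgt => r0.
by rewrite powR_mulrn// indicE mem_set ?mulr1//= in_itv/= r0.
Qed.

Lemma cmeasurableX d (T : measurableType d) (F : T -> R[i]) k :
  cmeasurable F -> cmeasurable (fun x => F x ^+ k).
Proof.
move=> mF; elim: k => [|k IH]; first by under eq_fun do rewrite expr0; exact: cmeasurable_cst.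
by under eq_fun do rewrite exprS; exact: cmeasurableM.
Qed.

Lemma cmeasurable_monomial j k (W : R -> R[i]) :
  cmeasurable (W : measurableTypeR R -> R[i]) ->
  cmeasurable (fun z : R[i] => z ^+ j * (z ^+ k)^* * W (carg z)).
Proof.
move=> [mWr mWi]; apply: cmeasurableM.
  apply: cmeasurableM; first exact: cmeasurableX (@measurable_ReIm R).
  by apply: cmeasurable_conj; exact: cmeasurableX (@measurable_ReIm R).
split; first exact: (measurableT_comp mWr (@measurable_carg R)).
exact: (measurableT_comp mWi (@measurable_carg R)).
Qed.

(** For r > 0 the integrand is r^(j + k) times a function of the angle, so the integral
    factorises. *)
Lemma radial_monomial j k (W : R -> R[i]) : periodic W (pi *+ 2) ->
  cmeasurable (W : measurableTypeR R -> R[i]) -> (exists B, forall t, normc (W t) <= B) ->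
  cintegrable (radial_measure mu) (fun z => z ^+ j * (z ^+ k)^* * W (carg z)) /\
  cint (radial_measure mu) (fun z => z ^+ j * (z ^+ k)^* * W (carg z)) =
  (Mo (j + k))%:C * cint am (fun t => cis (t *+ j - t *+ k) * W t).
Proof.
move=> pW mW [B WB].
have mf0 := @cmeasurable_monomial j k _ mW.
pose F (r : measurableTypeR R) : R[i] := (r ^+ (j + k))%:C.
pose G (t : measurableTypeR R) : R[i] := cis (t *+ j - t *+ k) * W t.
have iF : cintegrable mu F.
  by split; [exact: (rintegrable_Mo (j + k)).1|exact: integrable0].
have FE : cint mu F = (Mo (j + k))%:C.
  apply: complexP; rewrite /cint//=.
  by rewrite -[X in X = _]/(Rintegral _ _ (cst 0)) Rintegral_cst// mul0r.
have mG : cmeasurable G.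
  apply: cmeasurableM => //; apply: cmeasurable_cexp; split => //=.
  rewrite (_ : (fun x => _) = (fun x : R => x * (j%:R - k%:R))).
    exact: measurable_funM.
  by apply/funext => x; rewrite mulrBr !mulr_natr.
have iG : cintegrable am G.
  have iB : rintegrable am (cst B) by exact: finite_measure_integrable_cst.
  apply: (cintegrable_le mG iB) => t.
  by rewrite normcM normc_cis mul1r.
have [iFG EFG] := cintegrable_prod iF iG.
have mN : measurable [set p : measurableTypeR R * measurableTypeR R | p.1 <= 0].
  rewrite (_ : [set p | _] = `]-oo, 0%R]%classic `*` setT).
    by apply: measurableX => //; exact: measurable_itv.
  by apply/seteqP; split => [[x y]/= xy|[x y] [/=]]; rewrite ?in_itv//= in_itv/=.
have [mr mi] := mf0.
have mpol := @measurable_polar R.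
have [ip Ep] : cintegrable (finite_product mu am)
      ((fun z => z ^+ j * (z ^+ k)^* * W (carg z)) \o @polar R) /\
    cint (finite_product mu am)
      ((fun z => z ^+ j * (z ^+ k)^* * W (carg z)) \o @polar R) =
    cint (finite_product mu am) (fun p => F p.1 * G p.2).
  apply: (cintegrable_ae mN radial_ae_pos _ _ iFG).
    split; first exact: (measurableT_comp mr mpol).
    exact: (measurableT_comp mi mpol).
  move=> [r t] /= /negP; rewrite -ltNge => r0.
  rewrite carg_polar_periodic// polar_cis /F /G mulrA; congr (_ * _).
  rewrite !exprMn conjcM -!realcX conjc_real mulrACA -realcM -exprD; congr (_ * _).
  by rewrite !cisX cis_conj -cisD.
have [i0 E0] := cintegrable_image (@measurable_polar R) mf0 ip.
by split => //; rewrite E0 Ep EFG FE.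
Qed.

Hypothesis mu_nonzero : (0 < mu setT)%E.

(** A vanishing integral would make ]0, +oo[ a null set; as the complementary half-line is null too,
    [mu] would be zero. *)
Lemma Rintegral_gt0 (g : measurableTypeR R -> R) : rintegrable mu g ->
  (forall r, 0 <= g r) -> (forall r, 0 < r -> 0 < g r) -> 0 < \int[mu]_r g r.
Proof.
move=> ig g0 gpos; pose D : set (measurableTypeR R) := `]0, +oo[%classic.
have mD : measurable D by exact: measurable_itv.
have mN : measurable (`]-oo, 0%R]%classic : set (measurableTypeR R)).
  exact: measurable_itv.
have Mo0 : 0 <= \int[mu]_r g r by exact: Rintegral_ge0.
rewrite lt_neqAle Mo0 andbT eq_sym; apply/negP => /eqP Mk0.
have : (\int[mu]_r `|(g r)%:E| = 0)%E.
  rewrite (eq_integral (fun r => (g r)%:E)); last first.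
    by move=> r _; rewrite gee0_abs// lee_fin.
  by rewrite -[LHS]fineK ?integrable_fin_num// -/(Rintegral _ _ _) Mk0.
have mgE : measurable_fun setT (EFin \o g).
  by apply/measurable_EFinP; exact: rintegrable_measurable ig.
move/(ae_eq_integral_abs mu measurableT mgE) => [N [mN' N0 gN]].
have D0 : mu D = 0%E.
  apply: (subset_measure0 mD mN' _ N0) => r Dr; apply: gN => /= /(_ I) [] /eqP.
  by move: Dr; rewrite /D/= in_itv/= andbT => /gpos r0; rewrite gt_eqF.
move: mu_nonzero; rewrite (_ : setT = `]-oo, 0%R]%classic `|` D); last first.
  by apply/seteqP; split => // r _ /=; rewrite /D/= !in_itv/= andbT; case: (leP r 0); [left|right].
rewrite measureU//; last first.
  apply/seteqP; split => // r [/=]; rewrite /D/= !in_itv/= andbT => r0 r1.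
  by move: (le_lt_trans r0 r1); rewrite ltxx.
move=> /gt_eqF/eqP; apply.
by have := congr2 (fun x y : \bar R => (x + y)%E) mu_negative D0; rewrite adde0; exact.
Qed.

Definition monomial_norm j : R := (Num.sqrt (pi *+ 2 * Mo (j + j)))^-1.

Definition monomial j (z : R[i]) : R[i] := (monomial_norm j)%:C * z ^+ j.

Lemma Mo_gt0 k : 0 < Mo k.
Proof.
have [ig Eg] := rintegrable_powR_moment (ler0n R k).
have [_ ->] := rintegrable_Mo k; rewrite Eg.
apply: Rintegral_gt0 => // r => [|r0]; first by rewrite mulr_ge0 ?powR_ge0.
by rewrite indicE mem_set ?mulr1 ?powR_gt0//= in_itv/= ltW.
Qed.

(** Cosine of the angle between the radial parts r^j and r^k in L^2(mu): the factor by which the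
    Gram matrix of a function of the argument differs from a Toeplitz matrix. *)
Definition rho j k : R := Mo (j + k) / Num.sqrt (Mo (j + j) * Mo (k + k)).

Definition circle_mean (W : R -> R[i]) : R[i] :=
  ((pi *+ 2)^-1)%:C * cint am W.

Lemma gram_monomial n (W : R -> R[i]) (j k : 'I_n) : periodic W (pi *+ 2) ->
  cmeasurable (W : measurableTypeR R -> R[i]) -> (exists B, forall t, normc (W t) <= B) ->
  gram (radial_measure mu) (fun j : 'I_n => monomial j) (fun z => W (carg z)) j k =
  (rho j k)%:C * circle_mean (fun t => cis (t *+ j - t *+ k) * W t).
Proof.
move=> pW mW WB; have [iM EM] := @radial_monomial j k _ pW mW WB.
rewrite mxE (eq_cint _ (G := fun z : R[i] => (monomial_norm j * monomial_norm k)%:C *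
   (z ^+ j * (z ^+ k)^* * W (carg z)))); last first.
  by move=> z; rewrite /monomial conjcM conjc_real realcM mulrACA -!mulrA.
rewrite (cintegrableZ _ iM).2 EM /circle_mean !mulrA -!realcM; congr (_%:C * _).
rewrite /rho /monomial_norm.
have p0 : 0 < pi *+ 2 :> R by rewrite pmulrn_lgt0// pi_gt0.
have J := Mo_gt0 (j + j); have K := Mo_gt0 (k + k).
rewrite -invfM -sqrtrM ?mulr_ge0 ?ltW// mulrACA -expr2 sqrtrM ?sqr_ge0//.
by rewrite sqrtr_sqr gtr0_norm// invfM mulrC mulrA mulrAC.
Qed.

Lemma L2c_monomial j : L2c (radial_measure mu) (monomial j).
Proof.
have p1 : periodic (cst 1 : R -> R[i]) (pi *+ 2) by [].
have [iM _] := @radial_monomial j j _ p1 (cmeasurable_cst _ 1) (bounded_normc_cst _ 1).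
have mz := @measurable_ReIm R.
split.
  by apply: cmeasurableM; [exact: cmeasurable_cst|exact: cmeasurableX].
have [ir _] := iM.
have := rintegrableZ (monomial_norm j ^+ 2) ir; congr (rintegrable _ _).
apply/funext => z; rewrite mulr1 /monomial normcM normcR exprMn real_normK ?num_real//.
by rewrite -normc_sqr_conj.
Qed.

Lemma cint_cis j k : circle_mean (fun t => cis (t *+ j - t *+ k)) = (j == k)%:R.
Proof.
have p2 : 0 < pi *+ 2 :> R by rewrite pmulrn_lgt0// pi_gt0.
have [->|jk] := eqVneq j k.
  rewrite /circle_mean (eq_cint _ (G := cst 1)); last by move=> t; rewrite subrr cis0.
  rewrite /cint; have m1 (c : R) : \int[am]_t c = c * (pi *+ 2).
    have cB : exists B, forall x : R, `|cst c x| <= B by exists `|c|.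
    have [_ [_ ->]] := angle_measure_integral (measurable_cst c) cB.
    rewrite Rintegral_cst//= lebesgue_measure_itv/= lte_fin p2/=.
    by rewrite oppr0 addr0.
  by rewrite !m1 mul1r mul0r -realcM mulVf ?gt_eqF.
pose a : R := j%:R - k%:R.
have a0 : a != 0 by rewrite subr_eq0 eqr_nat.
have aE (t : R) : t *+ j - t *+ k = a * t by rewrite mulrBl !mulr_natl.
have cont (g : R -> R) : continuous g -> continuous (fun t : R => g (a * t)).
  move=> cg t; apply: (@continuous_comp _ _ _ (fun t : R => a * t) g); last exact: cg.
  exact: mulrl_continuous.
have p2a : pi *+ 2 * a = pi *+ 2 *+ j - pi *+ 2 *+ k.
  by rewrite mulrBr !mulr_natr.
have ftc (g G : R -> R) : continuous g -> (forall x : R, is_derive x 1 G (g x)) ->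
    (forall t, `|g t| <= 1) -> G (a * (pi *+ 2)) = G 0 ->
    \int[am]_t g (a * t) = 0.
  move=> cg dG g1 GE.
  have mg : measurable_fun setT (fun t : R => g (a * t)).
    by apply: continuous_measurable_fun; exact: cont.
  have gB : exists B, forall t, `|g (a * t)| <= B by exists 1.
  have [_ [_ ->]] := angle_measure_integral mg gB.
  have dF (x : R) : is_derive x 1 (fun t => a^-1 * G (a * t)) (g (a * x)).
    have dGx := dG (a * x).
    have dax : is_derive x 1 (fun t => a * t) a by apply: is_derive_eq; rewrite /GRing.scale/= mulr1.
    have h : is_derive x 1 (fun t => G (a * t)) (g (a * x) * a).
      exact: (@is_derive1_comp _ G (fun t => a * t)).
    by apply: is_derive_eq; rewrite /GRing.scale/= mulrC mulfK.
  by rewrite (Rintegral_FTC2 p2 (cont _ cg) dF) mulr0 GE subrr.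
have -> : (fun t : R => cis (t *+ j - t *+ k)) = (fun t => cis (a * t)).
  by apply/funext => t; rewrite aE.
rewrite /circle_mean.
have per (g : R -> R) : periodic g (pi *+ 2) -> g (a * (pi *+ 2)) = g 0.
  move=> pg; rewrite mulrC (_ : a = (j%:Z - k%:Z)%:~R); last by rewrite intrD rmorphN.
  by have := periodicz 0 (j%:Z - k%:Z) pg; rewrite add0r.
have E (g : R -> R) : \int[am]_t (expR 0 * g (a * t)) = \int[am]_t g (a * t).
  by apply: eq_Rintegral => t _; rewrite expR0 mul1r.
have Ic : \int[am]_t cos (a * t) = 0.
  apply: (ftc cos sin).
  - exact: continuous_cos.
  - by move=> t; rewrite ler_norml cos_geN1 cos_le1.
  - by apply: per; exact: sinD2pi.
have Is : \int[am]_t sin (a * t) = 0.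
  apply: (ftc sin (fun t => - cos t)).
  - exact: continuous_sin.
  - by move=> t; apply: is_derive_eq; rewrite opprK.
  - by move=> t; rewrite ler_norml sin_geN1 sin_le1.
  - by congr (- _); apply: per; exact: cosD2pi.
rewrite /cint /cis /cexp/= !E Ic Is.
by apply: complexP; rewrite /= ?mulr0 ?mul0r ?subr0 ?addr0.
Qed.

Lemma rho_diag j : rho j j = 1.
Proof.
by rewrite /rho -expr2 sqrtr_sqr gtr0_norm ?Mo_gt0// divff// gt_eqF// Mo_gt0.
Qed.

Lemma gram_monomial1 n :
  gram (radial_measure mu) (fun j : 'I_n => monomial j) (cst 1) = 1%:M.
Proof.
apply/matrixP => j k.
have p1 : periodic (cst 1 : R -> R[i]) (pi *+ 2) by [].
have := @gram_monomial n (cst 1) j k p1 (cmeasurable_cst _ 1) (bounded_normc_cst _ 1).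
move=> ->.
have -> : (fun t => cis (t *+ j - t *+ k) * cst 1 t) = (fun t => cis (t *+ j - t *+ k)).
  by apply/funext => t; rewrite mulr1.
rewrite cint_cis mxE; have [->|] := eqVneq j k; first by rewrite eqxx rho_diag mulr1.
by rewrite -val_eqE => /negbTE ->; rewrite mulr0.
Qed.

Lemma normc_prod (I : Type) (r : seq I) (P : pred I) (F : I -> R[i]) :
  normc (\prod_(i <- r | P i) F i) = \prod_(i <- r | P i) normc (F i).
Proof. by apply: (big_morph (@normc R)) => [x y|]; [exact: normcM|exact: normc1]. Qed.

(** The Slater matrix is a Vandermonde matrix with rows scaled by the normalising constants. This
    identifies the density of the joint law with a squared determinant, as Andreief's identity
    requires. *)
Lemma slater_monomial n (z : n.-tuple R[i]) :
  slater (fun j : 'I_n => monomial j) z * (slater (fun j : 'I_n => monomial j) z)^* =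
  (\prod_(j < n) monomial_norm j ^+ 2)%:C * (sq_vandermonde z)%:C.
Proof.
rewrite -normc_sqr_conj -realcM; congr _%:C.
rewrite /slater; pose a : 'rV[R[i]]_n := \row_k tnth z k.
have -> : \matrix_(i < n, k < n) monomial i (tnth z k) =
    diag_mx (\row_(i < n) (monomial_norm i)%:C) *m Vandermonde n a.
  by apply/matrixP => i k; rewrite mul_diag_mx !mxE.
rewrite det_mulmx det_diag det_Vandermonde normcM exprMn !normc_prod -!prodrXl.
congr (_ * _).
  by apply: eq_bigr => i _; rewrite mxE normcR real_normK ?num_real.
rewrite /sq_vandermonde; apply: eq_bigr => i _.
rewrite normc_prod -prodrXl; apply: eq_bigr => k _.
by rewrite !mxE -normcN opprB.
Qed.

(** Andreief's identity for [w] is divided by the same identity for the constant 1, whose Gram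
    matrix is the identity: n! and the normalising constants cancel. The constant 1 also shows that
    the total mass is finite and positive. *)
Lemma joint_law_product n (w : R[i] -> R[i]) : cmeasurable w ->
  (exists B, forall z, normc (w z) <= B) ->
  cintegrable (joint_law mu n) (fun z => \prod_k w (tnth z k)) /\
  cint (joint_law mu n) (fun z => \prod_k w (tnth z k)) =
  \det (gram (radial_measure mu) (fun j : 'I_n => monomial j) w).
Proof.
move=> mw [B wB].
pose e := fun j : 'I_n => monomial j.
pose tp := tuple_power (radial_measure mu) n.
pose c := \prod_(j < n) monomial_norm j ^+ 2.
have c0 : 0 < c.
  apply: prodr_gt0 => j _; rewrite exprn_gt0// invr_gt0 sqrtr_gt0 mulr_gt0 ?Mo_gt0//.
  by rewrite pmulrn_lgt0// pi_gt0.
have key v : cmeasurable v -> (exists B, forall z, normc (v z) <= B) ->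
    cintegrable tp (fun z => (sq_vandermonde z)%:C * \prod_k v (tnth z k)) /\
    cint tp (fun z => (sq_vandermonde z)%:C * \prod_k v (tnth z k)) =
    (c^-1)%:C * (n`!%:R * \det (gram (radial_measure mu) e v)).
  move=> mv vB.
  have ie i j : cintegrable (radial_measure mu) (fun x => e i x * (e j x)^* * v x).
    by apply: cintegrableMb => //; apply: cintegrable_cdot; exact: L2c_monomial.
  have [iA EA] := andreief ie.
  rewrite -EA -(cintegrableZ _ iA).2.
  have -> : (fun z => (sq_vandermonde z)%:C * \prod_k v (tnth z k)) =
    (fun z => (c^-1)%:C * (slater e z * (slater e z)^* * \prod_k v (tnth z k))).
    apply/funext => z; rewrite slater_monomial -/c !mulrA -realcM mulVf ?gt_eqF//.
    by rewrite mul1r.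
  by split => //; exact: (cintegrableZ _ iA).1.
have [i1 E1] := key _ (cmeasurable_cst _ 1) (bounded_normc_cst _ 1).
have prod1 (z : n.-tuple R[i]) : \prod_(k < n) cst (1 : R[i]) (tnth z k) = 1.
  by rewrite big1.
have iV : rintegrable tp (@sq_vandermonde R n).
  have [h _] := i1; move: h; congr (rintegrable _ _); apply/funext => z.
  by rewrite prod1 mulr1.
have ZE : \int[tp]_z sq_vandermonde z = c^-1 * n`!%:R.
  rewrite gram_monomial1 det1 mulr1 in E1.
  have := congr1 (@complex.Re R) E1.
  rewrite [X in X = _ -> _](_ : _ = \int[tp]_z sq_vandermonde z); last first.
    by apply: eq_Rintegral => z _; rewrite prod1 mulr1.
  move=> ->; rewrite (_ : n`!%:R = (n`!%:R : R)%:C :> R[i]); last by rewrite rmorph_nat.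
  by rewrite -realcM.
have Z0 : 0 < \int[tp]_z sq_vandermonde z.
  by rewrite ZE mulr_gt0// ?invr_gt0// ltr0n fact_gt0.
have mP := cmeasurable_prod_tnth (fun k : 'I_n => mw).
have wP (z : n.-tuple R[i]) : normc (\prod_(k < n) w (tnth z k)) <= B ^+ n.
  rewrite normc_prod -[X in _ <= _ ^+ X]card_ord -prodr_const.
  by apply: ler_prod => k _; rewrite normc_ge0 wB.
have wRe : exists C, forall z : n.-tuple R[i], `|complex.Re (\prod_k w (tnth z k))| <= C.
  by exists (B ^+ n) => z; apply: le_trans (norm_Re_le_normc _) _; exact: wP.
have wIm : exists C, forall z : n.-tuple R[i], `|complex.Im (\prod_k w (tnth z k))| <= C.
  by exists (B ^+ n) => z; apply: le_trans (norm_Im_le_normc _) _; exact: wP.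
have [ir Er] := rintegral_joint_law iV Z0 mP.1 wRe.
have [ii Ei] := rintegral_joint_law iV Z0 mP.2 wIm.
split => //.
have [iw Ew] := key _ mw (ex_intro _ B wB).
have -> : \det (gram (radial_measure mu) e w) =
    ((\int[tp]_z sq_vandermonde z)^-1)%:C *
    cint tp (fun z => (sq_vandermonde z)%:C * \prod_k w (tnth z k)).
  rewrite Ew ZE invfM invrK (_ : n`!%:R = (n`!%:R : R)%:C :> R[i]); last by rewrite rmorph_nat.
  rewrite !mulrA -!realcM [X in X%:C](_ : _ = 1) ?mul1r//; field.
  by rewrite (gt_eqF c0) pnatr_eq0 -lt0n fact_gt0.
rewrite /cint Er Ei; apply: complexP; rewrite /= ?mul0r ?subr0 ?addr0.
  congr (_ * _); apply: eq_Rintegral => z _.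
  by rewrite cReMl mulrC.
congr (_ * _); apply: eq_Rintegral => z _.
by rewrite cImMl mulrC.
Qed.

End radial_integrals.

(** * Second differences of the log moments *)

Section log_moments.
Variable R : realType.
Variable mu : {finite_measure set (measurableTypeR R) -> \bar R}.
Hypothesis mu_nonneg : mu `]-oo, 0%R[%classic = 0%E.
Hypothesis mu_no_atom0 : mu [set 0%R] = 0%E.
Hypothesis mu_moments : forall xi : R, 0 <= xi -> (moment mu xi < +oo)%E.
Hypothesis mu_nonzero : (0 < mu setT)%E.

Let B : set (measurableTypeR R) := `[0, +oo[%classic.
Let mB : measurable B. Proof. exact: measurable_itv. Qed.

(** For x > 0, the n-th derivative of the moment in its exponent. At r = 0 the power vanishes, which
    makes the value given to the logarithm there harmless. *)
Definition log_moment_integral (n : nat) (x : R) : R :=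
  \int[mu]_(r in B) (r `^ x * ln r ^+ n).

Lemma integrable_powR (x : R) : 0 <= x -> mu.-integrable B (EFin \o (fun r => r `^ x)).
Proof.
move=> x0; apply/integrableP; split.
  by apply/measurable_EFinP; apply: measurable_funTS; exact: measurable_powR.
have := mu_moments x0; rewrite /moment; congr (_ < _)%E.
by apply: eq_integral => r _; rewrite /= ger0_norm ?powR_ge0//.
Qed.

Lemma powR_le_sum (r y b : R) : 0 <= r -> 0 <= y -> y <= b -> r `^ y <= 1 + r `^ b.
Proof.
move=> r0 y0 yb; have [r1|r1] := leP r 1.
  rewrite (@le_trans _ _ 1)// ?lerDl ?powR_ge0//.
  rewrite [leRHS](_ : 1 = 1 `^ y); last by rewrite powR1.
  by rewrite ge0_ler_powR// nnegrE.
by rewrite (@le_trans _ _ (r `^ b))// ?lerDr// ler_powR// ltW.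
Qed.

(** From y^n <= n! exp y at y = delta |ln r|: there exp y is the larger of r^delta and r^(- delta),
    hence at most their sum. *)
Lemma norm_ln_le (n : nat) (delta r : R) : 0 < delta -> 0 < r ->
  `|ln r| ^+ n <= n`!%:R / delta ^+ n * (r `^ delta + r `^ (- delta)).
Proof.
move=> d0 r0; pose y := delta * `|ln r|.
have y0 : 0 <= y by rewrite mulr_ge0// ltW.
have h : y ^+ n <= n`!%:R * expR y.
  case: n => [|n]; first by rewrite expr0 fact0 mul1r -expR0 ler_expR.
  have := expR_ge1Dxn n y0.
  have f0 : 0 < n.+1`!%:R :> R by rewrite ltr0n fact_gt0.
  by move=> h; rewrite mulrC -ler_pdivrMr// (le_trans _ h)// lerDr.
have dn : 0 < delta ^+ n by rewrite exprn_gt0.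
have -> : `|ln r| ^+ n = y ^+ n / delta ^+ n.
  by rewrite /y exprMn mulrAC divff ?mul1r// gt_eqF.
rewrite [leRHS]mulrAC ler_wpM2r ?invr_ge0 ?(ltW dn)//. apply: (le_trans h); rewrite ler_wpM2l//; rewrite /powR gt_eqF// /y.
have [l0|l0] := ger0P (ln r); first by rewrite -[leLHS]addr0 lerD2l expR_ge0.
by rewrite mulrN -mulNr -[leLHS]add0r lerD2r expR_ge0.
Qed.

(** The dominating function for differentiation under the integral, uniform for x in [u, v]. Taking
    delta = u keeps the exponent x - u nonnegative, so that r^(x + u) and r^(x - u) are both at most
    1 + r^(v + u); hence the factor 2. *)
Lemma powR_ln_bound (n : nat) (u v x r : R) : 0 < u -> u <= x -> x <= v -> 0 <= r ->
  `|r `^ x * ln r ^+ n| <= 2 * (n`!%:R / u ^+ n) * (1 + r `^ (v + u)).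
Proof.
move=> u0 ux xv; have x0 := lt_le_trans u0 ux.
have c0 : 0 <= n`!%:R / u ^+ n by rewrite divr_ge0// exprn_ge0// ltW.
rewrite le_eqVlt => /predU1P[<-|r0].
  rewrite powR0 ?gt_eqF// mul0r normr0; apply: mulr_ge0; first exact: mulr_ge0.
  by rewrite addr_ge0// powR_ge0.
rewrite normrM normrX ger0_norm ?powR_ge0//.
have := ler_wpM2l (powR_ge0 r x) (norm_ln_le n u0 r0).
move=> /le_trans; apply; rewrite [leLHS]mulrCA [leRHS](_ : _ = n`!%:R / u ^+ n * ((1 + r `^ (v + u)) * 2)); last by ring.
rewrite ler_wpM2l//.
rewrite mulrDr -!powRD ?(gt_eqF r0) ?implybT//.
have b1 : r `^ (x + u) <= 1 + r `^ (v + u).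
  by apply: powR_le_sum; [exact: ltW | rewrite ltW ?addr_gt0 | rewrite lerD2r].
have b2 : r `^ (x - u) <= 1 + r `^ (v + u).
  apply: powR_le_sum; [exact: ltW | by rewrite subr_ge0 | by lra].
lra.
Qed.

Lemma integrable_one_powR (c w : R) : 0 <= w ->
  mu.-integrable B (EFin \o (fun r => c * (1 + r `^ w))).
Proof.
move=> w0; rewrite (_ : _ \o _ = fun r => (c%:E * (1 + r `^ w)%:E)%E)//.
apply: integrableZl => //.
rewrite (_ : (fun r => _) = fun r => (1%:E + (r `^ w)%:E)%E)//.
apply: integrableD => //; last exact: integrable_powR.
by apply: (@finite_measure_integrable_cst _ _ _ mu B 1).
Qed.

Lemma integrable_powR_ln n (x : R) : 0 < x ->
  mu.-integrable B (EFin \o (fun r => r `^ x * ln r ^+ n)).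
Proof.
move=> x0; apply: le_integrable (integrable_one_powR (2 * (n`!%:R / x ^+ n)) (_ : 0 <= x + x)) => //.
- apply/measurable_EFinP; apply: measurable_funTS; apply: measurable_funM.
    exact: measurable_powR.
  by apply: measurable_funX; exact: measurable_ln.
- move=> r; rewrite /B/= in_itv/= andbT => r0; rewrite lee_fin.
  have := powR_ln_bound n x0 (lexx x) (lexx x) r0.
  by move=> /le_trans; apply; exact: ler_norm.
- by rewrite addr_ge0// ltW.
Qed.

Lemma is_derive_powR_ln n (r x : R) : 0 <= r -> 0 < x ->
  is_derive x 1 (fun y => r `^ y * ln r ^+ n) (r `^ x * ln r ^+ n.+1).
Proof.
rewrite le_eqVlt => /predU1P[<-|r0] x0.
  rewrite powR0 ?gt_eqF// mul0r.
  apply: (near_eq_is_derive (f := cst 0)).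
  near=> y; rewrite powR0 ?mul0r// gt_eqF//; near: y; exact: lt_nbhsr.
rewrite /powR gt_eqF//.
pose c := ln r.
have dax : is_derive x 1 (fun t => c * t) c.
  by apply: is_derive_eq; rewrite /GRing.scale/= mulr1.
have d1 : is_derive x 1 (fun y => expR (c * y)) (expR (c * x) * c).
  exact: (@is_derive1_comp _ expR (fun t => c * t)).
rewrite (_ : (fun y => _) = (fun y => c ^+ n * expR (c * y))); last first.
  by apply/funext => y; rewrite mulrC [y * _]mulrC.
apply: is_derive_eq; rewrite /GRing.scale/= exprS -/c [x * _]mulrC.
by ring.
Unshelve. all: by end_near. Qed.

Lemma is_derive_log_moment_integral n (x : R) : 0 < x ->
  is_derive x 1 (log_moment_integral n) (log_moment_integral n.+1 x).
Proof.
move=> x0; pose u := x / 2; pose v := x + 1.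
have u0 : 0 < u by rewrite divr_gt0.
have Ix : `]u, v[%classic x.
  by rewrite /= in_itv/= ltrDl ltr01 andbT ltr_pdivrMr// ltr_pMr// ltr1n.
pose f (y r : R) := r `^ y * ln r ^+ n.
pose G (r : R) := 2 * (n.+1`!%:R / u ^+ n.+1) * (1 + r `^ (v + u)).
have v0 : 0 < v by rewrite addr_gt0.
have pos y : `]u, v[%classic y -> 0 < y.
  by rewrite /= in_itv/= => /andP[/(lt_trans u0)].
have intf y : `]u, v[%classic y -> mu.-integrable B (EFin \o f y).
  by move=> /pos y0; exact: integrable_powR_ln.
have B0 r : B r -> 0 <= r by rewrite /B/= in_itv/= andbT.
have df y r : `]u, v[%classic y -> B r -> is_derive y 1 (f ^~ r) (r `^ y * ln r ^+ n.+1).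
  by move=> /pos y0 /B0 r0; exact: is_derive_powR_ln.
have derf y r : `]u, v[%classic y -> B r -> derivable (f ^~ r) y 1.
  by move=> Iy Br; have := df y r Iy Br.
have d1 y r : `]u, v[%classic y -> B r -> partial1of2 f y r = r `^ y * ln r ^+ n.+1.
  by move=> Iy Br; rewrite partial1of2E; have dfy := df y r Iy Br; exact: derive_val.
have G0 r : 0 <= G r.
  apply: mulr_ge0; last by rewrite addr_ge0// powR_ge0.
  by rewrite mulr_ge0// divr_ge0// exprn_ge0// ltW.
have intG : mu.-integrable B (EFin \o G).
  by apply: integrable_one_powR; rewrite addr_ge0// ltW.
have Gub y r : `]u, v[%classic y -> B r -> `|partial1of2 f y r| <= G r.
  move=> Iy Br; rewrite d1//; move: Iy; rewrite /= in_itv/= => /andP[uy yv].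
  by apply: powR_ln_bound => //; rewrite ?(ltW uy) ?(ltW yv)//; exact: B0 Br.
have D := derivable_under_integral mB Ix intf derf G0 intG Gub.
have E := differentiation_under_integral mB Ix intf derf G0 intG Gub.
apply: DeriveDef; first exact: D.
rewrite -derive1E -[RHS]/(\int[mu]_(r in B) _) [LHS]E.
by apply: eq_Rintegral => r /set_mem Br; rewrite d1.
Qed.

Lemma log_moment_integral0_gt0 x : 0 < x -> 0 < log_moment_integral 0 x.
Proof.
move=> x0; have [ig Eg] := rintegrable_powR_moment mu_moments (ltW x0).
have -> : log_moment_integral 0 x = fine (moment mu x).
  by congr fine; apply: eq_integral => r _; rewrite expr0 mulr1.
rewrite Eg; apply: (Rintegral_gt0 mu_nonneg mu_no_atom0 mu_nonzero) => // r => [|r0].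
  by rewrite mulr_ge0 ?powR_ge0.
by rewrite indicE mem_set ?mulr1 ?powR_gt0//= in_itv/= ltW.
Qed.

Lemma ln_momentE x : ln_moment mu x = ln (log_moment_integral 0 x).
Proof.
by congr (ln (fine _)); apply: eq_integral => r _; rewrite expr0 mulr1.
Qed.

Let F := log_moment_integral.

(** Together with [d2ln_moment]: the mean and the variance of ln r under the law with density
    proportional to r^x with respect to [mu]. *)
Definition dln_moment x := F 1 x / F 0 x.
Definition d2ln_moment x := F 2 x / F 0 x - (F 1 x / F 0 x) ^+ 2.

Lemma is_derive_ln_moment (x : R) : 0 < x ->
  is_derive x 1 (ln_moment mu) (dln_moment x).
Proof.
move=> x0; have d0 := is_derive_log_moment_integral 0 x0.
have dl := is_derive1_ln (log_moment_integral0_gt0 x0).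
rewrite (_ : ln_moment mu = fun y => ln (F 0 y)); last by apply/funext => y; rewrite ln_momentE.
by rewrite /dln_moment mulrC; exact: (@is_derive1_comp _ (@ln R) (F 0)).
Qed.

Lemma is_derive_dln_moment (x : R) : 0 < x ->
  is_derive x 1 dln_moment (d2ln_moment x).
Proof.
move=> x0; have F0 := log_moment_integral0_gt0 x0.
have d0 := is_derive_log_moment_integral 0 x0.
have d1 := is_derive_log_moment_integral 1 x0.
have dV : is_derive x 1 (fun y => (F 0 y)^-1) (- (F 0 x) ^- 2 *: F 1 x).
  by apply: is_deriveV; rewrite gt_eqF.
rewrite /dln_moment; apply: is_derive_eq.
rewrite /d2ln_moment /GRing.scale/= -/F; field.
by rewrite gt_eqF.
Qed.

Lemma derive1n_ln_moment (x : R) : 0 < x -> derive1n 2 (ln_moment mu) x = d2ln_moment x.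
Proof.
move=> x0; rewrite derive1nS /= derive1E.
have dx := is_derive_dln_moment x0.
rewrite -[RHS]derive_val; apply: near_eq_derive; near=> y.
have y0 : 0 < y by near: y; exact: lt_nbhsr.
by have dy := is_derive_ln_moment y0; rewrite derive1E derive_val.
Unshelve. all: by end_near. Qed.

Lemma MVT_pos (f df : R -> R) a b : 0 < a -> a < b ->
  (forall x : R, 0 < x -> is_derive x 1 f (df x)) ->
  exists c, [/\ a < c, c < b & f b - f a = df c * (b - a)].
Proof.
move=> a0 ab Df; have [||c] := @MVT R f df a b ab.
- by move=> x; rewrite in_itv/= => /andP[ax _]; apply: Df; exact: lt_trans ax.
- apply: derivable_within_continuous => x; rewrite in_itv/= => /andP[ax _].
  by have := Df x (lt_le_trans a0 ax).
- by rewrite in_itv/= => /andP[ac cb] E; exists c.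
Qed.

(** Mean value theorem twice: for the unit increment [phi] on [x, x + 1], then for the first
    derivative on [y, y + 1]. *)
Lemma ln_moment_second_difference x : 0 < x ->
  exists c, [/\ x < c, c < x + 2 &
    ln_moment mu x - 2 * ln_moment mu (x + 1) + ln_moment mu (x + 2) = d2ln_moment c].
Proof.
move=> x0; pose phi t := ln_moment mu (t + 1) - ln_moment mu t.
have dphi (t : R) : 0 < t -> is_derive t 1 phi (dln_moment (t + 1) - dln_moment t).
  move=> t0; have t1 : 0 < t + 1 by exact: addr_gt0.
  have d1 : is_derive t 1 (fun y : R => y + 1) (1 : R).
    by apply: is_derive_eq; rewrite addr0.
  have d2 := is_derive_ln_moment t0; have d3 := is_derive_ln_moment t1.
  have d4 : is_derive t 1 (fun y => ln_moment mu (y + 1)) (dln_moment (t + 1)).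
    by rewrite -[dln_moment _]mulr1; exact: (@is_derive1_comp _ (ln_moment mu) (fun y => y + 1)).
  exact: is_deriveB.
have x1 : x < x + 1 by rewrite ltrDl.
have [y [xy yx E]] := MVT_pos x0 x1 dphi.
have y0 := lt_trans x0 xy.
have y1 : y < y + 1 by rewrite ltrDl.
have [c [yc cy E2]] := MVT_pos y0 y1 is_derive_dln_moment.
exists c; split; first exact: lt_trans yc.
  by apply: lt_trans cy _; rewrite [x + 2](addrA x 1 1) ltrD2r.
have d1 (a : R) : a + 1 - a = 1 by ring.
move: E; rewrite d1 mulr1 E2 d1 mulr1 => <-; rewrite /phi [x + 2](addrA x 1 1).
by move: (ln_moment mu x) (ln_moment mu (x + 1)) (ln_moment mu (x + 1 + 1)) => a b a'; ring.
Qed.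

Lemma Mo_log_convex m k : Mo mu (m + k) ^+ 2 <= Mo mu m * Mo mu (m + k + k).
Proof.
have i_ j := (rintegrable_Mo mu_nonneg mu_moments j).1.
pose a := Mo mu (m + k); pose b := Mo mu m.
have b0 : 0 < b := Mo_gt0 mu_nonneg mu_no_atom0 mu_moments mu_nonzero m.
(* Cauchy-Schwarz by a discriminant: for r >= 0 this is the nonnegative function r^m (a - b r^k)^2,
   and its integral is b (b Mo(m + 2k) - a^2). *)
pose g (r : measurableTypeR R) := a ^+ 2 * r ^+ m + (- (2 * a * b) * r ^+ (m + k) + b ^+ 2 * r ^+ (m + k + k)).
have gE r : g r = r ^+ m * (a - b * r ^+ k) ^+ 2.
  by rewrite /g !exprD; ring.
have ig : rintegrable mu g by do 2 (apply: rintegrableD; [exact: rintegrableZ|]); exact: rintegrableZ.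
have Eg : \int[mu]_r g r = b * (b * Mo mu (m + k + k) - a ^+ 2).
  rewrite RintegralD//; [|exact: rintegrableZ|]; last first.
    by apply: rintegrableD; exact: rintegrableZ.
  rewrite RintegralD//; [|exact: rintegrableZ|exact: rintegrableZ].
  rewrite !RintegralZl//; [|exact: i_|exact: i_|exact: i_].
  by rewrite -/(Mo mu m) -/(Mo mu (m + k)) -/(Mo mu (m + k + k)) -/a -/b; ring.
suff : 0 <= \int[mu]_r g r.
  by rewrite Eg pmulr_rge0// subr_ge0.
have mN : measurable (`]-oo, 0%R[%classic : set (measurableTypeR R)) by exact: measurable_itv.
have gg r : ~ `]-oo, 0%R[%classic r -> `|g r| = g r.
  rewrite /= in_itv/= => /negP; rewrite -leNgt => r0.
  by rewrite gE ger0_norm// mulr_ge0 ?sqr_ge0// exprn_ge0.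
have [_ <-] := rintegrable_ae mN mu_nonneg (rintegrable_measurable (rintegrable_norm ig)) gg ig.
by apply: Rintegral_ge0 => r _; exact: normr_ge0.
Qed.

Lemma bigO_pinfty (g e : R -> R) : g =O_ (+oo_R) e ->
  exists C X : R, 0 < C /\ forall x, X < x -> `|g x| <= C * `|e x|.
Proof.
move=> /eqOP O; near +oo_R => C; have C0 : 0 < C by near: C; exact: nbhs_pinfty_gt.
have [X [_ hX]] : \forall x \near +oo_R, `|g x| <= C * `|e x| by near: C.
by exists C, X.
Unshelve. all: by end_near. Qed.

(** * Second differences and increments of iota compared with [h] *)

Section growth.
Variables (beta rho gamma : R) (h : R -> R).
Hypothesis beta_gt0 : 0 < beta.
Hypotheses (rho_gt : 1 < rho) (gamma_gt : 1 < gamma).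
Hypothesis h_diff : forall xi : R, 0 < xi -> derivable h xi 1.
Hypothesis h_ge0 : forall xi : R, 0 < xi -> 0 <= h xi.
Hypothesis ln_moment_h : derive1n 2 (ln_moment mu) = h +O_ (+oo_R) (fun xi => xi `^ (- rho)).
Hypothesis h_bigO : h =O_ (+oo_R) (fun xi => xi `^ (- beta)).
Hypothesis dh_bigO : derive1 h =O_ (+oo_R) (fun xi => xi `^ (- gamma)).

(** Common rate of two errors: [rho] comes from (ln m)'' - h, [gamma] from moving the argument of
    [h] by a bounded amount. It exceeds 1, so the errors are summable. *)
Definition power_decay : R := Num.min rho gamma.

Definition lnMo_diff2 m : R := ln (Mo mu m) - 2 * ln (Mo mu m.+1) + ln (Mo mu m.+2).

(** The increment of iota from 2 j to 2 (j + 1). The interval has length 2, so the factor 1/2 makes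
    it an average of [h]. *)
Definition iota_step (j : nat) : R :=
  2^-1 * \int[lebesgue_measure]_(x in `[2 * j%:R, 2 * j.+1%:R]) h x.

Lemma lnMo_diff2_ge0 m : 0 <= lnMo_diff2 m.
Proof.
have M0 k := Mo_gt0 mu_nonneg mu_no_atom0 mu_moments mu_nonzero k.
have := Mo_log_convex m 1; rewrite !addn1 => H.
have : ln (Mo mu m.+1 ^+ 2) <= ln (Mo mu m * Mo mu m.+2).
  by rewrite ler_ln// ?posrE ?mulr_gt0 ?exprn_gt0.
by rewrite lnM ?posrE// lnXn// /lnMo_diff2; lra.
Qed.

Lemma powR_le_decay (c q : R) (j : nat) : (0 < j)%N -> j%:R <= c -> power_decay <= q ->
  c `^ (- q) <= j%:R `^ (- power_decay).
Proof.
move=> j0 jc pq; have j1 : (1 : R) <= j%:R by rewrite ler1n.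
have c1 : 1 <= c := le_trans j1 jc.
have p0 : 0 <= power_decay by rewrite /power_decay le_min !ltW ?(lt_trans ltr01).
rewrite (@le_trans _ _ (c `^ (- power_decay)))//; first by rewrite ler_powR// lerN2.
rewrite !powRN lef_pV2 ?posrE ?powR_gt0 ?(lt_le_trans ltr01)//.
by rewrite ge0_ler_powR// nnegrE (le_trans ler01).
Qed.

(** Mean value theorem on the window [2 j, 2 j + s]: all its points are at least j, so the
    derivative of [h] is O(j^(- gamma)) there. *)
Lemma h_MVT : exists K X : R, 0 < K /\ forall (j : nat) (x y s : R), X < j%:R -> (0 < j)%N ->
   2 * j%:R <= x -> 2 * j%:R <= y -> x <= 2 * j%:R + s -> y <= 2 * j%:R + s ->
   `|h y - h x| <= K * s * j%:R `^ (- power_decay).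
Proof.
have [C [X [C0 HC]]] := bigO_pinfty dh_bigO.
exists C, X; split => // j.
have Dh (x : R) : 0 < x -> is_derive x 1 h (derive1 h x).
  by move=> x0; rewrite derive1E; apply: DeriveDef => //; exact: h_diff.
move=> x y s Xj j0.
wlog xy : x y / x < y => [H jx jy xs ys|jx jy xs ys].
  have [xy|yx|->] := ltgtP x y; first exact: H.
    by rewrite distrC H.
  by rewrite subrr normr0 !mulr_ge0 ?powR_ge0 ?(ltW C0)//; lra.
have jR : (0 : R) < j%:R by rewrite ltr0n.
have x0 : 0 < x by lra.
have [c [xc cy ->]] := MVT_pos x0 xy Dh.
have yx0 : 0 <= y - x by rewrite subr_ge0 ltW.
rewrite normrM (ger0_norm yx0) -mulrA [leRHS]mulrCA [leLHS]mulrC.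
apply: ler_pM => //; first by lra.
apply: le_trans (HC c _) _; first by lra.
rewrite ler_wpM2l ?(ltW C0)// (ger0_norm (powR_ge0 _ _)) powR_le_decay//; first by lra.
by rewrite /power_decay ge_min lexx orbT.
Qed.

(** The second difference is (ln m)'' at some c between 2 j + s and 2 j + s + 2. Passing from (ln
    m)''(c) to h(c), and from h(c) to h(2 j), costs the two errors in turn. *)
Lemma lnMo_diff2_h s : exists K X : R, 0 < K /\ forall j : nat, X < j%:R -> (0 < j)%N ->
  `|lnMo_diff2 (j.*2 + s) - h (2 * j%:R)| <= K * j%:R `^ (- power_decay).
Proof.
have [C [X [C0 HC]]] : exists C X : R, 0 < C /\ forall x, X < x ->
    `|derive1n 2 (ln_moment mu) x - h x| <= C * `|x `^ (- rho)|.
  move/eqaddOP : ln_moment_h => O.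
  near +oo_R => C; have C0 : 0 < C by near: C; exact: nbhs_pinfty_gt.
  have [X [_ hX]] : \forall x \near +oo_R, `|derive1n 2 (ln_moment mu) x - h x| <= C * `|x `^ (- rho)|.
    by near: C.
  by exists C, X.
have [K [Y [K0 HK]]] := h_MVT.
exists (C + K * (s%:R + 2)), (Num.max X Y).
split; first by rewrite addr_gt0// mulr_gt0// ltr_wpDl.
move=> j; rewrite gt_max => /andP[Xj Yj] j0.
have jR : (0 : R) < j%:R by rewrite ltr0n.
pose x : R := (j.*2 + s)%:R.
have xE : x = 2 * j%:R + s%:R by rewrite /x natrD -mul2n natrM.
have s0 : (0 : R) <= s%:R by [].
have x0 : 0 < x by rewrite xE; lra.
have [c [xc cx E]] := ln_moment_second_difference x0.
have -> : lnMo_diff2 (j.*2 + s) = d2ln_moment c.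
  have e1 : x + 1 = (j.*2 + s).+1%:R by rewrite -natr1.
  have e2 : x + 2 = (j.*2 + s).+2%:R by rewrite -[RHS]natr1 -e1 -addrA.
  rewrite -E e1 e2 /lnMo_diff2 /ln_moment /x.
  by have M k := (rintegrable_Mo mu_nonneg mu_moments k).2; rewrite -!M.
have c0 := lt_trans x0 xc; clear E.
rewrite -derive1n_ln_moment// -[X in `|X|](subrKA (h c)) [leRHS]mulrDl.
apply: le_trans (ler_normD _ _) (lerD _ _).
  apply: le_trans (HC c _) _; first by lra.
  rewrite ler_wpM2l ?(ltW C0)// (ger0_norm (powR_ge0 _ _)) powR_le_decay//; first by lra.
  by rewrite /power_decay ge_min lexx.
by apply: HK => //; lra.
Unshelve. all: by end_near. Qed.

Lemma integrable_h (a b : R) : 0 < a -> lebesgue_measure.-integrable `[a, b] (EFin \o h).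
Proof.
move=> a0; apply: continuous_compact_integrable; first exact: segment_compact.
apply: derivable_within_continuous => x; rewrite in_itv/= => /andP[ax _].
by apply: h_diff; exact: lt_le_trans ax.
Qed.

Lemma iota_step_h : exists K X : R, 0 < K /\ forall j : nat, X < j%:R -> (0 < j)%N ->
  `|iota_step j - h (2 * j%:R)| <= K * j%:R `^ (- power_decay).
Proof.
have [K [X [K0 HK]]] := h_MVT.
exists (K * 2), X; split => [|j Xj j0]; first by rewrite mulr_gt0.
have jR : (0 : R) < j%:R by rewrite ltr0n.
pose D : set (measurableTypeR R) := `[2 * j%:R, 2 * j.+1%:R]%classic.
have mD : measurable D by exact: measurable_itv.
have jS : (j.+1%:R : R) = j%:R + 1 by rewrite -natr1.
have lD : (lebesgue_measure D = 2%:E)%E.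
  rewrite lebesgue_measure_itv/= lte_fin ltr_pM2l// ltr_nat ltnSn -EFinB; congr EFin.
  by rewrite jS; ring.
have ih : lebesgue_measure.-integrable D (EFin \o h) by apply: integrable_h; rewrite mulr_gt0.
have ic (c : R) : lebesgue_measure.-integrable D (EFin \o cst c).
  apply/integrableP; split; first exact/measurable_EFinP/measurable_cst.
  rewrite (eq_integral (cst (`|c|%:E)))// integral_cst// [X in (_ * X)%E](_ : _ = 2%:E); last exact: lD.
  by rewrite lte_mul_pinfty ?lee_fin ?ltry.
have Ic (c : R) : \int[lebesgue_measure]_(x in D) c = c * 2.
  by rewrite /Rintegral integral_cst// [X in (_ * X)%E](_ : _ = 2%:E) ?lD.
have -> : iota_step j - h (2 * j%:R) = 2^-1 * \int[lebesgue_measure]_(x in D) (h x - h (2 * j%:R)).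
  rewrite RintegralB//; last exact: ic.
  by rewrite Ic -/(iota_step j) mulrBr mulrCA mulVf// mulr1.
rewrite normrM ger0_norm// -ler_pdivlMl// invrK.
have iB : lebesgue_measure.-integrable D (EFin \o (fun x => h x - h (2 * j%:R))).
  exact: (integrableB mD ih (ic (h (2 * j%:R)))).
apply: le_trans (le_normr_Rintegral mD iB) _.
rewrite [leRHS]mulrC -(Ic (K * 2 * j%:R `^ (- power_decay))).
apply: (@le_Rintegral _ _ _ (@lebesgue_measure R) D) => //.
- exact: integrable_norm iB.
- exact: ic.
- move=> x; rewrite /D/= in_itv/= => /andP[jx xj].
  by apply: HK => //; lra.
Qed.

Lemma iota_fun_step (n : nat) : (0 < n)%N ->
  iota_fun h (2 * n.+1%:R) = iota_fun h (2 * n%:R) + iota_step n.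
Proof.
move=> n0; have nR : (1 : R) <= n%:R by rewrite ler1n.
have nS : (n.+1%:R : R) = n%:R + 1 by rewrite -natr1.
rewrite /iota_fun /iota_step -mulrDr; congr (_ * _).
apply/eqP; rewrite addrC -subr_eq; apply/eqP.
have ih := integrable_h (2 * n.+1%:R) ltr01.
rewrite Rintegral_itvB//; last 2 first.
- by rewrite bnd_simp; lra.
- by rewrite bnd_simp; lra.
rewrite Rintegral_itv_obnd_cbnd//; apply: integrableS (integrable_h (2 * n.+1%:R) (_ : 0 < 2 * n%:R)) => //.
- exact: subset_itv_oc_cc.
- by lra.
Qed.

Lemma powR_nat_cvg0 (q : R) : 0 < q -> (j%:R `^ (- q) : R) @[j --> \oo] --> 0.
Proof.
move=> q0; apply/cvgrPdist_le => e e0.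
near=> j; rewrite sub0r normrN ger0_norm ?powR_ge0// powRN.
have j0 : 0 < (j%:R : R) by near: j; exact: nbhs_infty_gtr.
rewrite invf_ple ?posrE ?powR_gt0//.
have -> : e^-1 = (e^-1 `^ q^-1) `^ q.
  by rewrite -powRrM mulVf ?gt_eqF// powRr1// invr_ge0 ltW.
rewrite ge0_ler_powR ?nnegrE ?powR_ge0 ?ltW//.
near: j; exact: nbhs_infty_gtr.
Unshelve. all: by end_near. Qed.

Lemma lnMo_diff2_cvg0 s : lnMo_diff2 (j.*2 + s) @[j --> \oo] --> 0.
Proof.
have [C [X [C0 HC]]] := bigO_pinfty h_bigO.
have [K [Y [K0 HK]]] := lnMo_diff2_h s.
have p0 : 0 < power_decay by rewrite /power_decay lt_min !(lt_trans ltr01).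
have U : (K * j%:R `^ (- power_decay) + C * (2 `^ (- beta) * j%:R `^ (- beta))) @[j --> \oo] --> (0 : R).
  rewrite -[X in _ --> X](addr0 0); apply: cvgD.
    by rewrite -[X in _ --> X](mulr0 K); apply: cvgMr; exact: powR_nat_cvg0.
  rewrite -[X in _ --> X](mulr0 C); apply: cvgMr.
  by rewrite -[X in _ --> X](mulr0 (2 `^ (- beta))); apply: cvgMr; exact: powR_nat_cvg0.
apply/norm_cvg0P; apply: (squeeze_cvgr _ (cvg_cst 0) U).
near=> j; rewrite normr_ge0/=.
have j0 : (0 < j)%N by near: j; exact: nbhs_infty_gt.
have jR : (0 : R) < j%:R by rewrite ltr0n.
have Yj : Y < j%:R by near: j; exact: nbhs_infty_gtr.
have Xj : X < j%:R by near: j; exact: nbhs_infty_gtr.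
rewrite -[X in `|X|](subrK (h (2 * j%:R))).
apply: le_trans (ler_normD _ _) (lerD (HK _ Yj j0) _).
apply: le_trans (HC _ _) _; first by lra.
by rewrite ger0_norm ?powR_ge0// powRM// ltW.
Unshelve. all: by end_near. Qed.

End growth.

End log_moments.

(** * Variance of a single mode *)

Section sums.
Variable R : realType.

(** With x = j / (j + 1) this is x^(- q) >= 1 - q ln x >= 1 + q (1 - x). Summed over j, the right
    side telescopes. *)
Lemma powR_step (q : R) (j : nat) : 0 < q -> (0 < j)%N ->
  q * j.+1%:R `^ (- (q + 1)) <= j%:R `^ (- q) - j.+1%:R `^ (- q).
Proof.
move=> q0 j0; have jR : (0 : R) < j%:R by rewrite ltr0n.
have kR : (0 : R) < j.+1%:R by rewrite ltr0n.
pose x : R := j%:R / j.+1%:R.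
have x0 : 0 < x by exact: divr_gt0.
have xE : 1 - x = j.+1%:R^-1.
  by rewrite /x -natr1; field; rewrite natr1 pnatr_eq0.
have -> : j%:R `^ (- q) = j.+1%:R `^ (- q) * x `^ (- q).
  by rewrite -powRM ?ltW// /x mulrCA divff ?mulr1// gt_eqF.
have -> : j.+1%:R `^ (- (q + 1)) = j.+1%:R `^ (- q) / j.+1%:R.
  by rewrite opprD powRD ?(gt_eqF kR) ?implybT// powR_inv1// ltW.
rewrite mulrCA -[X in _ <= _ - X]mulr1 -mulrBr ler_wpM2l ?powR_ge0//.
rewrite lerBrDl -xE; apply: le_trans (_ : 1 + - q * ln x <= _); last first.
  by rewrite /powR gt_eqF// expR_ge1Dx.
rewrite lerD2l mulNr -mulrN ler_wpM2l ?(ltW q0)// lerNr opprB lerBrDl.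
by have := expR_ge1Dx (ln x); rewrite lnK ?posrE.
Qed.

Lemma sum_powR_bounded (p : R) : 1 < p ->
  exists M : R, forall n, \sum_(j < n) (j%:R : R) `^ (- p) <= M.
Proof.
move=> p1; pose q := p - 1; have q0 : 0 < q by rewrite subr_gt0.
have pE : p = q + 1 by rewrite subrK.
exists (1 + q^-1) => n.
(* The sums start at j = 0, where the power is 0 by the convention on [powR]. *)
have z : (0 : R) `^ (- p) = 0 by rewrite powR0// oppr_eq0 gt_eqF// (lt_trans ltr01).
have H m : \sum_(j < m.+2) (j%:R : R) `^ (- p) <= 1 + q^-1 * (1 - m.+1%:R `^ (- q)).
  elim: m => [|m IH].
    by rewrite !big_ord_recr/= big_ord0 z !add0r !powR1 subrr mulr0 addr0.
  rewrite big_ord_recr/=; apply: le_trans (lerD IH (lexx _)) _.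
  rewrite -addrA lerD2l -lerBrDl -mulrBr ler_pdivlMl// pE.
  by apply: le_trans (powR_step q0 _) _ => //; lra.
have mono m m' : (m <= m')%N -> \sum_(j < m) (j%:R : R) `^ (- p) <= \sum_(j < m') (j%:R : R) `^ (- p).
  move=> mm; rewrite -!(big_mkord xpredT (fun j => (j%:R : R) `^ (- p))) (big_cat_nat _ mm)//=.
  by rewrite lerDl sumr_ge0// => i _; exact: powR_ge0.
apply: le_trans (mono n n.+2 _) _; first by rewrite -addn2 leq_addr.
apply: le_trans (H n) _; rewrite lerD2l -[leRHS]mulr1 ler_wpM2l ?invr_ge0 ?(ltW q0)// gerBl powR_ge0.
Qed.

Lemma sum_decay_bounded (p K X : R) (e : nat -> R) : 1 < p -> 0 < K ->
  (forall j, X < j%:R -> (0 < j)%N -> `|e j| <= K * j%:R `^ (- p)) ->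
  exists M, forall n, `|\sum_(j < n) e j| <= M.
Proof.
move=> p1 K0 He; have [M HM] := sum_powR_bounded p1.
have [N XN] : exists N : nat, X < N%:R.
  by exists (Num.bound `|X|); apply: le_lt_trans (ler_norm _) _; rewrite archi_boundP.
exists (\sum_(j < N.+1) `|e j| + K * M) => n.
apply: le_trans (ler_norm_sum _ _ _) _.
apply: le_trans (_ : \sum_(j < N.+1) `|e j| + K * \sum_(j < n) (j%:R : R) `^ (- p) <= _); last first.
  by rewrite lerD2l ler_wpM2l// ltW.
elim: n => [|n IH].
  by rewrite !big_ord0 mulr0 addr0 sumr_ge0.
have [Nn|nN] := leqP N.+1 n.
  rewrite [leLHS]big_ord_recr (big_ord_recr n)/= mulrDr addrA lerD//; apply: He.
    by apply: lt_le_trans XN _; rewrite ler_nat ltnW.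
  exact: leq_trans Nn.
have -> : \sum_(j < N.+1) `|e j| = \sum_(j < n.+1) `|e j| + \sum_(n.+1 <= j < N.+1) `|e j|.
  by rewrite -!(big_mkord xpredT (fun j => `|e j|)) (big_cat_nat _ nN).
rewrite -addrA lerDl addr_ge0 ?sumr_ge0// mulr_ge0 ?(ltW K0)// sumr_ge0// => i _; exact: powR_ge0.
Qed.

Lemma cvg_pinfty_ge (J : nat -> R) (A : R) : J n @[n --> \oo] --> +oo_R ->
  \forall n \near \oo, A <= J n.
Proof. by move=> H; have Y := (@cvgryPge R nat \oo%classic _ J).1 H A; exact: Y. Qed.

Lemma cvg_pinfty_gt (J : nat -> R) (A : R) : J n @[n --> \oo] --> +oo_R ->
  \forall n \near \oo, A < J n.
Proof. by move=> H; have Y := (@cvgryPgt R nat \oo%classic _ J).1 H A; exact: Y. Qed.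

Lemma bounded_over_infty (u J : nat -> R) (M : R) : (\forall n \near \oo, `|u n| <= M) ->
  J n @[n --> \oo] --> +oo_R -> u n / J n @[n --> \oo] --> (0 : R).
Proof.
move=> uM Joo; apply/cvgrPdist_le => e e0; near=> n.
rewrite sub0r normrN normrM normfV.
have J0 : 0 < J n by near: n; exact: (cvg_pinfty_gt _ Joo).
have Je : M / e <= J n by near: n; exact: (cvg_pinfty_ge _ Joo).
have uMn : `|u n| <= M by near: n.
rewrite (gtr0_norm J0) ler_pdivrMr//; apply: le_trans uMn _.
by rewrite mulrC -ler_pdivrMr.
Unshelve. all: by end_near. Qed.

(** Cesaro argument: beyond an index N the terms [a] are a small multiple of [b], whose sums are
    O(J); the finitely many earlier terms are absorbed because J tends to infinity. *)
Lemma little_sum_over_infty (a b J : nat -> R) (C : R) : 0 < C -> (forall j, 0 <= b j) ->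
  (\forall n \near \oo, \sum_(j < n) b j <= C * J n) -> J n @[n --> \oo] --> +oo_R ->
  (forall e, 0 < e -> \forall j \near \oo, `|a j| <= e * b j) ->
  (\sum_(j < n) a j) / J n @[n --> \oo] --> (0 : R).
Proof.
move=> C0 b0 bC Joo ab; apply/cvgrPdist_le => e e0.
have e1 : 0 < e / 2 / C by rewrite !divr_gt0.
have [N _ HN] := ab _ e1.
pose A := \sum_(j < N) `|a j|.
have A0 : 0 <= A by exact: sumr_ge0.
have H n : \sum_(j < n) `|a j| <= A + e / 2 / C * \sum_(j < n) b j.
  elim: n => [|n IH]; first by rewrite !big_ord0 mulr0 addr0.
  have [Nn|nN] := leqP N n.
    by rewrite !big_ord_recr/= mulrDr addrA lerD// HN.
  rewrite /A -!(big_mkord xpredT (fun j => `|a j|)) (big_cat_nat _ nN)//= -addrA lerDl.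
  by rewrite addr_ge0 ?sumr_ge0// mulr_ge0 ?(ltW e1)// sumr_ge0.
near=> n; rewrite sub0r normrN normrM normfV.
have J0 : 0 < J n by near: n; exact: (cvg_pinfty_gt _ Joo).
have Je : A / (e / 2) <= J n by near: n; exact: (cvg_pinfty_ge _ Joo).
have bCn : \sum_(j < n) b j <= C * J n by near: n.
rewrite (gtr0_norm J0) ler_pdivrMr//.
apply: le_trans (ler_norm_sum _ _ _) _; apply: le_trans (H n) _.
have -> : e * J n = e / 2 * J n + e / 2 * J n by rewrite -mulrDl -splitr.
apply: lerD; first by rewrite mulrC -ler_pdivrMr// divr_gt0.
have -> : e / 2 * J n = e / 2 / C * (C * J n) by rewrite mulrA mulfVK// gt_eqF.
by rewrite ler_wpM2l// ltW.
Unshelve. all: by end_near. Qed.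

Lemma cvg_bigsum (I : Type) (r : seq I) (F : I -> nat -> R) (l : I -> R) :
  (forall i, F i n @[n --> \oo] --> l i) ->
  (\sum_(i <- r) F i n) @[n --> \oo] --> \sum_(i <- r) l i.
Proof.
move=> Fl; elim: r => [|i r IH].
  by rewrite big_nil; under eq_fun do rewrite big_nil; exact: cvg_cst.
by rewrite big_cons; under eq_fun do rewrite big_cons; exact: cvgD (Fl i) IH.
Qed.

Lemma sum_even_odd (d : nat -> R) n : \sum_(i < n.*2) d i = \sum_(j < n) (d j.*2 + d j.*2.+1).
Proof.
by elim: n => [|n IH]; rewrite ?big_ord0// doubleS !big_ord_recr/= IH addrA.
Qed.

Section variance_sequence.
Variables (d J : nat -> R).
Hypothesis d0 : forall i, 0 <= d i.
Hypothesis Joo : J n @[n --> \oo] --> +oo_R.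
Hypothesis dJ : forall s, (\sum_(j < n) d (j.*2 + s)) / J n @[n --> \oo] --> (1 : R).
Hypothesis d_cvg0 : forall s, d (j.*2 + s) @[j --> \oo] --> (0 : R).

(** When [d] is the second difference of step 1, this is the second difference of step k at 2 j,
    written as a sum over a square of indices. *)
Definition square_sum k j : R := \sum_(a < k) \sum_(b < k) d (j.*2 + (a + b)).

(* If [d] is the second difference of the log moments, then
   [expR (- square_sum k j)] is [rho j (j + k) ^+ 2]. *)
Definition mode_variance n k : R :=
  (minn n k)%:R + \sum_(j < n - k) (1 - expR (- square_sum k j)).

Lemma square_sum_ge0 k j : 0 <= square_sum k j.
Proof. by do 2 (apply: sumr_ge0 => ? _). Qed.

Lemma one_sub_expR_ge0 k j : 0 <= 1 - expR (- square_sum k j).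
Proof. by rewrite subr_ge0 -expR0 ler_expR oppr_le0 square_sum_ge0. Qed.

Lemma mode_variance_ge0 n k : 0 <= mode_variance n k.
Proof. by rewrite addr_ge0// sumr_ge0// => j _; exact: one_sub_expR_ge0. Qed.

(** For fixed a and b the indices 2 j + a + b with j < n - k are distinct and below 2 n, because a
    and b are below k; there are k^2 pairs (a, b). *)
Lemma sum_square_sum_le n k :
  \sum_(j < n - k) square_sum k j <= k%:R ^+ 2 * \sum_(i < n.*2) d i.
Proof.
rewrite /square_sum exchange_big/=.
have -> : k%:R ^+ 2 * \sum_(i < n.*2) d i = \sum_(a < k) \sum_(b < k) \sum_(i < n.*2) d i.
  by rewrite !sumr_const !card_ord -mulrnA -[RHS]mulr_natl natrM.
apply: ler_sum => a _; rewrite exchange_big/=; apply: ler_sum => b _.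
have [nk|kn] := leqP n k.
  by move/eqP : nk => ->; rewrite big_ord0 sumr_ge0.
have mono (f : nat -> R) m m' : (forall i, 0 <= f i) -> (m <= m')%N ->
    \sum_(i < m) f i <= \sum_(i < m') f i.
  move=> f0 mm; rewrite -!(big_mkord xpredT f) (big_cat_nat _ mm)//=.
  by rewrite lerDl sumr_ge0.
apply: le_trans (_ : \sum_(i < (n - k).*2) d (i + (a + b)) <= _).
  rewrite (sum_even_odd (fun i => d (i + (a + b)))).
  by apply: ler_sum => j _; rewrite lerDl.
have -> : \sum_(i < (n - k).*2) d (i + (a + b)) = \sum_(a + b <= i < (n - k).*2 + (a + b)) d i.
  have := @big_addn R 0 +%R 0 ((n - k).*2 + (a + b)) (a + b) xpredT d.
  by rewrite add0n addnK big_mkord => ->.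
apply: le_trans (_ : \sum_(i < (n - k).*2 + (a + b)) d i <= _).
  by rewrite -(big_mkord xpredT d) (big_cat_nat (leq0n (a + b)) (leq_addl _ _))/= lerDr sumr_ge0.
apply: mono => //; rewrite -[X in (_ <= X.*2)%N](subnK (ltnW kn)) doubleD leq_add2l -addnn.
by rewrite leq_add// ltnW.
Qed.

(** Each parity class contributes at most 2 J, as its ratio to J tends to 1. *)
Lemma sum_d_le : \forall n \near \oo, \sum_(i < n.*2) d i <= 4 * J n.
Proof.
have H s : \forall n \near \oo, \sum_(j < n) d (j.*2 + s) <= 2 * J n.
  near=> n; have J0 : 0 < J n by near: n; exact: (cvg_pinfty_gt _ Joo).
  rewrite -ler_pdivrMr//; near: n; apply: (cvgr_le _ (dJ s)).
  by rewrite ltr1n.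
near=> n; rewrite sum_even_odd big_split/=.
have -> : 4 * J n = 2 * J n + 2 * J n by ring.
apply: lerD.
  by under eq_bigr do rewrite -[_.*2]addn0; near: n; exact: H.
by under eq_bigr do rewrite -addn1; near: n; exact: H.
Unshelve. all: by end_near. Qed.

(** Uniformity in k is the point: this is the majorant for dominated convergence over the modes. The
    5 is 1 + 4: min(n, k) <= k^2 J once J >= 1, and 1 - exp(- s) <= s brings in the 4 J of
    [sum_d_le]. *)
Lemma mode_variance_le : \forall n \near \oo, forall k, mode_variance n k <= 5 * k%:R ^+ 2 * J n.
Proof.
near=> n => k; have J1 : 1 <= J n by near: n; exact: (cvg_pinfty_ge _ Joo).
have S : \sum_(i < n.*2) d i <= 4 * J n by near: n; exact: sum_d_le.
have -> : 5 * k%:R ^+ 2 * J n = k%:R ^+ 2 * J n + k%:R ^+ 2 * (4 * J n) by ring.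
apply: lerD.
  apply: le_trans (_ : k%:R <= _); first by rewrite ler_nat geq_minr.
  case: (k) => [|k']; first by rewrite expr0n/= mul0r.
  have k1 : (1 : R) <= k'.+1%:R by rewrite ler1n.
  by rewrite expr2 -mulrA ler_peMr// -[leLHS]mulr1 ler_pM.
apply: le_trans (_ : \sum_(j < n - k) square_sum k j <= _).
  by apply: ler_sum => j _; have := expR_ge1Dx (- square_sum k j); lra.
apply: le_trans (sum_square_sum_le n k) _.
by rewrite ler_wpM2l// sqr_ge0.
Unshelve. all: by end_near. Qed.

Lemma square_sum_cvg0 k : square_sum k j @[j --> \oo] --> (0 : R).
Proof.
rewrite [X in _ --> X](_ : 0 = \sum_(a < k) \sum_(b < k) 0); last by rewrite !big1.
apply: cvg_bigsum => a; apply: cvg_bigsum => b; exact: d_cvg0.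
Qed.

Lemma sum_square_sum_cvg k : (\sum_(j < n) square_sum k j) / J n @[n --> \oo] --> (k%:R ^+ 2 : R).
Proof.
have -> : (fun n => (\sum_(j < n) square_sum k j) / J n) =
    (fun n => \sum_(a < k) \sum_(b < k) (\sum_(j < n) d (j.*2 + (a + b))) / J n).
  apply/funext => n; rewrite exchange_big mulr_suml; apply: eq_bigr => a _.
  by rewrite exchange_big mulr_suml.
rewrite [X in _ --> X](_ : _ = \sum_(a < k) \sum_(b < k) 1); last first.
  by rewrite !sumr_const !card_ord -mulrnA natrM.
by apply: cvg_bigsum => a; apply: cvg_bigsum => b; exact: dJ.
Qed.

(** Linearisation of 1 - exp(- s): since s tends to 0 along j, the quadratic error is negligible
    against the sum of the s, which is O(J). *)
Lemma mode_variance_cvg k : mode_variance n k / J n @[n --> \oo] --> (k%:R ^+ 2 : R).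
Proof.
pose x j := 1 - expR (- square_sum k j).
pose e j := square_sum k j - x j.
have x0 j : 0 <= x j by exact: one_sub_expR_ge0.
have x1 j : x j <= 1 by rewrite gerBl expR_ge0.
(* Boundary terms: min(n, k) is at most k, and the at most k summands between n - k and n are at
   most 1 each. *)
have eb n : `|mode_variance n k - \sum_(j < n) x j| <= k%:R + k%:R.
  have [nk|kn] := leqP n k.
    rewrite /mode_variance (eqP nk) big_ord0 addr0 (minn_idPl nk).
    apply: le_trans (ler_normB _ _) _; rewrite ger0_norm//.
    apply: lerD; first by rewrite ler_nat.
    rewrite ger0_norm ?sumr_ge0//; apply: le_trans (_ : \sum_(j < n) 1 <= _); first exact: ler_sum.
    by rewrite sumr_const card_ord ler_nat.
  rewrite /mode_variance (minn_idPr (ltnW kn)) -addrA.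
  apply: le_trans (ler_normD _ _) _; rewrite ger0_norm// lerD2l distrC.
  rewrite -!(big_mkord xpredT x) -/(x _) (big_cat_nat (n := n - k))//= ?leq_subr//.
  rewrite addrAC subrr add0r ger0_norm ?sumr_ge0//.
  apply: le_trans (_ : \sum_(n - k <= j < n) 1 <= _); first exact: ler_sum.
  by rewrite big_const_nat iter_addr_0 subKn// ltnW.
have E : (fun n => mode_variance n k / J n) = (fun n => (\sum_(j < n) square_sum k j) / J n +
   ((mode_variance n k - \sum_(j < n) x j) / J n - (\sum_(j < n) e j) / J n)).
  apply/funext => n; rewrite -mulrBl -mulrDl; congr (_ / _).
  rewrite /e (sumrB _ _ (fun j : 'I_n => square_sum k j)).
  by move: (mode_variance n k) (\sum_(j < n) square_sum k j) (\sum_(j < n) x j) => a b c; ring.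
rewrite E -[X in _ --> X]addr0; apply: cvgD; first exact: sum_square_sum_cvg.
rewrite -[X in _ --> X](subrr 0); apply: cvgB.
  by apply: (bounded_over_infty (M := k%:R + k%:R)) => //; near=> n; exact: eb.
have Y : \forall n \near \oo, (\sum_(j < n) square_sum k j) / J n <= k%:R ^+ 2 + 1.
  have k1 : (k%:R ^+ 2 : R) < k%:R ^+ 2 + 1 by rewrite ltrDl.
  have Z := cvgr_le _ (@sum_square_sum_cvg k) _ k1; exact: Z.
have C0 : 0 < k%:R ^+ 2 + 1 :> R by rewrite ltr_wpDl ?sqr_ge0.
apply: (little_sum_over_infty (b := square_sum k) C0) => //.
- exact: square_sum_ge0.
- near=> n; have J0 : 0 < J n by near: n; exact: (cvg_pinfty_gt _ Joo).
  by rewrite -ler_pdivrMr//; near: n; exact: Y.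
- move=> eps eps0; near=> j.
  have s0 := square_sum_ge0 k j.
  have s1 : square_sum k j <= eps by near: j; exact: (cvgr_le _ (@square_sum_cvg0 k)).
  have eE : e j = expR (- square_sum k j) - (1 + - square_sum k j) by rewrite /e /x; ring.
  have e0 : 0 <= e j by rewrite eE subr_ge0 expR_ge1Dx.
  rewrite ger0_norm//; apply: le_trans (_ : square_sum k j * square_sum k j <= _); last first.
    by rewrite ler_wpM2r.
  rewrite eE; move: s0; set s := square_sum k j => s0.
  (* From exp(- s) <= 1 / (1 + s) follows exp(- s) - 1 + s <= s^2. *)
  have : expR (- s) * (1 + s) <= 1.
    by rewrite -[leRHS]expR0 -(addNr s) expRD ler_wpM2l ?expR_ge0// expR_ge1Dx.
  have := expR_ge0 (- s); have : expR (- s) <= 1 by rewrite -expR0 ler_expR oppr_le0.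
  by nra.
Unshelve. all: by end_near. Qed.

End variance_sequence.
End sums.

Section moment_variance.
Variable R : realType.
Variable mu : {finite_measure set (measurableTypeR R) -> \bar R}.
Hypothesis mu_nonneg : mu `]-oo, 0%R[%classic = 0%E.
Hypothesis mu_no_atom0 : mu [set 0%R] = 0%E.
Hypothesis mu_nonzero : (0 < mu setT)%E.
Hypothesis mu_moments : forall xi : R, 0 <= xi -> (moment mu xi < +oo)%E.

(** Double telescoping: the sum over b leaves a difference of two increments of step k, at
    neighbouring indices, and the sum over a telescopes those. *)
Lemma square_sum_lnMo m k : \sum_(a < k) \sum_(b < k) lnMo_diff2 mu (m + (a + b)) =
  ln (Mo mu m) - 2 * ln (Mo mu (m + k)) + ln (Mo mu (m + (k + k))).
Proof.
pose l (i : nat) := ln (Mo mu i).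
have H1 i k' : \sum_(b < k') lnMo_diff2 mu (i + b) = (l i - l (i + k')%N) - (l i.+1 - l (i.+1 + k')%N).
  elim: k' => [|k' IH]; first by rewrite big_ord0 !addn0; ring.
  rewrite big_ord_recr/= IH /lnMo_diff2 !addnS !addSn -/(l _) -/(l _) -/(l _).
  by move: (l i) (l i.+1) (l (i + k')%N) (l (i + k').+1) (l (i + k').+2) => a b c d e; ring.
have H2 k' : \sum_(a < k') \sum_(b < k) lnMo_diff2 mu (m + (a + b)) =
    (l m - l (m + k)%N) - (l (m + k')%N - l (m + k' + k)%N).
  elim: k' => [|k' IH]; first by rewrite big_ord0 !addn0 subrr.
  rewrite big_ord_recr/= IH; under eq_bigr do rewrite addnA.
  rewrite H1 addnS !addSn.
  move: (l m) (l (m + k)%N) (l (m + k')%N) (l (m + k' + k)%N) (l (m + k').+1) (l (m + k' + k).+1).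
  by move=> a b c d e f; ring.
by rewrite H2 addnA -/(l m) -/(l _) -/(l _); move: (l m) (l (m + k)%N) (l (m + k + k)%N) => a b c; ring.
Qed.

Lemma rho_sqr j k : rho mu j (j + k) ^+ 2 = expR (- square_sum (lnMo_diff2 mu) k j).
Proof.
have M0 i := Mo_gt0 mu_nonneg mu_no_atom0 mu_moments mu_nonzero i.
rewrite /square_sum square_sum_lnMo -addnn /rho addnA.
have -> : (j + k + (j + k) = j + j + (k + k))%N by rewrite addnACA.
rewrite expr_div_n sqr_sqrtr ?mulr_ge0 ?(ltW (M0 _))//.
apply: ln_inj; rewrite ?posrE ?expR_gt0 ?divr_gt0 ?exprn_gt0 ?mulr_gt0//.
rewrite expRK ln_div ?posrE ?exprn_gt0 ?mulr_gt0// lnXn// lnM ?posrE//.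
by ring.
Qed.

Variables (beta prho gamma : R) (h : R -> R).
Hypothesis beta_gt0 : 0 < beta.
Hypotheses (rho_gt : 1 < prho) (gamma_gt : 1 < gamma).
Hypothesis h_diff : forall xi : R, 0 < xi -> derivable h xi 1.
Hypothesis ln_moment_h : derive1n 2 (ln_moment mu) = h +O_ (+oo_R) (fun xi => xi `^ (- prho)).
Hypothesis h_bigO : h =O_ (+oo_R) (fun xi => xi `^ (- beta)).
Hypothesis dh_bigO : derive1 h =O_ (+oo_R) (fun xi => xi `^ (- gamma)).
Hypothesis iota_infty : iota_fun h x @[x --> +oo_R] --> +oo_R.

Definition iota2 n : R := iota_fun h (2 * n%:R).

Lemma iota2_cvg : iota2 n @[n --> \oo] --> +oo_R.
Proof.
have H : (2 * n%:R : R) @[n --> \oo] --> +oo_R.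
  apply/(@cvgryPge R nat \oo%classic) => A; near=> n.
  rewrite -ler_pdivrMl//; near: n; exact: nbhs_infty_ger.
exact: (cvg_comp _ _ H iota_infty).
Unshelve. all: by end_near. Qed.

(** The second differences and the increments [iota_step] are both within a summable error of h(2
    j), so for every shift s the sum differs from iota(2 n) by a bounded amount. *)
Lemma sum_lnMo_diff2_cvg s :
  (\sum_(j < n) lnMo_diff2 mu (j.*2 + s)) / iota2 n @[n --> \oo] --> (1 : R).
Proof.
pose p := power_decay prho gamma.
have p1 : 1 < p by rewrite /p /power_decay lt_min rho_gt gamma_gt.
have [K1 [X1 [K10 H1]]] := lnMo_diff2_h mu_nonneg mu_no_atom0 mu_moments mu_nonzero rho_gt gamma_gt h_diff ln_moment_h dh_bigO s.
have [K2 [X2 [K20 H2]]] := iota_step_h rho_gt gamma_gt h_diff dh_bigO.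
pose e j := lnMo_diff2 mu (j.*2 + s) - iota_step h j.
have He j : Num.max X1 X2 < j%:R -> (0 < j)%N -> `|e j| <= (K1 + K2) * j%:R `^ (- p).
  rewrite gt_max => /andP[x1 x2] j0; rewrite mulrDl.
  have -> : e j = (lnMo_diff2 mu (j.*2 + s) - h (2 * j%:R)) - (iota_step h j - h (2 * j%:R)).
    by rewrite opprB addrA subrK.
  by apply: le_trans (ler_normB _ _) _; apply: lerD; [exact: H1|exact: H2].
have [M HM] := sum_decay_bounded p1 (addr_gt0 K10 K20) He.
(* Since iota starts at 1, its increments are summed from j = 1 on. The quantity [iota_step h 0],
   over an interval reaching 0 where [h] is not controlled, occurs in [e 0] and is compensated on
   the right. *)
have E n : (0 < n)%N -> \sum_(j < n) lnMo_diff2 mu (j.*2 + s) - iota2 n =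
    \sum_(j < n) e j + (iota_step h 0 - iota2 1).
  case: n => // n _; elim: n => [|n IH].
    by rewrite !big_ord_recl !big_ord0 /e; ring.
  rewrite big_ord_recr [in RHS]big_ord_recr/= /iota2 iota_fun_step// -/(iota2 n.+1).
  rewrite [in RHS]addrAC -IH /e.
  move: (\sum_(j < n.+1) _) (lnMo_diff2 _ _) (iota2 n.+1) (iota_step h n.+1) => a b c d; ring.
have J := iota2_cvg.
have B : (\sum_(j < n) lnMo_diff2 mu (j.*2 + s) - iota2 n) / iota2 n @[n --> \oo] --> (0 : R).
  apply: (bounded_over_infty (M := M + `|iota_step h 0 - iota2 1|)) => //.
  near=> n; rewrite E; last by near: n; exact: nbhs_infty_gt.
  by apply: le_trans (ler_normD _ _) _; rewrite lerD2r.
have C : (1 + (\sum_(j < n) lnMo_diff2 mu (j.*2 + s) - iota2 n) / iota2 n) @[n --> \oo] --> (1 : R).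
  by rewrite -[X in _ --> X]addr0; apply: cvgD => //; exact: cvg_cst.
apply: cvg_trans C; apply: near_eq_cvg; near=> n.
have n0 : 0 < iota2 n by near: n; exact: (cvg_pinfty_gt _ J).
by field; rewrite gt_eqF.
Unshelve. all: by end_near. Qed.

Lemma mode_variance_lnMo_le : \forall n \near \oo, forall k,
  mode_variance (lnMo_diff2 mu) n k <= 5 * k%:R ^+ 2 * iota2 n.
Proof.
apply: mode_variance_le iota2_cvg sum_lnMo_diff2_cvg => i.
exact: lnMo_diff2_ge0.
Qed.

Lemma mode_variance_lnMo_cvg k :
  mode_variance (lnMo_diff2 mu) n k / iota2 n @[n --> \oo] --> (k%:R ^+ 2 : R).
Proof.
apply: (mode_variance_cvg _ iota2_cvg sum_lnMo_diff2_cvg) => [i|s].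
  exact: lnMo_diff2_ge0.
exact: (lnMo_diff2_cvg0 mu_nonneg mu_no_atom0 mu_moments mu_nonzero beta_gt0 rho_gt gamma_gt h_diff ln_moment_h h_bigO dh_bigO).
Qed.

End moment_variance.

(** * Polynomial approximation and Levy continuity *)

Section bernstein.
Variable R : realType.
Implicit Types (phi psi : nat -> R) (y : R).

(* The mean of [phi] under the binomial law (n, y), conditioning on the first trial. *)
Fixpoint bern n y phi : R :=
  if n is m.+1 then (1 - y) * bern m y phi + y * bern m y (phi \o succn)
  else phi 0%N.

Lemma bernD n y a phi psi :
  bern n y (fun k => a * phi k + psi k) = a * bern n y phi + bern n y psi.
Proof.
elim: n phi psi => [//|n IH] phi psi /=.
rewrite IH (IH (phi \o succn) (psi \o succn)).
move: (bern n y phi) (bern n y psi) (bern n y (phi \o succn)) (bern n y (psi \o succn)) => b c d e.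
by ring.
Qed.

Lemma bern_cst n y a : bern n y (fun=> a) = a.
Proof.
elim: n => [//|n IH] /=; rewrite (_ : _ \o _ = fun=> a)// IH; ring.
Qed.

Lemma bern_mono n y phi psi : 0 <= y -> y <= 1 -> (forall k, phi k <= psi k) ->
  bern n y phi <= bern n y psi.
Proof.
move=> y0 y1; elim: n phi psi => [|n IH] phi psi le /=; first exact: le.
by apply: lerD; apply: ler_wpM2l; rewrite ?subr_ge0//; apply: IH => k /=.
Qed.

(** Second moment of the binomial law about -c. Conditioning on the first trial shifts c by 1, hence
    the general c; the choice c = - n y gives the variance. *)
Lemma bern_variance n y c :
  bern n y (fun k => (k%:R + c) ^+ 2) = (n%:R * y + c) ^+ 2 + n%:R * (y * (1 - y)).
Proof.
elim: n c => [|n IH] c /=; first by rewrite mul0r add0r mul0r addr0.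
have -> : (fun k => (k%:R + c) ^+ 2) \o succn = fun k => (k%:R + (1 + c)) ^+ 2.
  by apply/funext => k /=; rewrite -natr1 addrA.
by rewrite !IH -natr1; ring.
Qed.

(** Chebyshev's argument: averaging the quadratic bound produces the binomial variance n y (1 - y),
    which is at most n. *)
Lemma bern_near n y phi L e C : 0 <= y -> y <= 1 -> 0 <= C ->
  (forall k, `|phi k - L| <= e + C * (k%:R - n%:R * y) ^+ 2) ->
  `|bern n y phi - L| <= e + C * n%:R.
Proof.
move=> y0 y1 C0 H.
have V : bern n y (fun k => C * (k%:R + (- (n%:R * y))) ^+ 2 + e) <= e + C * n%:R.
  rewrite bernD bern_cst bern_variance subrr expr0n/= add0r addrC lerD2l ler_wpM2l//.
  rewrite -[leRHS]mulr1 ler_wpM2l// -[leRHS]mulr1 ler_pM ?subr_ge0//.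
  by rewrite gerBl.
rewrite ler_norml; apply/andP; split.
  rewrite lerNl opprB lerBlDl -lerBlDr; apply: le_trans (_ : L - bern n y (fun k => C * (k%:R + (- (n%:R * y))) ^+ 2 + e) <= _).
    by rewrite lerB.
  rewrite lerBlDl -{1}(bern_cst n y L) -[leRHS]mul1r [leRHS]mul1r -[X in _ <= _ + X]mul1r addrC -bernD.
  apply: bern_mono => // k; have := H k; rewrite ler_norml => /andP[+ _]; lra.
rewrite lerBlDl; apply: le_trans (_ : L + bern n y (fun k => C * (k%:R + (- (n%:R * y))) ^+ 2 + e) <= _).
  rewrite -{1}(bern_cst n y L) -[X in _ <= X + _]mul1r -bernD.
  apply: bern_mono => // k; have := H k; rewrite ler_norml => /andP[_ +]; lra.
by rewrite lerD2l.
Qed.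

(** Only [x] is confined to the segment: in [bern_near] the nodes k / n range over all k and may
    leave [0, 1]. *)
Lemma unif_continuous_segment (G : R -> R) (a b e : R) : continuous G -> 0 < e ->
  exists2 d, 0 < d & forall x y, a <= x <= b -> `|y - x| < d -> `|G y - G x| <= e.
Proof.
move=> cG e0.
have /compact_near_coveringP cov := @segment_compact R a b.
have := cov R (0 : R)^'+ (fun d x => forall y, `|y - x| < d -> `|G y - G x| <= e) _.
have H (x : R) : `[a, b]%classic x -> \forall x' \near x & i \near (0 : R)^'+,
    forall y, `|y - x'| < i -> `|G y - G x'| <= e.
  move=> _; have e2 : 0 < e / 2 by rewrite divr_gt0.
  have /cvgrPdist_le/(_ _ e2) [d /= d0 Hd] := cG x.
  have d2 : 0 < d / 2 by rewrite divr_gt0.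
  exists (ball x (d / 2), [set i | i < d / 2]).
    by split; [exact: nbhsx_ballx|exact: nbhs_right_lt].
  move=> [x' i]/= [xx' id] y yx'.
  have h1 := Hd x'; have h2 := Hd y.
  have {}h1 : `|G x - G x'| <= e / 2 by apply: h1; apply: lt_trans xx' _; rewrite ltr_pdivrMr// ltr_pMr// ltr1n.
  have {}h2 : `|G x - G y| <= e / 2.
    apply: h2 => /=; rewrite -(subrKA x') (le_lt_trans (ler_normD _ _))// [ltRHS]splitr.
    by rewrite ltrD// distrC (lt_trans yx').
  rewrite -(subrKA (G x)) (le_trans (ler_normD _ _))// [leRHS]splitr lerD//.
  by rewrite distrC.
move=> /(_ _ H) K.
near (0 : R)^'+ => d; exists d; first by near: d; exact: nbhs_right_gt.
move=> x y xab; suff : `[a, b]%classic `<=` (fun x => forall y, `|y - x| < d -> `|G y - G x| <= e).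
  by move/(_ x); apply; rewrite /= in_itv/=.
by near: d.
Unshelve. all: by end_near. Qed.

(** Bernstein's proof: nodes within d of y cost e / 2 by uniform continuity, the others at most 2 M
    <= 2 M (k / n - y)^2 / d^2, whose mean is O(1 / n). *)
Lemma bern_weierstrass (G : R -> R) (M e : R) : continuous G -> (forall x, `|G x| <= M) -> 0 < e ->
  exists n, forall y, 0 <= y <= 1 -> `|bern n y (fun k => G (k%:R / n%:R)) - G y| <= e.
Proof.
move=> cG GM e0; have e2 : 0 < e / 2 by rewrite divr_gt0.
have M0 : 0 <= M := le_trans (normr_ge0 _) (GM 0).
have [d d0 Hd] := unif_continuous_segment 0 1 cG e2.
near \oo => n; have n0 : 0 < (n%:R : R) by near: n; exact: nbhs_infty_gtr.
have nM : 2 * M / d ^+ 2 / (e / 2) <= n%:R by near: n; exact: nbhs_infty_ger.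
exists n => y y01; have /andP[y0 y1] := y01.
pose C := 2 * M / d ^+ 2 / n%:R ^+ 2.
have d20 : 0 < d ^+ 2 by exact: exprn_gt0.
have C0 : 0 <= C by rewrite divr_ge0 ?sqr_ge0// divr_ge0 ?sqr_ge0// mulr_ge0.
apply: le_trans (bern_near (e := e / 2) (C := C) y0 y1 C0 _) _.
  move=> k; have [kd|kd] := ltP `|k%:R / n%:R - y| d.
    by apply: le_trans (Hd _ _ y01 kd) _; rewrite lerDl mulr_ge0// sqr_ge0.
  apply: le_trans (ler_normB _ _) _; apply: le_trans (lerD (GM _) (GM _)) _.
  apply: le_trans (_ : C * (k%:R - n%:R * y) ^+ 2 <= _); last by rewrite lerDr ltW.
  have -> : C * (k%:R - n%:R * y) ^+ 2 = 2 * M * ((k%:R / n%:R - y) ^+ 2 / d ^+ 2).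
    by rewrite /C; field; rewrite !gt_eqF.
  have -> : M + M = 2 * M * 1 by ring.
  rewrite ler_wpM2l ?mulr_ge0// ler_pdivlMr// mul1r -[leRHS]real_normK ?num_real//.
  by rewrite lerXn2r// nnegrE ltW.
rewrite [leRHS]splitr lerD2l.
have -> : C * n%:R = 2 * M / d ^+ 2 / n%:R by rewrite /C; field; rewrite !gt_eqF.
by rewrite ler_pdivrMr// [leRHS]mulrC -ler_pdivrMr.
Unshelve. all: by end_near. Qed.

End bernstein.

Section trigonometric.
Variable R : realType.

(* Trigonometric polynomials of frequency s, as lists of (amplitude, mode, phase). *)
Definition trig_sum (s : R) (l : seq (R * int * R)) (x : R) : R :=
  \sum_(p <- l) p.1.1 * cos (p.1.2%:~R * (s * x) + p.2).

Definition trig_poly s (phi : R -> R) := exists l, forall x, phi x = trig_sum s l x.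

Lemma trig_cst s c : trig_poly s (fun=> c).
Proof.
exists [:: (c, 0, 0)] => x.
by rewrite /trig_sum big_seq1/= mul0r addr0 cos0 mulr1.
Qed.

Lemma trigD s phi psi : trig_poly s phi -> trig_poly s psi ->
  trig_poly s (fun x => phi x + psi x).
Proof.
by move=> [l Hl] [l' Hl']; exists (l ++ l') => x; rewrite /trig_sum big_cat Hl Hl'.
Qed.

Lemma trigZ s c phi : trig_poly s phi -> trig_poly s (fun x => c * phi x).
Proof.
move=> [l Hl]; exists [seq (c * p.1.1, p.1.2, p.2) | p <- l] => x.
by rewrite /trig_sum big_map Hl mulr_sumr; apply: eq_bigr => p _; rewrite mulrA.
Qed.

Lemma trigMcos s a phi : trig_poly s phi -> trig_poly s (fun x => cos (s * x + a) * phi x).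
Proof.
move=> [l Hl].
exists ([seq (p.1.1 / 2, p.1.2 + 1, p.2 + a) | p <- l] ++
        [seq (p.1.1 / 2, p.1.2 - 1, p.2 - a) | p <- l]) => x.
rewrite /trig_sum big_cat/= !big_map Hl mulr_sumr -big_split/=; apply: eq_bigr => p _ /=.
set A := p.1.2%:~R * (s * x) + p.2; set B := s * x + a.
have -> : (p.1.2 + 1)%:~R * (s * x) + (p.2 + a) = A + B by rewrite /A /B intrD; ring.
have -> : (p.1.2 - 1)%:~R * (s * x) + (p.2 - a) = A - B by rewrite /A /B intrB; ring.
by clearbody A B; rewrite cosB cosD; field.
Qed.

(** Each step of the recursion multiplies by (1 + cos) / 2 or its complement, which preserves
    trigonometric polynomials; so Bernstein's theorem also yields trigonometric approximation. *)
Lemma trig_bern s a n psi :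
  trig_poly s (fun x => bern n ((1 + cos (s * x + a)) / 2) psi).
Proof.
elim: n psi => [|n IH] psi /=; first exact: trig_cst.
pose y x := (1 + cos (s * x + a)) / 2.
have H (u v : R -> R) : trig_poly s u -> trig_poly s v ->
    trig_poly s (fun x => (1 - y x) * u x + y x * v x).
  move=> tu tv.
  have := trigD (trigD (trigZ 2^-1 tu) (trigZ 2^-1 tv))
    (trigD (trigZ (- 2^-1) (trigMcos a tu)) (trigZ 2^-1 (trigMcos a tv))).
  move=> [l Hl]; exists l => x; rewrite -Hl /y; by field.
exact: H (IH _) (IH _).
Qed.

Lemma halfcos_itv (x : R) : 0 <= (1 + cos x) / 2 <= 1.
Proof.
by have := cos_geN1 x; have := cos_le1 x => h1 h2; apply/andP; split; lra.
Qed.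

End trigonometric.

Section clamp.
Variable R : realType.

(** Truncation to [-c, c], in a form whose continuity is immediate. *)
Definition clamp (c u : R) : R := (`|u + c| - `|u - c|) / 2.

Lemma clampE (c u : R) : - c <= u <= c -> clamp c u = u.
Proof.
move=> /andP[cu uc]; rewrite /clamp ger0_norm ?ler0_norm; [|lra|lra].
by field.
Qed.

Lemma clamp_itv (c u : R) : 0 <= c -> - c <= clamp c u <= c.
Proof.
move=> c0; rewrite /clamp.
have [h|h] := ler0P (u + c); have [k|k] := ler0P (u - c); apply/andP; split; lra.
Qed.

Lemma continuous_clamp c : continuous (clamp c).
Proof.
move=> u; apply: cvgMl; apply: cvgB; apply: cvg_norm.
  by apply: cvgD; [exact: cvg_id|exact: cvg_cst].
by apply: cvgB; [exact: cvg_id|exact: cvg_cst].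
Qed.

Lemma sin_half_lt1 : 0 <= sin (2^-1 : R) < 1.
Proof.
have p2 := pi_ge2 R.
apply/andP; split.
  by apply: sin_ge0_pi; lra.
rewrite -[ltRHS](sin_pihalf R) ltr_sin ?in_itv/=; first by lra.
  by apply/andP; split; lra.
by apply/andP; split; lra.
Qed.

(* The inverse of y = (1 + sin (x / (2 A))) / 2 on [-A, A], extended continuously. *)
Definition sine_coord_inv (A y : R) : R := 2 * A * asin (clamp (sin 2^-1) (2 * y - 1)).

(** Truncation at sin(1/2) < 1 keeps the argument of [asin] inside ]-1, 1[. This is why x is divided
    by 2 A: for |x| <= A the angle stays within [-1/2, 1/2]. *)
Lemma continuous_sine_coord_inv A : continuous (sine_coord_inv A).
Proof.
move=> y; apply: cvgMr; have /andP[s0 s1] := sin_half_lt1.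
have cl : {for y, continuous (fun y : R => clamp (sin 2^-1) (2 * y - 1))}.
  apply: (@continuous_comp _ _ _ (fun y : R => 2 * y - 1)); last exact: continuous_clamp.
  by apply: cvgB; [apply: cvgMr; exact: cvg_id|exact: cvg_cst].
apply: (continuous_comp cl); apply: continuous_asin.
have /andP[h1 h2] := clamp_itv (2 * y - 1) s0.
by apply/andP; split; lra.
Qed.

Lemma sine_coord_invK (A x : R) : 0 < A -> `|x| <= A ->
  sine_coord_inv A ((1 + sin ((2 * A)^-1 * x)) / 2) = x.
Proof.
move=> A0 xA; have p2 := pi_ge2 R; set u := (2 * A)^-1 * x.
have uh : `|u| <= 2^-1.
  by rewrite /u normrM normfV (gtr0_norm (_ : 0 < 2 * A)) ?mulr_gt0// mulrC ler_pdivrMr ?mulr_gt0// mulrA mulVf// mul1r.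
have hu : - (pi / 2) <= u <= pi / 2.
  by move: uh; rewrite ler_norml => /andP[h1 h2]; apply/andP; split; lra.
rewrite /sine_coord_inv.
have -> : 2 * ((1 + sin u) / 2) - 1 = sin u by field.
rewrite clampE ?sinK ?in_itv//; first by rewrite /u; field; rewrite gt_eqF.
move: uh; rewrite ler_norml => /andP[h1 h2].
have hh : (2^-1 : R) \in `[- (pi / 2), pi / 2] by rewrite in_itv/=; apply/andP; split; lra.
have hn : (- 2^-1 : R) \in `[- (pi / 2), pi / 2] by rewrite in_itv/=; apply/andP; split; lra.
have hu' : u \in `[- (pi / 2), pi / 2] by rewrite in_itv.
by rewrite -sinN !leNgt !ltr_sin// -!leNgt h1 h2.
Qed.

Lemma sqr_le_cosh (x : R) : x ^+ 2 <= 2 * (expR x + expR (- x)).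
Proof.
have H (y : R) : 0 <= y -> y ^+ 2 <= 2 * expR y.
  by move=> y0; have := expR_ge1Dxn 1 y0; rewrite (_ : 2`! = 2)%N// => h; lra.
have [x0|x0] := leP 0 x.
  by apply: le_trans (H _ x0) _; rewrite ler_pM2l// lerDl expR_ge0.
have x1 : 0 <= - x by rewrite oppr_ge0 ltW.
by rewrite -sqrrN; apply: le_trans (H _ x1) _; rewrite ler_pM2l// lerDr expR_ge0.
Qed.

End clamp.

Section dominated.
Context d (T : measurableType d) (R : realType) (m : {measure set T -> \bar R}).

Lemma Rintegral_dominated_cvg (f_ : nat -> T -> R) (f g : T -> R) :
  (forall n, measurable_fun setT (f_ n)) -> rintegrable m g ->
  (forall n x, `|f_ n x| <= g x) -> (forall x, f_ n x @[n --> \oo] --> f x) ->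
  measurable_fun setT f ->
  rintegrable m f /\ (\int[m]_x f_ n x) @[n --> \oo] --> \int[m]_x f x.
Proof.
move=> mf ig fg fc mf'.
have fg' x : `|f x| <= g x.
  apply: (ler_cvg_to (cvg_norm (fc x)) (cvg_cst (g x))).
  by near=> n; exact: fg.
have rf : rintegrable m f by exact: rintegrable_le ig fg'.
split=> //; apply: fine_cvg; rewrite fineK ?integrable_fin_num//.
apply: (@dominated_cvg _ _ _ m _ measurableT _ _ (EFin \o g)) => //.
- by move=> n; exact/measurable_EFinP.
- by move=> x _; apply/fine_cvgP; split; [near=> n|exact: fc].
- by move=> n x _; rewrite lee_fin.
Unshelve. all: by end_near. Qed.

End dominated.

(** On [-A, A] the variable y = (1 + sin(x / (2 A))) / 2 is a coordinate, so [g] is a continuous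
    function G of y and Bernstein polynomials of G apply. Outside, |g - G| <= 2 M is paid by the
    exponential weight, because x^2 >= A >= 4 M / e and x^2 <= 2 (exp x + exp(- x)). *)
Lemma trig_approximation (R : realType) (g : R -> R) (M e : R) : continuous g ->
  (forall x, `|g x| <= M) -> 0 < e ->
  exists s l, forall x, `|g x - trig_sum s l x| <= e * (1 + (expR x + expR (- x))).
Proof.
move=> cg gM e0; have M0 : 0 <= M := le_trans (normr_ge0 _) (gM 0).
near +oo_R => A; have A1 : 1 <= A by near: A; exact: nbhs_pinfty_ge.
have A0 : 0 < A by apply: lt_le_trans A1.
have AM : 4 * M / e <= A by near: A; exact: (nbhs_pinfty_ge (num_real _)).
pose G y := g (sine_coord_inv A y).
have cG : continuous G.
  by move=> y; apply: continuous_comp; [exact: continuous_sine_coord_inv|exact: cg].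
have [n Hn] := bern_weierstrass cG (fun y => gM _) e0.
pose s := (2 * A)^-1.
have [l Hl] := trig_bern s (- (pi / 2)) n (fun k => G (k%:R / n%:R)).
exists s, l => x; rewrite -Hl.
have sE : cos (s * x + - (pi / 2)) = sin (s * x) by rewrite cosB cos_pihalf sin_pihalf mulr0 mulr1 add0r.
set y := (1 + cos _) / 2; have y01 : 0 <= y <= 1 by exact: halfcos_itv.
have ex : 0 <= expR x + expR (- x) by rewrite addr_ge0 ?expR_ge0.
rewrite -[X in `|X|](subrKA (G y)); apply: le_trans (ler_normD _ _) _.
rewrite mulrDr mulr1 addrC lerD//; first by rewrite distrC Hn.
have [xA|xA] := leP `|x| A.
  rewrite /G /y sE sine_coord_invK// subrr normr0.
  by rewrite mulr_ge0 ?(ltW e0).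
apply: le_trans (ler_normB _ _) _; apply: le_trans (lerD (gM _) (gM _)) _.
have x2 : A <= x ^+ 2.
  apply: le_trans (_ : A ^+ 2 <= _); first by rewrite expr2 ler_peMr// ltW.
  by rewrite -[leRHS]real_normK ?num_real// lerXn2r ?nnegrE// ltW.
have h := le_trans x2 (sqr_le_cosh x).
move: AM; rewrite ler_pdivrMr// => AM.
have : 4 * M <= 2 * (expR x + expR (- x)) * e by apply: le_trans AM _; rewrite ler_wpM2r// ltW.
move: (expR x + expR (- x)) => E; lra.
Unshelve. all: by end_near. Qed.

Section levy.
Variables (R : realType) (d : measure_display) (T : nat -> measurableType d).
Variables (P : forall n, probability (T n) R) (X : forall n, T n -> R).
Variables (Q : probability (measurableTypeR R) R).
Hypothesis mX : forall n, measurable_fun setT (@X n).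
Hypothesis char_cvg : forall t theta : R,
  (\int[P n]_w cos (t * @X n w + theta)) @[n --> \oo] --> \int[Q]_x cos (t * x + theta).
Variable K : R.
Hypothesis exp_bound : \forall n \near \oo,
  rintegrable (P n) (fun w => expR (@X n w) + expR (- @X n w)) /\
  \int[P n]_w (expR (@X n w) + expR (- @X n w)) <= K.
Hypothesis exp_boundQ : rintegrable Q (fun x => expR x + expR (- x)) /\
  \int[Q]_x (expR x + expR (- x)) <= K.

Lemma rintegrable_bounded d' (T' : measurableType d') (P' : probability T' R) (f : T' -> R) :
  measurable_fun setT f -> (exists B, forall x, `|f x| <= B) -> rintegrable P' f.
Proof.
move=> mf fB; have := rintegrableMb (m := P') (f := cst 1) _ mf fB.
under eq_fun do rewrite /= mul1r; apply.
exact: (@finite_measure_integrable_cst _ _ _ P' setT 1).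
Qed.

Lemma Rintegral_trig_sum d' (T' : measurableType d') (P' : probability T' R) (X' : T' -> R) s l :
  measurable_fun setT X' -> rintegrable P' (fun w => trig_sum s l (X' w)) /\
  \int[P']_w trig_sum s l (X' w) =
    \sum_(p <- l) p.1.1 * \int[P']_w cos (p.1.2%:~R * s * X' w + p.2).
Proof.
move=> mX'; have ic (p : R * int * R) : rintegrable P' (fun w => cos (p.1.2%:~R * s * X' w + p.2)).
  apply: rintegrable_bounded.
    apply: (@measurableT_comp _ _ _ _ _ _ (fun x : R => cos (p.1.2%:~R * s * x + p.2))) => //.
    apply: continuous_measurable_fun => x.
    apply: (@continuous_comp _ _ _ (fun x : R => p.1.2%:~R * s * x + p.2)); last exact: continuous_cos.
    by apply: cvgD; [apply: cvgMr; exact: cvg_id|exact: cvg_cst].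
  by exists 1 => x; rewrite ler_norml cos_geN1 cos_le1.
have E : (fun w => trig_sum s l (X' w)) =
    (fun w => \sum_(p <- l) p.1.1 * cos (p.1.2%:~R * s * X' w + p.2)).
  by apply/funext => w; apply: eq_bigr => p _; rewrite mulrA.
rewrite E; split; first by apply: rintegrable_sum => p _; exact: rintegrableZ.
rewrite Rintegral_sum//; last by move=> p _; exact: rintegrableZ.
by apply: eq_bigr => p _; rewrite RintegralZl//; exact: ic.
Qed.

Lemma trig_sum_cvg s l :
  (\int[P n]_w trig_sum s l (@X n w)) @[n --> \oo] --> \int[Q]_x trig_sum s l x.
Proof.
rewrite (Rintegral_trig_sum Q (X' := id) s l _).2//.
under eq_fun do rewrite (Rintegral_trig_sum _ _ _ (@mX _)).2.
by apply: cvg_bigsum => p; apply: cvgMr; exact: char_cvg.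
Qed.

Lemma le_Rintegral_approx d' (T' : measurableType d') (P' : probability T' R) (X' : T' -> R)
    (g : R -> R) M s l e : measurable_fun setT X' -> continuous g -> (forall x, `|g x| <= M) ->
  rintegrable P' (fun w => expR (X' w) + expR (- X' w)) ->
  \int[P']_w (expR (X' w) + expR (- X' w)) <= K -> 0 < e ->
  (forall x, `|g x - trig_sum s l x| <= e * (1 + (expR x + expR (- x)))) ->
  `|\int[P']_w g (X' w) - \int[P']_w trig_sum s l (X' w)| <= e * (1 + K).
Proof.
move=> mX' cg gM iE EK e0 H.
have ig : rintegrable P' (g \o X').
  apply: rintegrable_bounded; last by exists M => x; exact: gM.
  by apply: measurableT_comp => //; exact: continuous_measurable_fun.
have [it _] := Rintegral_trig_sum P' s l mX'.
have i1 : rintegrable P' (cst (1 : R)) by apply: rintegrable_bounded => //; exists 1 => x; rewrite normr1.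
have E1 : fine (P' setT) = 1 by rewrite probability_setT.
rewrite -RintegralB//; apply: le_trans (le_normr_Rintegral _ _) _ => //.
  exact: rintegrableB.
apply: le_trans (_ : \int[P']_w (e * (1 + (expR (X' w) + expR (- X' w)))) <= _).
  apply: le_Rintegral => //; first by apply: rintegrable_norm; exact: rintegrableB.
  by apply: rintegrableZ; exact: rintegrableD.
rewrite RintegralZl//; last exact: rintegrableD.
rewrite ler_wpM2l ?(ltW e0)// RintegralD// lerD//.
rewrite -[X in X <= _]/(Rintegral P' setT (cst 1)) Rintegral_cst// mul1r; by rewrite le_eqVlt; apply/orP; left; apply/eqP.
Qed.

(** A trigonometric sum approximates [g] with an error whose mean is at most e' (1 + K), both under
    Q and under P n for large n: the exponential moments do the work of tightness. The phase theta
    in [char_cvg] lets cosines alone carry the real and the imaginary part of the characteristic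
    function. *)
Lemma levy (g : R -> R) (M : R) : continuous g -> (forall x, `|g x| <= M) ->
  (\int[P n]_w g (@X n w)) @[n --> \oo] --> \int[Q]_x g x.
Proof.
move=> cg gM; apply/cvgrPdist_le => e e0.
have [iQ QK] := exp_boundQ.
have K0 : 0 <= K by apply: le_trans QK; apply: Rintegral_ge0 => x _; rewrite addr_ge0 ?expR_ge0.
pose e' := e / 3 / (1 + K).
have K1 : 0 < 1 + K by rewrite ltr_wpDr.
have e'0 : 0 < e' by rewrite !divr_gt0.
have e'E : e' * (1 + K) = e / 3 by rewrite /e' mulfVK// gt_eqF.
have [s [l H]] := trig_approximation cg gM e'0.
have mid : measurable_fun setT (id : measurableTypeR R -> R) by exact: measurable_id.
have hQ := le_Rintegral_approx (P' := Q) (X' := id) mid cg gM iQ QK e'0 H.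
have e3 : 0 < e / 3 by rewrite divr_gt0.
have /cvgrPdist_le/(_ _ e3) C := @trig_sum_cvg s l.
near=> n.
have [iP PK] : rintegrable (P n) (fun w => expR (@X n w) + expR (- @X n w)) /\
  \int[P n]_w (expR (@X n w) + expR (- @X n w)) <= K by near: n.
have hP := le_Rintegral_approx (@mX n) cg gM iP PK e'0 H.
have hC : `|\int[Q]_x trig_sum s l x - \int[P n]_w trig_sum s l (@X n w)| <= e / 3 by near: n.
move: hQ hP hC; rewrite !e'E !ler_norml => /andP[a1 a2] /andP[b1 b2] /andP[c1 c2].
by apply/andP; split; lra.
Unshelve. all: by end_near. Qed.

End levy.

(** * The Gaussian law *)

Section gaussian_integrals.
Variables (R : realType) (s : R).
Hypothesis s0 : 0 < s.
Local Notation lam := (@lebesgue_measure R).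
Let p (x : measurableTypeR R) : R := normal_pdf 0 s x.

Let sn0 : s != 0. Proof. by rewrite gt_eqF. Qed.

Let pE x : p x = normal_peak s * expR (- (x ^+ 2 / (s ^+ 2 * 2))).
Proof.
by rewrite /p normal_pdfE// /normal_fun subr0 mulr_natr mulNr.
Qed.

Let p_ge0 x : 0 <= p x. Proof. exact: normal_pdf_ge0. Qed.

Let mp : measurable_fun setT p. Proof. exact: measurable_normal_pdf. Qed.

(** Completing the square; exponential moments thus reduce to the integrability of a shifted
    density. *)
Lemma normal_pdf_shift (a x : R) :
  expR (a * x) * p x = expR (a ^+ 2 * s ^+ 2 / 2) * normal_pdf (a * s ^+ 2) s x.
Proof.
rewrite pE normal_pdfE// /normal_fun mulrCA [RHS]mulrCA -!expRD; congr (_ * expR _).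
by rewrite -mulr_natr; field.
Qed.

Lemma rintegrable_expR_normal (a : R) : rintegrable lam (fun x => expR (a * x) * p x).
Proof.
under eq_fun do rewrite normal_pdf_shift.
by apply: rintegrableZ; exact: integrable_normal_pdf.
Qed.

Lemma rintegrable_cosh_normal : rintegrable lam (fun x => (expR x + expR (- x)) * p x).
Proof.
have := rintegrableD (rintegrable_expR_normal 1) (rintegrable_expR_normal (- 1)).
by under eq_fun do rewrite mul1r mulN1r -mulrDl.
Qed.

Lemma rintegrable_abs_normal : rintegrable lam (fun x => `|x| * p x).
Proof.
apply: rintegrable_le rintegrable_cosh_normal _.
  by apply: measurable_funM => //; exact: measurableT_comp.
move=> x; rewrite ger0_norm ?mulr_ge0// ler_wpM2r//.
have h1 := expR_ge1Dx x; have h2 := expR_ge1Dx (- x).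
have h3 := expR_ge0 x; have h4 := expR_ge0 (- x).
by have [x0|x0] := ger0P x; lra.
Qed.

Lemma rintegrable_normal : rintegrable lam p.
Proof. exact: integrable_normal_pdf. Qed.

Lemma is_derive_normal (x : R) : is_derive x 1 p (- (x / s ^+ 2) * p x).
Proof.
pose c := (s ^+ 2 * 2)^-1.
have d1 : is_derive x 1 (fun y : R => - (y ^+ 2 * c)) (- (x * 2 * c)).
  by apply: is_derive_eq; rewrite /GRing.scale/=; ring.
have d2 : is_derive x 1 (fun y : R => expR (- (y ^+ 2 * c))) (expR (- (x ^+ 2 * c)) * - (x * 2 * c)).
  exact: (@is_derive1_comp _ expR (fun y : R => - (y ^+ 2 * c))).
rewrite (_ : p = fun y : R => normal_peak s * expR (- (y ^+ 2 * c))); last by apply/funext => y; rewrite pE.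
apply: is_derive_eq; rewrite /GRing.scale/= /c.
by field.
Qed.

Lemma normal_pdf_le (n : nat) : p n.+1%:R <= normal_peak s * (s ^+ 2 * 2) / n.+1%:R.
Proof.
have k0 : (1 : R) <= n.+1%:R by rewrite ler1n.
set k : R := n.+1%:R in k0 *; have k1 : 0 < k by lra.
rewrite pE -mulrA ler_wpM2l ?normal_peak_ge0//.
set u := k ^+ 2 / (s ^+ 2 * 2).
have ss : 0 < s ^+ 2 * 2 by rewrite mulr_gt0// exprn_gt0.
have u0 : 0 < u by rewrite divr_gt0// exprn_gt0.
apply: le_trans (_ : u^-1 <= _).
  rewrite expRN lef_pV2 ?posrE ?expR_gt0//.
  by have := expR_ge1Dx u; lra.
rewrite /u invf_div ler_pM2l// lef_pV2 ?posrE ?exprn_gt0//.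
by rewrite expr2 ler_peMl// ltW.
Qed.

Variables (t theta : R).

Let F (x : R) := sin (t * x + theta) * p x.
Let dF (x : R) := t * (cos (t * x + theta) * p x) - (s ^+ 2)^-1 * (x * sin (t * x + theta) * p x).

Let cphase (tr : R -> R) : continuous tr -> continuous (fun x : R => tr (t * x + theta)).
Proof.
move=> ct x; apply: (@continuous_comp _ _ _ (fun x : R => t * x + theta)); last exact: ct.
by apply: cvgD; [apply: cvgMr; exact: cvg_id|exact: cvg_cst].
Qed.

Let cp : continuous (p : R -> R). Proof. exact: continuous_normal_pdf. Qed.

Lemma rintegrable_cos_normal : rintegrable lam (fun x => cos (t * x + theta) * p x).
Proof.
apply: rintegrable_le rintegrable_normal _.
  apply: measurable_funM => //; apply: continuous_measurable_fun.
  by apply: cphase; exact: continuous_cos.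
move=> x; rewrite normrM [`|p x|]ger0_norm// ler_piMl//.
by rewrite ler_norml cos_geN1 cos_le1.
Qed.

Lemma rintegrable_xsin_normal : rintegrable lam (fun x => x * sin (t * x + theta) * p x).
Proof.
apply: rintegrable_le rintegrable_abs_normal _.
  apply: measurable_funM => //; apply: measurable_funM => //.
  by apply: continuous_measurable_fun; apply: cphase; exact: continuous_sin.
move=> x; rewrite !normrM [`|p x|]ger0_norm// ler_wpM2r// ler_piMr//.
by rewrite ler_norml sin_geN1 sin_le1.
Qed.

(** Since p' = - x p / s^2, [dF] is the derivative of sin(t x + theta) p(x); its integral over
    [-n - 1, n + 1] is a boundary term that tends to 0. *)
Lemma normal_by_parts :
  \int[lam]_x (x * sin (t * x + theta) * p x) = s ^+ 2 * t * \int[lam]_x (cos (t * x + theta) * p x).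
Proof.
have ic := rintegrable_cos_normal; have ixs := rintegrable_xsin_normal.
have idF : rintegrable lam dF by apply: rintegrableB; exact: rintegrableZ.
suff I0 : \int[lam]_x dF x = 0.
  have : \int[lam]_x dF x = t * \int[lam]_x (cos (t * x + theta) * p x) -
     (s ^+ 2)^-1 * \int[lam]_x (x * sin (t * x + theta) * p x).
    rewrite RintegralB//; try exact: rintegrableZ.
    by rewrite !RintegralZl.
  rewrite I0 => /esym/eqP; rewrite subr_eq0 => /eqP E.
  by rewrite -mulrA E mulrA divff ?mul1r// expf_eq0.
have cdF : continuous dF.
  move=> x; apply: cvgB; apply: cvgMr; apply: cvgM.
  - by apply: cphase; exact: continuous_cos.
  - exact: cp.
  - by apply: cvgM; [exact: cvg_id|apply: cphase; exact: continuous_sin].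
  - exact: cp.
have DF (x : R) : is_derive x 1 F (dF x).
  have dax : is_derive x 1 (fun y : R => t * y + theta) t.
    by apply: is_derive_eq; rewrite /GRing.scale/= mulr1 addr0.
  have ds : is_derive x 1 (fun y : R => sin (t * y + theta)) (cos (t * x + theta) * t).
    exact: (@is_derive1_comp _ sin (fun y => t * y + theta)).
  have dp := is_derive_normal x.
  by rewrite /F; apply: is_derive_eq; rewrite /GRing.scale/= /dF; field.
pose D n : set (measurableTypeR R) := `[- n.+1%:R, n.+1%:R]%classic.
have mD n : measurable (D n) by exact: measurable_itv.
have mdF : measurable_fun setT (dF : measurableTypeR R -> R) by exact: continuous_measurable_fun.
have [_ L1] : rintegrable lam dF /\ (\int[lam]_x (dF \_ (D n)) x) @[n --> \oo] --> \int[lam]_x dF x.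
  apply: Rintegral_dominated_cvg (rintegrable_norm idF) _ _ mdF.
  - by move=> n; apply: (measurable_restrictT _ (mD n)).1; apply: measurable_funTS;
    exact: continuous_measurable_fun.
  - by move=> n x; rewrite patchE; case: ifP => _ //; rewrite normr0 normr_ge0.
  - move=> x; apply: cvg_near_cst; near=> n; rewrite patchE ifT//.
    apply/mem_set; rewrite /D/= in_itv/= -ler_norml.
    apply: le_trans (_ : n%:R <= _); last by rewrite ler_nat.
    by near: n; exact: nbhs_infty_ger.
have L2 : (\int[lam]_x (dF \_ (D n)) x) @[n --> \oo] --> (0 : R).
  have E n : \int[lam]_x (dF \_ (D n)) x = F n.+1%:R - F (- n.+1%:R).
    rewrite -Rintegral_mkcond; apply: Rintegral_FTC2 => //.
    have k0 : (0 : R) < n.+1%:R by rewrite ltr0n.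
    by apply: lt_trans k0; rewrite oppr_lt0.
  under eq_fun do rewrite E.
  have FB x : `|F x| <= p x.
    by rewrite /F normrM [`|p x|]ger0_norm// ler_piMl// ler_norml sin_geN1 sin_le1.
  have pN x : p (- x) = p x by rewrite !pE sqrrN.
  pose C := normal_peak s * (s ^+ 2 * 2).
  have U : (2 * C * n.+1%:R^-1) @[n --> \oo] --> (0 : R).
    by rewrite -[X in _ --> X](mulr0 (2 * C)); apply: cvgMr; exact: cvg_harmonic.
  apply/norm_cvg0P; apply: (squeeze_cvgr _ (cvg_cst 0) U).
  near=> n; rewrite normr_ge0/=; apply: le_trans (ler_normB _ _) _.
  have h1 := FB n.+1%:R; have h2 := FB (- n.+1%:R); rewrite pN in h2.
  have h3 := normal_pdf_le n; rewrite -/C in h3.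
  have -> : 2 * C * n.+1%:R^-1 = C / n.+1%:R + C / n.+1%:R by rewrite -mulrA mulr2n mulrDl mul1r.
  by apply: lerD; [apply: le_trans h1 h3|apply: le_trans h2 h3].
exact: cvg_unique L1 L2.
Unshelve. all: by end_near. Qed.

End gaussian_integrals.

Section gaussian_law.
Variable R : realType.
Local Notation lam := (@lebesgue_measure R).

(** Differentiation under the integral and integration by parts give phi'(t) = - s^2 t phi(t), so
    phi(t) exp(s^2 t^2 / 2) is constant. *)
Lemma normal_char (s t theta : R) : 0 < s ->
  \int[lam]_x (cos (t * x + theta) * normal_pdf 0 s x) = cos theta * expR (- (s ^+ 2 * t ^+ 2 / 2)).
Proof.
move=> s0; pose phi (t : R) := \int[lam]_x (cos (t * x + theta) * normal_pdf 0 s x).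
have p0 x : 0 <= normal_pdf 0 s x by exact: normal_pdf_ge0.
have dphi (a : R) : is_derive a 1 phi (- (s ^+ 2 * a) * phi a).
  pose f (t : R) (x : measurableTypeR R) := cos (t * x + theta) * normal_pdf 0 s x.
  have Ia : `]a - 1, a + 1[%classic a by rewrite /= in_itv/=; apply/andP; split; lra.
  have df (y : R) (x : measurableTypeR R) :
      is_derive y 1 (f ^~ x) (- (x * sin (y * x + theta) * normal_pdf 0 s x)).
    have dax : is_derive y 1 (fun y : R => x * y + theta) x.
      by apply: is_derive_eq; rewrite /GRing.scale/= mulr1 addr0.
    have dc : is_derive y 1 (fun y : R => cos (x * y + theta)) (- sin (x * y + theta) * x).
      exact: (@is_derive1_comp _ cos (fun y => x * y + theta)).
    rewrite /f (_ : (fun t => _) = (fun y => normal_pdf 0 s x * cos (x * y + theta))); last first.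
      by apply/funext => z; rewrite mulrC [z * _]mulrC.
    by apply: is_derive_eq; rewrite /GRing.scale/= [y * _]mulrC; ring.
  have intf y : `]a - 1, a + 1[%classic y -> lam.-integrable setT (EFin \o f y).
    by move=> _; exact: rintegrable_cos_normal.
  have derf y x : `]a - 1, a + 1[%classic y -> setT x -> derivable (f ^~ x) y 1.
    by move=> _ _; have := df y x.
  have d1 y x : partial1of2 f y x = - (x * sin (y * x + theta) * normal_pdf 0 s x).
    by rewrite partial1of2E; have dfy := df y x; exact: derive_val.
  pose G (x : measurableTypeR R) := `|x| * normal_pdf 0 s x.
  have G0 x : 0 <= G x by rewrite mulr_ge0.
  have intG : lam.-integrable setT (EFin \o G) by exact: rintegrable_abs_normal.
  have Gub y x : `]a - 1, a + 1[%classic y -> setT x -> `|partial1of2 f y x| <= G x.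
    move=> _ _; rewrite d1 normrN !normrM (ger0_norm (p0 x)) ler_wpM2r// ler_piMr//.
    by rewrite ler_norml sin_geN1 sin_le1.
  have D := derivable_under_integral measurableT Ia intf derf G0 intG Gub.
  have E := differentiation_under_integral measurableT Ia intf derf G0 intG Gub.
  apply: DeriveDef; first exact: D.
  rewrite -derive1E [LHS]E.
  transitivity (\int[lam]_x (-1 * (x * sin (a * x + theta) * normal_pdf 0 s x))).
    by apply: eq_Rintegral => x _; rewrite d1 mulN1r.
  rewrite RintegralZl//; last exact: rintegrable_xsin_normal.
  by rewrite normal_by_parts// -/(phi a); ring.
pose psi (y : R) := phi y * expR (s ^+ 2 / 2 * y ^+ 2).
have dpsi (a : R) : is_derive a 1 psi 0.
  have d1 : is_derive a 1 (fun y : R => s ^+ 2 / 2 * y ^+ 2) (s ^+ 2 * a).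
    by apply: is_derive_eq; rewrite /GRing.scale/=; field.
  have d2 : is_derive a 1 (fun y : R => expR (s ^+ 2 / 2 * y ^+ 2)) (expR (s ^+ 2 / 2 * a ^+ 2) * (s ^+ 2 * a)).
    exact: (@is_derive1_comp _ expR (fun y : R => s ^+ 2 / 2 * y ^+ 2)).
  have d3 := dphi a.
  by rewrite /psi; apply: is_derive_eq; rewrite /GRing.scale/=; ring.
have := is_derive_0_is_cst t 0 dpsi.
rewrite /psi expr0n/= mulr0 expR0 mulr1.
have -> : phi 0 = cos theta.
  transitivity (\int[lam]_x (cos theta * normal_pdf 0 s x)).
    by apply: eq_Rintegral => x _; rewrite mul0r add0r.
  rewrite RintegralZl//; last exact: rintegrable_normal.
  by rewrite /Rintegral integral_normal_pdf mulr1.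
rewrite -/(phi t) => <-; rewrite -[RHS]mulrA -expRD.
by rewrite [X in expR X](_ : _ = 0) ?expR0 ?mulr1//; field.
Qed.

Lemma gaussian_char (v t theta : R) : 0 <= v ->
  \int[gaussian 0 v]_x cos (t * x + theta) = cos theta * expR (- (v * t ^+ 2 / 2)).
Proof.
have mc : measurable_fun setT (fun x : measurableTypeR R => cos (t * x + theta)).
  apply: continuous_measurable_fun => x.
  apply: (@continuous_comp _ _ _ (fun x : R => t * x + theta)); last exact: continuous_cos.
  by apply: cvgD; [apply: cvgMr; exact: cvg_id|exact: cvg_cst].
rewrite le_eqVlt => /predU1P[<-|v0]; rewrite /gaussian.
  rewrite eqxx mul0r mul0r oppr0 expR0 mulr1.
  rewrite /Rintegral integral_dirac//; last exact/measurable_EFinP.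
  by rewrite diracT mul1e/= mulr0 add0r.
rewrite gt_eqF//; have s0 : 0 < Num.sqrt v by rewrite sqrtr_gt0.
have [_ ->] := @rintegral_density _ _ R lam (normal_prob 0 (Num.sqrt v)) _ (@measurable_normal_pdf R 0 (Num.sqrt v))
  (normal_pdf_ge0 _ _) (fun A _ => erefl) _ mc (rintegrable_cos_normal (Num.sqrt v) t theta).
by rewrite normal_char// sqr_sqrtr// ltW.
Qed.

Lemma gaussian_cosh (v : R) : 0 <= v ->
  rintegrable (gaussian 0 v) (fun x => expR x + expR (- x)).
Proof.
have mc : measurable_fun setT (fun x : measurableTypeR R => expR x + expR (- x)).
  by apply: measurable_funD; [exact: measurable_expR|apply: measurableT_comp => //; exact: measurable_expR].
rewrite le_eqVlt => /predU1P[<-|v0]; rewrite /gaussian.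
  rewrite eqxx; apply/integrableP; split; first exact/measurable_EFinP.
  rewrite integral_dirac//; last by apply: measurableT_comp => //; exact/measurable_EFinP.
  by rewrite diracT mul1e/= ltry.
rewrite gt_eqF//; have s0 : 0 < Num.sqrt v by rewrite sqrtr_gt0.
by have [] := @rintegral_density _ _ R lam (normal_prob 0 (Num.sqrt v)) _ (@measurable_normal_pdf R 0 (Num.sqrt v))
  (normal_pdf_ge0 _ _) (fun A _ => erefl) _ mc (rintegrable_cosh_normal s0).
Qed.

End gaussian_law.

(** * Fourier series *)

Section fourier_uniqueness.
Variable R : realType.
Local Notation lam := (@lebesgue_measure R).
Local Notation am := (@angle_measure R).

(* [ramp tau m (cos (x - c))] approximates the indicator of an arc centred at [c]. *)
Definition ramp (tau : R) (m : nat) (y : R) : R :=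
  (clamp 1 (2 * (m%:R * (y - tau)) - 1) + 1) / 2.

Lemma ramp01 tau m y : 0 <= ramp tau m y <= 1.
Proof.
have := clamp_itv (2 * (m%:R * (y - tau)) - 1) (@ler01 R).
by rewrite /ramp => /andP[h1 h2]; apply/andP; split; lra.
Qed.

Lemma continuous_ramp tau m : continuous (ramp tau m).
Proof.
move=> y; apply: cvgMl; apply: cvgD; last exact: cvg_cst.
apply: (@continuous_comp _ _ _ (fun y : R => 2 * (m%:R * (y - tau)) - 1)); last exact: continuous_clamp.
apply: cvgB; last exact: cvg_cst.
by do 2 apply: cvgMr; apply: cvgB; [exact: cvg_id|exact: cvg_cst].
Qed.

Lemma ramp_cvg (tau y : R) : ramp tau m y @[m --> \oo] --> ((tau < y)%R%:R : R).
Proof.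
apply: cvg_near_cst; near=> m; rewrite /ramp /clamp.
have [ty|yt] := ltP tau y => /=.
  have d0 : 0 < y - tau by rewrite subr_gt0.
  have : 1 / (y - tau) <= m%:R by near: m; exact: nbhs_infty_ger.
  rewrite ler_pdivrMr// => h; rewrite !ger0_norm; [|lra|lra].
  by field.
have h : m%:R * (y - tau) <= 0 by rewrite mulr_ge0_le0// subr_le0.
by rewrite !ler0_norm; [field|lra|lra].
Unshelve. all: by end_near. Qed.

Variable r : measurableTypeR R -> R.
Hypothesis mr : measurable_fun setT r.
Hypothesis lr : lam.-integrable `[0, pi *+ 2] (EFin \o r).
Hypothesis r_orth : forall (m : int) (a : R), \int[am]_t (r t * cos (m%:~R * t + a)) = 0.

Let ir : rintegrable am r. Proof. exact: (angle_measure_integrable mr lr).1. Qed.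

Let rintegrable_rM (g : R -> R) : measurable_fun setT g -> (exists B, forall x, `|g x| <= B) ->
  rintegrable am (fun t => r t * g t).
Proof. by move=> mg gB; exact: rintegrableMb ir mg gB. Qed.

Lemma continuous_phase (g : R -> R) (t a : R) : continuous g -> continuous (fun x : R => g (t * x + a)).
Proof.
move=> cg x; apply: (@continuous_comp _ _ _ (fun x : R => t * x + a)); last exact: cg.
by apply: cvgD; [apply: cvgMr; exact: cvg_id|exact: cvg_cst].
Qed.

Lemma trig_sum_orth l : rintegrable am (fun t => r t * trig_sum 1 l t) /\
  \int[am]_t (r t * trig_sum 1 l t) = 0.
Proof.
have ic (p : R * int * R) : rintegrable am (fun t => r t * cos (p.1.2%:~R * t + p.2)).
  apply: rintegrable_rM; last by exists 1 => x; rewrite ler_norml cos_geN1 cos_le1.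
  by apply: continuous_measurable_fun; apply: continuous_phase; exact: continuous_cos.
have E : (fun t => r t * trig_sum 1 l t) =
    (fun t => \sum_(p <- l) p.1.1 * (r t * cos (p.1.2%:~R * t + p.2))).
  apply/funext => t; rewrite /trig_sum mulr_sumr; apply: eq_bigr => p _.
  by rewrite mul1r mulrCA.
rewrite E; split; first by apply: rintegrable_sum => p _; exact: rintegrableZ.
rewrite Rintegral_sum; last by move=> p _; exact: rintegrableZ.
by rewrite big1// => p _; rewrite RintegralZl ?r_orth ?mulr0//; exact: ic.
Qed.

(** Bernstein polynomials of G in the variable (1 + cos(t - c)) / 2 are trigonometric sums, hence
    orthogonal to [r], and they approximate G uniformly. *)
Lemma cos_function_orth (G : R -> R) (M c : R) : continuous G -> (forall x, `|G x| <= M) ->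
  \int[am]_t (r t * G ((1 + cos (t - c)) / 2)) = 0.
Proof.
move=> cG GM; pose y (t : R) := (1 + cos (1 * t + - c)) / 2.
have cy : continuous y.
  move=> t; apply: cvgMl; apply: cvgD; first exact: cvg_cst.
  by apply: continuous_phase; exact: continuous_cos.
have iG : rintegrable am (fun t => r t * G (y t)).
  apply: rintegrable_rM; last by exists M => x; exact: GM.
  by apply: continuous_measurable_fun => t; apply: continuous_comp; [exact: cy|exact: cG].
rewrite (_ : \int[am]_t _ = \int[am]_t (r t * G (y t))); last first.
  by apply: eq_Rintegral => t _; rewrite /y mul1r.
pose I := \int[am]_t `|r t|.
have I0 : 0 <= I by apply: Rintegral_ge0 => t _.
have H e : 0 < e -> `|\int[am]_t (r t * G (y t))| <= e * I.
  move=> e0; have [n Hn] := bern_weierstrass cG GM e0.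
  have [l Hl] := trig_bern 1 (- c) n (fun k => G (k%:R / n%:R)).
  have [it Et] := trig_sum_orth l.
  rewrite -[X in `|X|]subr0 -Et -RintegralB//.
  apply: le_trans (le_normr_Rintegral _ _) _ => //; first exact: rintegrableB.
  rewrite /I -RintegralZl//; last exact: rintegrable_norm.
  apply: le_Rintegral => //; first by apply: rintegrable_norm; exact: rintegrableB.
    by apply: rintegrableZ; exact: rintegrable_norm.
  move=> t _; rewrite -mulrBr normrM mulrC ler_wpM2r// distrC -Hl.
  by apply: Hn; exact: halfcos_itv.
apply/eqP; rewrite -normr_le0; apply/ler_addgt0Pr => e e0; rewrite add0r.
apply: le_trans (H (e / (I + 1)) _) _; first by rewrite divr_gt0// ltr_wpDl.
by rewrite mulrAC ler_pdivrMr ?ltr_wpDl// ler_wpM2l ?(ltW e0)// lerDl.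
Qed.

(** Limit of ramps by dominated convergence, with majorant |r|. The threshold (1 + tau) / 2 is tau
    read in the variable (1 + cos) / 2. *)
Lemma arc_orth (c tau : R) : \int[am]_t (r t * (tau < cos (t - c))%R%:R) = 0.
Proof.
pose y (t : R) := (1 + cos (t - c)) / 2.
have cy : continuous y.
  move=> t; apply: cvgMl; apply: cvgD; first exact: cvg_cst.
  apply: (@continuous_comp _ _ _ (fun t : R => t - c)); last exact: continuous_cos.
  by apply: cvgB; [exact: cvg_id|exact: cvg_cst].
have mG m : measurable_fun setT (fun t : measurableTypeR R => ramp ((1 + tau) / 2) m (y t)).
  apply: continuous_measurable_fun => t.
  by apply: continuous_comp; [exact: cy|exact: continuous_ramp].
have Gc (t : R) : ramp ((1 + tau) / 2) m (y t) @[m --> \oo] --> ((tau < cos (t - c))%R%:R : R).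
  have -> : (tau < cos (t - c)) = ((1 + tau) / 2 < y t).
    by rewrite /y ltr_pM2r// ltrD2l.
  exact: ramp_cvg.
have m1 : measurable_fun setT (fun t : measurableTypeR R => (tau < cos (t - c))%R%:R : R).
  by apply: measurable_fun_cvg mG _ => t _; exact: Gc.
have Hc (t : R) : (r t * ramp ((1 + tau) / 2) m (y t)) @[m --> \oo] -->
    r t * (tau < cos (t - c))%R%:R by apply: cvgMr; exact: Gc.
have Hb m t : `|r t * ramp ((1 + tau) / 2) m (y t)| <= `|r t|.
  rewrite normrM ler_piMr//.
  by have /andP[h1 h2] := ramp01 ((1 + tau) / 2) m (y t); rewrite ger0_norm.
have [_ L] := Rintegral_dominated_cvg (f_ := fun m t => r t * ramp ((1 + tau) / 2) m (y t))
   (f := fun t => r t * (tau < cos (t - c))%R%:R) (fun m => measurable_funM mr (mG m)) (rintegrable_norm ir)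
   Hb Hc (measurable_funM mr m1).
apply: cvg_unique L _ => //.
rewrite (_ : (fun m => _) = cst 0); first exact: cvg_cst.
apply/funext => m; have B1 x : `|ramp ((1 + tau) / 2) m x| <= 1.
  by have /andP[h1 h2] := ramp01 ((1 + tau) / 2) m x; rewrite ger0_norm.
exact: (cos_function_orth c (@continuous_ramp ((1 + tau) / 2) m) B1).
Qed.

(** The bound 2 pi - rho keeps [u] short of the neighbouring periods, where the arc reappears. *)
Lemma cos_arc (rho u : R) : 0 < rho -> rho < pi -> `|u| < pi *+ 2 - rho ->
  (cos rho < cos u) = (`|u| < rho).
Proof.
move=> rho0 rhopi; rewrite -[cos u](_ : cos `|u| = _); last first.
  by have [u0|u0] := ger0P u; rewrite ?cosN.
move: `|u| (normr_ge0 u) => v v0 vrho.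
have rin : rho \in `[0, pi] by rewrite in_itv/= !ltW.
have [vpi|piv] := leP v pi.
  have vin : v \in `[0, pi] by rewrite in_itv/= v0.
  by rewrite ltr_cos.
rewrite -[cos v](_ : cos (pi *+ 2 - v) = _); last first.
  by rewrite cosB cos2pi sin2pi mul1r mul0r addr0.
rewrite mulr2n in vrho *.
have win : pi + pi - v \in `[0, pi] by rewrite in_itv/=; apply/andP; split; lra.
by rewrite ltr_cos//; apply/idP/idP; lra.
Qed.

Lemma ball_orth (x rho : R) : 0 < rho -> rho < pi -> rho < x -> x + rho < pi *+ 2 ->
  (\int[lam]_(t in ball x rho) (r t)%:E = 0)%E.
Proof.
move=> rho0 rhopi rhox xrho; pose D : set (measurableTypeR R) := `[0, pi *+ 2]%classic.
have bD : ball x rho `<=` D.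
  by move=> t; rewrite ball_itv/= /D/= !in_itv/= => /andP[h1 h2]; apply/andP; split; lra.
have mB : measurable (ball x rho : set (measurableTypeR R)) by exact: measurable_ball.
have iB : lam.-integrable (ball x rho) (EFin \o r) by apply: integrableS lr.
pose w (t : measurableTypeR R) : R := (cos rho < cos (t - x))%R%:R.
have E (t : R) : ((fun t => r t * w t) \_ D) t = (r \_ (ball x rho)) t.
  rewrite !patchE; have [tD|tD] := boolP (t \in D); last first.
    by rewrite ifF//; apply: contraNF tD => /set_mem/bD/mem_set.
  move/set_mem : tD; rewrite /D/= in_itv/= => /andP[t0 t2].
  rewrite /w cos_arc//; last first.
    by rewrite ltr_norml; apply/andP; split; lra.
  have [xt|xt] := boolP (`|t - x| < rho).
    by rewrite mulr1 ifT//; apply/mem_set; rewrite -ball_normE/= distrC.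
  by rewrite mulr0 ifF//; apply: contraNF xt => /set_mem; rewrite -ball_normE/= distrC.
have iw : lam.-integrable setT (EFin \o (fun t => r t * w t) \_ D).
  rewrite (_ : _ \o _ = (EFin \o r) \_ (ball x rho)); last first.
    by apply/funext => t; rewrite /= E !patchE; case: ifP.
  by rewrite -integrable_mkcond.
have mw : measurable_fun setT (fun t => r t * w t).
  apply: measurable_funM => //.
  have mcos : measurable_fun setT (fun t : measurableTypeR R => cos (t - x)).
    apply: continuous_measurable_fun => t.
    apply: (@continuous_comp _ _ _ (fun t : R => t - x)); last exact: continuous_cos.
    by apply: cvgB; [exact: cvg_id|exact: cvg_cst].
  rewrite (_ : w = fun t => if cos rho < cos (t - x) then 1 else 0); last first.
    by apply/funext => t; rewrite /w; case: ifP.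
  by apply: measurable_fun_ifT => //; exact: measurable_fun_ltr.
have lw : lam.-integrable D (EFin \o (fun t => r t * w t)).
  have mD : measurable D by exact: measurable_itv.
  rewrite (integrable_mkcond _ mD); move: iw; congr (integrable _ _ _).
  by apply/funext => t; rewrite /= !patchE; case: ifP.
have [_ Ew] := angle_measure_integrable mw lw.
have := arc_orth x (cos rho); rewrite Ew Rintegral_mkcond.
under eq_Rintegral do rewrite E.
rewrite -Rintegral_mkcond /Rintegral => Z.
by rewrite -[LHS]fineK ?Z//; exact: integrable_fin_num.
Qed.

(** The integrals of [r] over small intervals inside ]0, 2 pi[ vanish, so Lebesgue differentiation
    gives r = 0 at almost every point. *)
Lemma fourier_unique : exists N : set (measurableTypeR R),
  [/\ measurable N, lam N = 0%E & forall t, 0 <= t < pi *+ 2 -> ~ N t -> r t = 0].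
Proof.
pose D : set (measurableTypeR R) := `[0, pi *+ 2]%classic.
have mD : measurable D by exact: measurable_itv.
pose q := r \_ D.
have lq : locally_integrable setT q by exact: integrable_locally.
pose E (x : R) (n : nat) : set R := ball x n.+1%:R^-1.
have hE x : nicely_shrinking x (E x).
  split; first by move=> n; exact: measurable_ball.
  have p0 n : 0 < (n.+1%:R^-1 : R) by [].
  exists (1, fun n => PosNum (p0 n)); split => [//||n|n] /=.
  - exact: cvg_harmonic.
  - by [].
  - by rewrite mul1e.
have [N [mN N0 HN]] := lebesgue_differentiation lq.
(* The point 0 is discarded because no ball around it lies in [0, 2 pi]. *)
exists (N `|` [set 0]); split.
- exact: measurableU.
- by apply/eqP; rewrite measureU0//; [exact/eqP|exact: lebesgue_measure_set1].
move=> t /andP[t0 t2] /not_orP[Nt /eqP tn0].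
have {}t0 : 0 < t by rewrite lt_neqAle eq_sym tn0.
have Lt : lebesgue_pt q t by apply: contrapT => h; apply: Nt; exact: HN.
have qt : q t = r t by rewrite /q patchE ifT//; apply/mem_set; rewrite /D/= in_itv/= !ltW.
have L := nice_lebesgue_differentiation hE lq Lt.
have L0 : ((lam (E t n))^-1 * \int[lam]_(y in E t n) (q y)%:E)%E @[n --> \oo] --> 0%E.
  apply: cvg_near_cst; near=> n.
  have p0 : 0 < (n.+1%:R^-1 : R) by [].
  have pn (e : R) : 0 < e -> e^-1 < n.+1%:R -> n.+1%:R^-1 < e.
    by move=> e0 h; rewrite invf_plt ?posrE.
  have ppi := pi_gt0 R.
  have h1 : n.+1%:R^-1 < t.
    apply: pn => //; apply: lt_trans (_ : n%:R < _); last by rewrite ltr_nat.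
    by near: n; exact: nbhs_infty_gtr.
  have h2 : n.+1%:R^-1 < pi *+ 2 - t.
    apply: pn; first by rewrite subr_gt0.
    apply: lt_trans (_ : n%:R < _); last by rewrite ltr_nat.
    by near: n; exact: nbhs_infty_gtr.
  have h3 : n.+1%:R^-1 < (pi : R).
    apply: pn => //; apply: lt_trans (_ : n%:R < _); last by rewrite ltr_nat.
    by near: n; exact: nbhs_infty_gtr.
  rewrite (eq_integral (fun y => (r y)%:E)); last first.
    move=> y /set_mem; rewrite /E ball_itv/= in_itv/= => /andP[y1 y2].
    rewrite /q patchE ifT//; apply/mem_set; rewrite /D/= in_itv/=.
    rewrite !ltW//; first by apply: lt_trans y2 _; rewrite -ltrBrDl.
    by apply: lt_trans y1; rewrite subr_gt0.
  by rewrite ball_orth ?mule0// -ltrBrDl.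
have Z : (q t)%:E = 0%E by apply: cvg_unique L L0; exact: ereal_hausdorff.
by rewrite -qt; case: Z.
Unshelve. all: by end_near. Qed.

End fourier_uniqueness.

Section circle_means.
Variable R : realType.
Local Notation lam := (@lebesgue_measure R).
Local Notation am := (@angle_measure R).

Definition rmean (g : R -> R) : R := (pi *+ 2)^-1 * \int[am]_t g t.

Definition bmeas (g : R -> R) := measurable_fun setT (g : measurableTypeR R -> R) /\
  exists B, forall x, `|g x| <= B.

Lemma bmeas_rintegrable g : bmeas g -> rintegrable am g.
Proof. by move=> [mg gB]; exact: (angle_measure_integral mg gB).1. Qed.

Lemma bmeasD g h : bmeas g -> bmeas h -> bmeas (fun x => g x + h x).
Proof.
move=> [mg [B gB]] [mh [C hC]]; split; first exact: measurable_funD.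
by exists (B + C) => x; rewrite (le_trans (ler_normD _ _))// lerD.
Qed.

Lemma bmeasM g h : bmeas g -> bmeas h -> bmeas (fun x => g x * h x).
Proof.
move=> [mg [B gB]] [mh [C hC]]; split; first exact: measurable_funM.
by exists (B * C) => x; rewrite normrM ler_pM.
Qed.

Lemma bmeas_cst c : bmeas (fun=> c).
Proof. by split; [exact: measurable_cst|exists `|c|]. Qed.

Lemma bmeas_sum n (g : nat -> R -> R) : (forall k, bmeas (g k)) ->
  bmeas (fun x => \sum_(k < n) g k x).
Proof.
move=> bg; elim: n => [|n IH].
  by under eq_fun do rewrite big_ord0; exact: bmeas_cst.
by under eq_fun do rewrite big_ord_recr/=; exact: bmeasD.
Qed.

Lemma bmeas_cos (m a : R) : bmeas (fun x => cos (m * x + a)).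
Proof.
split; last by exists 1 => x; rewrite ler_norml cos_geN1 cos_le1.
by apply: continuous_measurable_fun; apply: continuous_phase; exact: continuous_cos.
Qed.

Lemma rmeanD g h : bmeas g -> bmeas h -> rmean (fun x => g x + h x) = rmean g + rmean h.
Proof.
by move=> bg bh; rewrite /rmean RintegralD ?mulrDr//; exact: bmeas_rintegrable.
Qed.

Lemma rmeanZ c g : bmeas g -> rmean (fun x => c * g x) = c * rmean g.
Proof.
by move=> /bmeas_rintegrable ig; rewrite /rmean RintegralZl//; exact: mulrCA.
Qed.

Lemma rmeanB g h : bmeas g -> bmeas h -> rmean (fun x => g x - h x) = rmean g - rmean h.
Proof.
move=> bg bh; rewrite -mulN1r -rmeanZ// -rmeanD//; last exact: bmeasM (bmeas_cst _) bh.
by congr rmean; apply/funext => x; rewrite mulN1r.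
Qed.

Lemma rmean_sum n (g : nat -> R -> R) : (forall k, bmeas (g k)) ->
  rmean (fun x => \sum_(k < n) g k x) = \sum_(k < n) rmean (g k).
Proof.
move=> bg; rewrite /rmean Rintegral_sum ?mulr_sumr// => k _.
exact: bmeas_rintegrable.
Qed.

Let p2 : 0 < (pi *+ 2 : R). Proof. by rewrite pmulrn_lgt0// pi_gt0. Qed.

Lemma rmean_cst c : rmean (fun=> c) = c.
Proof.
have cB : exists B, forall x : R, `|cst c x| <= B by exists `|c|.
rewrite /rmean; have [_ [_ ->]] := angle_measure_integral (measurable_cst c) cB.
rewrite Rintegral_cst//= lebesgue_measure_itv/= lte_fin p2/= oppr0 addr0.
by rewrite mulrCA mulVf ?mulr1// gt_eqF.
Qed.

Lemma rmean_le g B : bmeas g -> (forall x, `|g x| <= B) -> `|rmean g| <= B.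
Proof.
move=> bg gB; have ig := bmeas_rintegrable bg.
rewrite -[B]rmean_cst /rmean normrM normfV (gtr0_norm p2) ler_wpM2l ?invr_ge0 ?(ltW p2)//.
apply: le_trans (le_normr_Rintegral _ _) _ => //.
apply: le_Rintegral => //; [exact: rintegrable_norm|exact: bmeas_rintegrable (bmeas_cst B)].
Qed.

Lemma circle_mean_re (W : R -> R[i]) : circle_mean W =
  (rmean (fun t => complex.Re (W t))) +i* (rmean (fun t => complex.Im (W t))).
Proof.
by rewrite /circle_mean /cint /rmean; apply/eqP; rewrite eq_complex/= !mul0r subr0 addr0 !eqxx.
Qed.

Lemma cisE (t : R) : cis t = cos t +i* sin t.
Proof. by rewrite /cis /cexp/= expR0 !mul1r. Qed.

Lemma rmean_cos (m : int) (a : R) : rmean (fun t => cos (m%:~R * t + a)) = (m == 0)%:R * cos a.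
Proof.
have H (j k : nat) : rmean (fun t => cos ((j%:R - k%:R) * t)) = (j == k)%:R /\
    rmean (fun t => sin ((j%:R - k%:R) * t)) = 0.
  have := cint_cis R j k; rewrite circle_mean_re => /eqP; rewrite eq_complex/=.
  move=> /andP[/eqP h1 /eqP h2]; split.
    transitivity (rmean (fun t => complex.Re (cis (t *+ j - t *+ k)))).
      by congr rmean; apply/funext => t; rewrite cisE/= mulrBl !mulr_natl.
    by rewrite h1; case: (j == k).
  transitivity (rmean (fun t => complex.Im (cis (t *+ j - t *+ k)))).
    by congr rmean; apply/funext => t; rewrite cisE/= mulrBl !mulr_natl.
  by rewrite h2; case: (j == k).
(* Orthogonality is known for exponents j - k with j and k natural numbers, and every integer is
   such a difference. *)
have [j [k mE]] : exists j k : nat, m = j%:Z - k%:Z.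
  by case: m => n; [exists n, 0%N; rewrite subr0|exists 0%N, n.+1; rewrite sub0r NegzE].
have mR : m%:~R = j%:R - k%:R :> R by rewrite mE intrB.
have m0 : (m == 0) = (j == k) by rewrite mE subr_eq0.
have [h1 h2] := H j k.
have bc : bmeas (fun t => cos ((j%:R - k%:R) * t)).
  by have := bmeas_cos (j%:R - k%:R) 0; under eq_fun do rewrite addr0.
have bs : bmeas (fun t => sin ((j%:R - k%:R) * t)).
  by have := bmeas_cos (j%:R - k%:R) (- (pi / 2)); under eq_fun do rewrite cosBpihalf.
rewrite m0 -h1 mR mulrC.
transitivity (rmean (fun t => cos a * cos ((j%:R - k%:R) * t) - sin a * sin ((j%:R - k%:R) * t))).
  by congr rmean; apply/funext => t; rewrite cosD; ring.
rewrite rmeanB ?rmeanZ// ?h2 ?mulr0 ?subr0//.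
  exact: bmeasM (bmeas_cst _) bc.
exact: bmeasM (bmeas_cst _) bs.
Qed.

End circle_means.

(** * Absolutely convergent Fourier series *)

Section fourier_series.
Variables (R : realType) (a b : nat -> R) (T : R).
Hypothesis b0 : b 0 = 0.
Hypothesis abT : forall N, \sum_(k < N) (a k ^+ 2 + b k ^+ 2) * k.+1%:R ^+ 2 <= T.

(** For a real function the modes k and - k are conjugate. Folded onto k >= 0, every mode but 0
    counts twice. *)
Definition mode_weight (k : nat) : R := if k is 0 then 1 else 2.

Let term k x := mode_weight k * (a k * cos (k%:R * x) + b k * sin (k%:R * x)).
Let S N x := \sum_(k < N) term k x.

Definition fourier_series (x : R) : R := limn (S ^~ x).

Let t k := 2 * (`|a k| + `|b k|).
Let Tn N := \sum_(k < N) t k.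

Let term_le k x : `|term k x| <= t k.
Proof.
rewrite /term /t normrM ler_pM//.
  by case: k => [|k] /=; rewrite ger0_norm// ler1n.
apply: le_trans (ler_normD _ _) _; rewrite !normrM; apply: lerD.
  by rewrite ler_piMr// ler_norml cos_geN1 cos_le1.
by rewrite ler_piMr// ler_norml sin_geN1 sin_le1.
Qed.

Let t_ge0 k : 0 <= t k. Proof. by rewrite mulr_ge0// addr_ge0. Qed.

Let Tn_bounded : exists M, forall N, Tn N <= M.
Proof.
have p1 : (1 : R) < 2 by rewrite ltr1n.
have [M HM] := sum_powR_bounded p1.
exists (T + 2 * M) => N; apply: le_trans (_ : \sum_(k < N) ((a k ^+ 2 + b k ^+ 2) * k.+1%:R ^+ 2 + 2 * k.+1%:R `^ (- 2)) <= _).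
  apply: ler_sum => k _; rewrite /t.
  set q : R := k.+1%:R; have q0 : 0 < q by rewrite ltr0n.
  have -> : q `^ (- 2) = (q^-1) ^+ 2 by rewrite powRN powR_mulrn ?(ltW q0)// exprVn.
  (* Arithmetic-geometric mean inequality: weighted square summability becomes absolute summability,
     at the price of the convergent series of the 1 / (k + 1)^2. *)
  have H (x : R) : 2 * `|x| <= x ^+ 2 * q ^+ 2 + q^-1 ^+ 2.
    have := sqr_ge0 (`|x| * q - q^-1).
    rewrite (_ : _ ^+ 2 = `|x| ^+ 2 * q ^+ 2 - 2 * `|x| + q^-1 ^+ 2); last by field; rewrite gt_eqF.
    rewrite real_normK ?num_real// => h; rewrite -subr_ge0; apply: le_trans h _.
    by rewrite le_eqVlt; apply/orP; left; apply/eqP; ring.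
  rewrite (_ : _ + 2 * _ = (a k ^+ 2 * q ^+ 2 + q^-1 ^+ 2) + (b k ^+ 2 * q ^+ 2 + q^-1 ^+ 2)); last by ring.
  by rewrite mulrDr lerD.
rewrite big_split/=; apply: lerD; first exact: abT.
rewrite -mulr_sumr ler_wpM2l//; apply: le_trans (HM N.+1).
by rewrite [leRHS]big_ord_recl/= lerDr powR_ge0.
Qed.

Let Tn_cvg : cvgn Tn.
Proof.
have [M HM] := Tn_bounded.
apply: (@nondecreasing_is_cvgn _ Tn).
  by apply/nondecreasing_seqP => n; rewrite /Tn big_ord_recr/= lerDl.
by exists M => _ [n _ <-]; exact: HM.
Qed.

Definition fourier_tail N : R := limn Tn - Tn N.

Lemma fourier_tail_cvg0 : fourier_tail N @[N --> \oo] --> (0 : R).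
Proof.
rewrite -[X in _ --> X](subrr (limn Tn)); apply: cvgB; first exact: cvg_cst.
exact: Tn_cvg.
Qed.

Let S_diff N M x : (N <= M)%N -> `|S M x - S N x| <= Tn M - Tn N.
Proof.
move=> NM; rewrite /S /Tn -!(big_mkord xpredT (term ^~ x)) -!(big_mkord xpredT t).
rewrite (big_cat_nat (leq0n N) NM)/= (big_cat_nat (F := t) (leq0n N) NM)/=.
rewrite [X in `|X|]addrAC subrr add0r [leRHS]addrAC subrr add0r.
by apply: le_trans (ler_norm_sum _ _ _) _; apply: ler_sum => k _; exact: term_le.
Qed.

Let S_cvg x : S N x @[N --> \oo] --> fourier_series x.
Proof.
suff : cvgn (S ^~ x) by [].
have E : S ^~ x = series (term ^~ x).
  by apply/funext => N; rewrite /series/= big_mkord.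
rewrite E; apply: normed_cvg.
rewrite (_ : [normed series _] = fun N => \sum_(k < N) `|term k x|); last first.
  by apply/funext => N; rewrite /normed_series_of /series/= big_mkord.
apply: nondecreasing_is_cvgn.
  by apply/nondecreasing_seqP => n; rewrite big_ord_recr/= lerDl.
have [M HM] := Tn_bounded; exists M => _ [n _ <-].
by apply: le_trans (HM n); apply: ler_sum => k _; exact: term_le.
Qed.

Lemma fourier_series_approx N x : `|fourier_series x - S N x| <= fourier_tail N.
Proof.
have h1 : `|S M x - S N x| @[M --> \oo] --> `|fourier_series x - S N x|.
  by apply: cvg_norm; apply: cvgB; [exact: S_cvg|exact: cvg_cst].
have h2 : (Tn M - Tn N) @[M --> \oo] --> fourier_tail N.
  by apply: cvgB; [exact: Tn_cvg|exact: cvg_cst].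
apply: (ler_cvg_to h1 h2); near=> M; apply: S_diff.
by near: M; exact: nbhs_infty_ge.
Unshelve. all: by end_near. Qed.

Let bterm k : bmeas (term k).
Proof.
have bc := bmeas_cos (k%:R : R) 0; have bs := bmeas_cos (k%:R : R) (- (pi / 2)).
have := bmeasM (bmeas_cst (mode_weight k)) (bmeasD (bmeasM (bmeas_cst (a k)) bc) (bmeasM (bmeas_cst (b k)) bs)).
by under eq_fun do rewrite addr0 cosBpihalf.
Qed.

Let bS N : bmeas (S N). Proof. exact: (bmeas_sum N bterm). Qed.

Lemma bmeas_fourier_series : bmeas fourier_series.
Proof.
split.
  apply: (measurable_fun_cvg (h := S)) => [N|x _]; first exact: (bS N).1.
  exact: S_cvg.
exists (fourier_tail 0) => x; have := fourier_series_approx 0 x.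
by rewrite /S big_ord0 subr0.
Qed.

Lemma fourier_series_periodic : periodic fourier_series (pi *+ 2).
Proof.
move=> x; congr (limn _); apply/funext => N; apply: eq_bigr => k _.
rewrite /term; have -> : k%:R * (x + pi *+ 2) = k%:R * x + (pi *+ 2) *+ k.
  by rewrite mulrDr; congr (_ + _); exact: mulr_natl.
by rewrite (periodicn (@cosD2pi R)) (periodicn (@sinD2pi R)).
Qed.

Let rmean_lim g (l : R) : bmeas g -> rmean (fun x => S N x * g x) @[N --> \oo] --> l ->
  rmean (fun x => fourier_series x * g x) = l.
Proof.
move=> bg; have [_ [B gB]] := bg => L.
have bF := bmeas_fourier_series.
have B0 : 0 <= B := le_trans (normr_ge0 _) (gB 0).
apply: cvg_unique L => //; apply/cvgrPdist_le => e e0.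
have U : fourier_tail N * B @[N --> \oo] --> (0 : R).
  by rewrite -[X in _ --> X](mul0r B); apply: cvgMl; exact: fourier_tail_cvg0.
near=> N; rewrite -rmeanB; [|exact: bmeasM|exact: bmeasM].
apply: le_trans (rmean_le (B := fourier_tail N * B) _ _) _.
- rewrite (_ : (fun x => _) = fun x => fourier_series x * g x + -1 * (S N x * g x)); last first.
    by apply/funext => x; rewrite mulN1r.
  by apply: bmeasD; apply: bmeasM => //; [exact: bmeas_cst|exact: bmeasM].
- move=> x; rewrite -mulrBl normrM ler_pM// ?fourier_series_approx//.
- by near: N; apply: (cvgr_le _ U).
Unshelve. all: by end_near. Qed.

(** The partial sums converge uniformly, so the mean passes to the limit. The phase [al] covers
    cosine and sine coefficients at once. *)
Lemma fourier_series_coef (m : nat) (al : R) :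
  rmean (fun x => fourier_series x * cos (m%:R * x + al)) = a m * cos al - b m * sin al.
Proof.
apply: rmean_lim; first exact: bmeas_cos.
apply: cvg_near_cst; near=> N.
have mN : (m < N)%N by near: N; exact: nbhs_infty_gt.
(* Product-to-sum form. For k = m > 0 only the difference frequency has a nonzero mean and the
   weight 2 compensates the 1/2; for k = m = 0 both frequencies vanish and the weight is 1. *)
pose ck k x := mode_weight k * a k / 2 * (cos ((m%:Z + k%:Z)%:~R * x + al) + cos ((m%:Z - k%:Z)%:~R * x + al)) +
   mode_weight k * b k / 2 * (cos ((m%:Z + k%:Z)%:~R * x + (al - pi / 2)) - cos ((m%:Z - k%:Z)%:~R * x + (al - pi / 2))).
have bN g : bmeas g -> bmeas (fun x : R => - g x).
  by move=> bg; have := bmeasM (bmeas_cst (-1)) bg; under eq_fun do rewrite mulN1r.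
have bck k : bmeas (ck k).
  apply: bmeasD; apply: bmeasM (bmeas_cst _) _; apply: bmeasD; try exact: bmeas_cos.
  by apply: bN; exact: bmeas_cos.
transitivity (rmean (fun x => \sum_(k < N) ck k x)).
  congr rmean; apply/funext => x; rewrite /S mulr_suml; apply: eq_bigr => k _.
  rewrite /term /ck !addrA !cosBpihalf intrD intrB !mulrDl mulNr.
  have -> : m%:~R * x + k%:~R * x + al = (m%:R * x + al) + k%:R * x by rewrite -addrA addrAC addrA [_ + al]addrC; ring.
  have -> : m%:~R * x - k%:~R * x + al = (m%:R * x + al) - k%:R * x by ring.
  by move: (m%:R * x + al) (k%:R * x) => A B; rewrite cosD cosB sinD sinB; field.
have Eck k : rmean (ck k) = (k == m)%:R * (a m * cos al - b m * sin al).
  have bc1 n' al' := bmeas_cos (n'%:~R : R) al'.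
  rewrite /ck rmeanD; [|by apply: bmeasM (bmeas_cst _) _; apply: bmeasD|]; last first.
    by apply: bmeasM (bmeas_cst _) _; apply: bmeasD => //; exact: bN.
  rewrite rmeanZ; last exact: bmeasD.
  rewrite rmeanZ; last by apply: bmeasD => //; exact: bN.
  rewrite rmeanD// rmeanB// !rmean_cos cosBpihalf.
  have -> : (m%:Z - k%:Z == 0) = (k == m) by rewrite subr_eq0 eqz_nat eq_sym.
  have -> : (m%:Z + k%:Z == 0) = (m == 0)%N && (k == 0)%N by rewrite -PoszD eqz_nat addn_eq0.
  have [->|km] := eqVneq k m.
    case: (m) => [|m'] /=; last by rewrite !mul0r !mul1r; field.
    by rewrite b0 !mul1r !mul0r subr0; field.
  case: (eqVneq m 0) => [m0|m0]; case: (eqVneq k 0) => [k0|k0] /=; last 3 first.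
  - by rewrite !mul0r subrr addr0 !mulr0 addr0.
  - by rewrite !mul0r subrr addr0 !mulr0 addr0.
  - by rewrite !mul0r subrr addr0 !mulr0 addr0.
  by rewrite k0 m0 eqxx in km.
rewrite rmean_sum// (bigD1 (Ordinal mN))//= big1 ?addr0; first by rewrite Eck eqxx mul1r.
by move=> k; rewrite -val_eqE/= Eck => /negPf ->; rewrite mul0r.
Unshelve. all: by end_near. Qed.

Lemma fourier_series_parseval :
  (\sum_(k < N) mode_weight k * (a k ^+ 2 + b k ^+ 2)) @[N --> \oo] -->
  rmean (fun x => fourier_series x ^+ 2).
Proof.
have bF := bmeas_fourier_series.
have [_ [B FB]] := bF.
have B0 : 0 <= B := le_trans (normr_ge0 _) (FB 0).
have E N : rmean (fun x => fourier_series x * S N x) = \sum_(k < N) mode_weight k * (a k ^+ 2 + b k ^+ 2).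
  pose g k x := mode_weight k * (a k * (fourier_series x * cos (k%:R * x + 0)) +
    b k * (fourier_series x * cos (k%:R * x + - (pi / 2)))).
  have bc1 (k : nat) al : bmeas (fun x => fourier_series x * cos (k%:R * x + al)).
    by apply: bmeasM => //; exact: bmeas_cos.
  have bg k : bmeas (g k).
    by apply: bmeasM (bmeas_cst _) _; apply: bmeasD; apply: bmeasM (bmeas_cst _) _.
  transitivity (rmean (fun x => \sum_(k < N) g k x)).
    congr rmean; apply/funext => x; rewrite /S mulr_sumr; apply: eq_bigr => k _.
    by rewrite /g /term addr0 cosBpihalf; ring.
  rewrite rmean_sum//; apply: eq_bigr => k _.
  rewrite /g rmeanZ; last by apply: bmeasD; apply: bmeasM (bmeas_cst _) _.
  rewrite rmeanD; [|exact: bmeasM (bmeas_cst _) _|exact: bmeasM (bmeas_cst _) _].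
  rewrite !rmeanZ// !fourier_series_coef cosN sinN cos_pihalf sin_pihalf cos0 sin0.
  by ring.
under eq_fun do rewrite -E.
have U : B * fourier_tail N @[N --> \oo] --> (0 : R).
  by rewrite -[X in _ --> X](mulr0 B); apply: cvgMr; exact: fourier_tail_cvg0.
apply/cvgrPdist_le => e e0; near=> N.
rewrite -rmeanB; [|by under eq_fun do rewrite expr2; exact: bmeasM|exact: bmeasM].
apply: le_trans (rmean_le (B := B * fourier_tail N) _ _) _.
- rewrite (_ : (fun x => _) = fun x => fourier_series x * (fourier_series x + -1 * S N x)); last first.
    by apply/funext => x; ring.
  by apply: bmeasM => //; apply: bmeasD => //; apply: bmeasM => //; exact: bmeas_cst.
- by move=> x; rewrite expr2 -mulrBr normrM ler_pM// ?fourier_series_approx.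
- by near: N; apply: (cvgr_le _ U).
Unshelve. all: by end_near. Qed.

End fourier_series.

(** * The coefficients of [f] and its continuous version *)

Section coefficients.
Variable R : realType.

Lemma esum_int (G : int -> \bar R) : (forall k, (0 <= G k)%E) ->
  (\esum_(k in [set: int]) G k =
   \sum_(0 <= k <oo) G (Posz k) + \sum_(0 <= k <oo) G (Negz k))%E.
Proof.
move=> G0; rewrite (esumID (range Posz))//; congr (_ + _)%E.
  rewrite setTI nneseries_esumT//; apply: reindex_esum.
  by split => [n _|m n _ _ []|k]//; exists n.
rewrite setTI nneseries_esumT//; apply: reindex_esum.
split => [n _ [m _]|m n _ _ []|k] //.
by case: k => [n []|n _]; exists n.
Qed.

Variables (f : R -> R) (sigma : R).
Hypothesis sigma_ge1 : 1 <= sigma.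
Hypothesis f_Fl2 : Fl2 sigma f.

Definition fcos (k : nat) : R := complex.Re (fourier_coef f k).
Definition fsin (k : nat) : R := complex.Im (fourier_coef f k).
Definition fpower (k : nat) : R := fcos k ^+ 2 + fsin k ^+ 2.

Lemma fpower_ge0 k : 0 <= fpower k.
Proof. by rewrite addr_ge0// sqr_ge0. Qed.

Lemma normc_coef_Posz (k : nat) : normc (fourier_coef f k) ^+ 2 = fpower k.
Proof.
by rewrite /fpower /fcos /fsin; case: (fourier_coef f k) => x y /=; rewrite sqr_sqrtr// addr_ge0 ?sqr_ge0.
Qed.

Let D : set (measurableTypeR R) := `[0, pi *+ 2]%classic.

Lemma integrable_coef (g : R -> R) : bmeas g ->
  lebesgue_measure.-integrable D (EFin \o (fun x => f x * g x)).
Proof.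
move=> [mg [B gB]]; have [[_ fi] _] := f_Fl2.
apply: (integrableMl _ fi); first exact: measurable_itv.
  exact: measurable_funTS.
by exists B; split; [exact: num_real|move=> M BM x _; exact: le_trans (gB x) (ltW BM)].
Qed.

Lemma fourier_coefN (k : int) : fourier_coef f (- k) = (fourier_coef f k)^*.
Proof.
rewrite /fourier_coef; apply/eqP; rewrite eq_complex/=; apply/andP; split; apply/eqP.
  by congr (_ * _); apply: eq_Rintegral => x _; rewrite mulrNz mulNr cosN.
rewrite -mulrN; congr (_ * _).
transitivity (\int[lebesgue_measure]_(x in D) (-1 * (f x * sin (k%:~R * x)))).
  apply: eq_Rintegral => x _; rewrite mulN1r -mulrN; congr (_ * _).
  by rewrite mulrNz mulNr sinN.
rewrite RintegralZl ?mulN1r//; first exact: measurable_itv.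
apply: integrable_coef; have := bmeas_cos (k%:~R : R) (- (pi / 2)).
by under eq_fun do rewrite cosBpihalf.
Qed.

Lemma fourier_coef_cos (m : nat) (al : R) :
  (pi *+ 2)^-1 * \int[lebesgue_measure]_(x in D) (f x * cos (m%:R * x + al)) =
  fcos m * cos al - fsin m * sin al.
Proof.
have bc := bmeas_cos (m%:R : R) 0; rewrite (_ : (fun x => _) = fun x => cos (m%:R * x)) in bc; last first.
  by apply/funext => x; rewrite addr0.
have bs := bmeas_cos (m%:R : R) (- (pi / 2)); rewrite (_ : (fun x => _) = fun x => sin (m%:R * x)) in bs; last first.
  by apply/funext => x; rewrite cosBpihalf.
have mD : measurable D by exact: measurable_itv.
have ic := integrable_coef bc; have is_ := integrable_coef bs.
transitivity ((pi *+ 2)^-1 * \int[lebesgue_measure]_(x in D)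
    (cos al * (f x * cos (m%:R * x)) - sin al * (f x * sin (m%:R * x)))).
  by congr (_ * _); apply: eq_Rintegral => x _; rewrite cosD; ring.
have iZ (c : R) (g : measurableTypeR R -> R) : lebesgue_measure.-integrable D (EFin \o g) ->
    lebesgue_measure.-integrable D (EFin \o (fun x => c * g x)).
  by move=> /(integrableZl mD c).
rewrite RintegralB//; [|exact: iZ|exact: iZ].
rewrite !RintegralZl// mulrBr /fcos /fsin /fourier_coef /=.
by rewrite -pmulrn mulrCA [X in _ - X]mulrCA ![_ * cos al]mulrC ![_ * sin al]mulrC.
Qed.

Lemma fsin0 : fsin 0 = 0.
Proof.
rewrite /fsin /fourier_coef/= (_ : \int[_]_(x in _) _ = 0) ?mulr0//.
transitivity (\int[lebesgue_measure]_(x in D) (cst 0 x : R)).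
  by apply: eq_Rintegral => x _; rewrite mul0r sin0 mulr0.
by rewrite Rintegral_cst ?mul0r//; exact: measurable_itv.
Qed.

(** As sigma >= 1, (1 + k)^2 <= (1 + k)^(2 sigma). The nonnegative modes are bounded by the full
    sum, which is finite because its square root is. *)
Lemma fcos_bounded : exists T, forall N, \sum_(k < N) fpower k * k.+1%:R ^+ 2 <= T.
Proof.
have [_ fin] := f_Fl2; move: fin; rewrite /Fl2_norm.
set E := (\esum_(k in [set: int]) _)%E => fin.
have E0 : (0 <= E)%E by apply: esum_ge0 => k _; rewrite lee_fin mulr_ge0 ?sqr_ge0 ?powR_ge0.
have Ey : (E < +oo)%E.
  by rewrite ltey; apply: contraTneq fin => ->; rewrite poweRyr ?invr_eq0 ?pnatr_eq0.
have Efin : E \is a fin_num by rewrite ge0_fin_numE.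
exists (fine E) => N; rewrite -lee_fin fineK// /E esum_int; last first.
  by move=> k; rewrite lee_fin mulr_ge0 ?sqr_ge0 ?powR_ge0.
rewrite -[leLHS]adde0; apply: leeD; last first.
  by apply: nneseries_ge0 => k _ _; rewrite lee_fin mulr_ge0 ?sqr_ge0 ?powR_ge0.
apply: le_trans (nneseries_lim_ge N _); last first.
  by move=> k _ _; rewrite lee_fin mulr_ge0 ?sqr_ge0 ?powR_ge0.
rewrite big_mkord sumEFin lee_fin; apply: ler_sum => k _.
rewrite normc_coef_Posz ler_wpM2l ?fpower_ge0//.
have -> : 1 + `|(k : int)%:~R| = k.+1%:R :> R by rewrite -pmulrn ger0_norm// -natr1 addrC.
by rewrite -powR_mulrn// ler_powR ?ler1n//; rewrite -[leLHS]mulr1 ler_wpM2l.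
Qed.

Lemma fpower_bounded : exists T, forall N, \sum_(k < N) k%:R ^+ 2 * fpower k <= T.
Proof.
have [T HT] := fcos_bounded; exists T => N; apply: le_trans (HT N).
apply: ler_sum => k _; rewrite mulrC ler_wpM2l ?fpower_ge0//.
by rewrite lerXn2r ?nnegrE// ler_nat.
Qed.

(** Modes k and - k contribute equally. [Negz k] is -(k + 1), so the negative half is the same
    series shifted by one; nothing is lost, since the term at 0 vanishes. *)
Lemma limit_variance_cvg :
  (\sum_(k < N) mode_weight R k * (k%:R ^+ 2 * fpower k)) @[N --> \oo] --> limit_variance f.
Proof.
pose P N := \sum_(k < N) k%:R ^+ 2 * fpower k.
have P0 k : 0 <= (k%:R : R) ^+ 2 * fpower k by rewrite mulr_ge0 ?sqr_ge0 ?fpower_ge0.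
have [T HT] := fpower_bounded.
have Pc : cvgn P.
  apply: nondecreasing_is_cvgn; first by apply/nondecreasing_seqP => n; rewrite /P big_ord_recr/= lerDl.
  by exists T => _ [n _ <-]; exact: HT.
have -> : limit_variance f = 2 * limn P.
  rewrite /limit_variance esum_int; last by move=> k; rewrite lee_fin mulr_ge0 ?sqr_ge0.
  have E1 : (\sum_(0 <= k <oo) (k%:~R ^+ 2 * normc (fourier_coef f (Posz k)) ^+ 2)%:E = (limn P)%:E)%E.
    apply: cvg_lim => //; apply/fine_cvgP; split.
      by near=> n; rewrite sumEFin.
    apply: cvg_trans Pc; apply: near_eq_cvg; near=> n.
    by rewrite /P /= sumEFin/= big_mkord; apply: eq_bigr => k _; rewrite normc_coef_Posz.
  have E2 : (\sum_(0 <= k <oo) ((Negz k)%:~R ^+ 2 * normc (fourier_coef f (Negz k)) ^+ 2)%:E = (limn P)%:E)%E.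
    apply: cvg_lim => //; apply/fine_cvgP; split.
      by near=> n; rewrite sumEFin.
    have Pc' : P n.+1 @[n --> \oo] --> limn P by rewrite (cvg_shiftS P).
    apply: cvg_trans Pc'; apply: near_eq_cvg; near=> n.
    rewrite /P /= sumEFin/= big_mkord big_ord_recl/= expr0n/= mul0r add0r.
    apply: eq_bigr => k _; rewrite NegzE fourier_coefN normc_conj normc_coef_Posz.
    by rewrite mulrNz sqrrN.
  by rewrite E1 E2 /= mulr2n mulrDl mul1r.
have -> : (fun N => \sum_(k < N) mode_weight R k * (k%:R ^+ 2 * fpower k)) = (fun N => 2 * P N).
  apply/funext => N; rewrite mulr_sumr; apply: eq_bigr => -[[|k] kN] _ //=.
  by rewrite expr0n/= mul0r !mulr0.
by apply: cvgMr; exact: Pc.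
Unshelve. all: by end_near. Qed.

Definition continuous_version : R -> R := fourier_series fcos fsin.

Lemma bmeas_continuous_version : bmeas continuous_version.
Proof. by have [T HT] := fcos_bounded; exact: bmeas_fourier_series HT. Qed.

Lemma continuous_version_cos (m : int) (al : R) :
  rmean (fun x => continuous_version x * cos (m%:~R * x + al)) =
  (pi *+ 2)^-1 * \int[lebesgue_measure]_(x in D) (f x * cos (m%:~R * x + al)).
Proof.
have [T HT] := fcos_bounded.
have H (k : nat) be : rmean (fun x => continuous_version x * cos (k%:R * x + be)) =
  (pi *+ 2)^-1 * \int[lebesgue_measure]_(x in D) (f x * cos (k%:R * x + be)).
  by rewrite fourier_coef_cos (fourier_series_coef fsin0 HT).
case: m => k; first by rewrite -pmulrn H.
have E x : cos ((Negz k)%:~R * x + al) = cos (k.+1%:R * x + (- al)).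
  by rewrite NegzE mulrNz mulNr -pmulrn -cosN opprD opprK.
under eq_Rintegral do rewrite E.
by rewrite -H; congr rmean; apply/funext => x; rewrite E.
Qed.

(** All trigonometric moments of the difference vanish, so uniqueness of Fourier coefficients
    applies. *)
Lemma continuous_version_ae : exists N : set (measurableTypeR R),
  [/\ measurable N, lebesgue_measure N = 0%E &
  forall t, 0 <= t < pi *+ 2 -> ~ N t -> f t = continuous_version t].
Proof.
have mD : measurable D by exact: measurable_itv.
have [[_ fi] _] := f_Fl2.
have bF := bmeas_continuous_version.
have p2 : (pi *+ 2 : R) != 0 by rewrite gt_eqF// pmulrn_lgt0// pi_gt0.
(* Cut off outside one period: integrability of [f], and with it measurability, is given there. *)
pose r : measurableTypeR R -> R := (fun x => f x - continuous_version x) \_ D.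
have ri : lebesgue_measure.-integrable D (EFin \o (fun x => f x - continuous_version x)).
  have [_ [lF _]] := angle_measure_integral bF.1 bF.2.
  exact: (integrableB mD fi lF).
have mr : measurable_fun setT r.
  by apply: (measurable_restrictT _ mD).1; case/integrableP: ri => /measurable_EFinP.
have rE x : D x -> r x = f x - continuous_version x.
  by move=> Dx; rewrite /r patchE ifT//; apply/mem_set.
have lr : lebesgue_measure.-integrable D (EFin \o r).
  by apply: eq_integrable ri => // x /set_mem Dx /=; rewrite rE.
have [N [mN N0 HN]] : exists N : set (measurableTypeR R),
    [/\ measurable N, lebesgue_measure N = 0%E & forall t, 0 <= t < pi *+ 2 -> ~ N t -> r t = 0].
  apply: (fourier_unique mr lr) => m al.
  have bc := bmeas_cos (m%:~R : R) al.
  have ir := (angle_measure_integrable mr lr).1.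
  have irc : rintegrable (@angle_measure R) (fun t => r t * cos (m%:~R * t + al)).
    exact: rintegrableMb ir bc.1 bc.2.
  have mrc : measurable_fun setT (fun t => r t * cos (m%:~R * t + al)) by exact: rintegrable_measurable irc.
  have lrc : lebesgue_measure.-integrable D (EFin \o (fun t => r t * cos (m%:~R * t + al))).
    apply: (integrableMl _ lr) => //; first exact: measurable_funTS bc.1.
    by have [_ [B HB]] := bc; exists B; split; [exact: num_real|move=> M BM x _; exact: le_trans (HB x) (ltW BM)].
  rewrite (angle_measure_integrable mrc lrc).2.
  transitivity (\int[lebesgue_measure]_(x in D) (f x * cos (m%:~R * x + al) - continuous_version x * cos (m%:~R * x + al))).
    by apply: eq_Rintegral => x /set_mem Dx; rewrite rE// mulrBl.
  have bFc := bmeasM bF bc.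
  have [_ [lFc EFc]] := angle_measure_integral bFc.1 bFc.2.
  rewrite RintegralB//; last exact: integrable_coef.
  have := continuous_version_cos m al; rewrite /rmean EFc => /(mulfI (invr_neq0 p2)) ->.
  by rewrite subrr.
exists N; split => // t t02 Nt; have /eqP := HN t t02 Nt.
have /andP[t0 t2] := t02.
by rewrite rE ?subr_eq0 => [/eqP//|]; rewrite /D/= in_itv/= t0 ltW.
Qed.

End coefficients.

(** * Asymptotics of the variance *)

Section symmetric_sums.
Variable R : realType.

(** Grouping by diagonals d = |j - k|, each d > 0 occurring on both sides of the main one. The
    induction adds the last row and column. *)
Lemma sum_symmetric (H : nat -> nat -> R) n : (forall j k, H j k = H k j) ->
  \sum_(j < n) \sum_(k < n) H j k =
  \sum_(d < n) mode_weight R d * \sum_(j < n - d) H j (j + d)%N.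
Proof.
move=> Hs; elim: n => [|n IH]; first by rewrite !big_ord0.
have -> : \sum_(j < n.+1) \sum_(k < n.+1) H j k =
    \sum_(j < n) \sum_(k < n) H j k + ((\sum_(j < n) H j n) *+ 2 + H n n).
  rewrite big_ord_recr/=; under eq_bigr do rewrite big_ord_recr/=.
  rewrite big_split/= big_ord_recr/=.
  rewrite (eq_bigr (fun k : 'I_n => H k n) (F1 := fun k : 'I_n => H n k)); last by move=> k _; exact: Hs.
  by rewrite mulr2n !addrA.
have E (d : 'I_n.+1) : mode_weight R d * (\sum_(j < n.+1 - d) H j (j + d)%N) =
    mode_weight R d * (\sum_(j < n - d) H j (j + d)%N) + mode_weight R d * H (n - d)%N n.
  have dn : (d <= n)%N by rewrite -ltnS.
  by rewrite subSn// big_ord_recr/= subnK// mulrDr.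
rewrite (eq_bigr _ (fun d _ => E d)) big_split/= IH big_ord_recr/= subnn big_ord0 mulr0 addr0.
congr (_ + _); rewrite big_ord_recl/= subn0 mul1r addrC; congr (_ + _).
rewrite (reindex_inj rev_ord_inj)/= -sumrMnl; apply: eq_bigr => k _.
by rewrite /bump leq0n add1n mulr_natl.
Qed.

(** Dominated convergence for nonnegative series: beyond K the remainder of V n is at most C J n
    times that of L. K is chosen so that the remainder of L is below both e / 3 and e / (3 C). *)
Lemma tannery (w : nat -> R) (mv : nat -> nat -> R) (J V : nat -> R) (s : nat -> R) (L C : R) :
  0 < C -> (forall k, 0 <= w k) -> (forall n k, 0 <= mv n k) ->
  (forall n, (\sum_(k < K) w k * mv n k) @[K --> \oo] --> V n) ->
  (\forall n \near \oo, forall k, mv n k <= C * s k * J n) ->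
  (\sum_(k < K) w k * s k) @[K --> \oo] --> L ->
  (forall k, mv n k / J n @[n --> \oo] --> s k) ->
  J n @[n --> \oo] --> +oo_R -> V n / J n @[n --> \oo] --> L.
Proof.
move=> C0 w0 mv0 WV mvC QL mvs Joo; apply/cvgrPdist_le => e e0.
pose W n K := \sum_(k < K) w k * mv n k.
pose Q K := \sum_(k < K) w k * s k.
have s0 k : 0 <= s k.
  apply: (ler_cvg_to (cvg_cst 0) (mvs k)); near=> n.
  by rewrite divr_ge0// ltW//; near: n; exact: (cvg_pinfty_gt _ Joo).
have e3 : 0 < e / 3 by rewrite divr_gt0.
have e4 : 0 < e / 3 / C by rewrite divr_gt0.
have /cvgrPdist_le/(_ _ e3)[K1 _ HK1] := QL.
have /cvgrPdist_le/(_ _ e4)[K2 _ HK2] := QL.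
pose K := maxn K1 K2.
have LQ1 : `|L - Q K| <= e / 3 by apply: HK1; rewrite /= leq_maxl.
have LQ2 : `|L - Q K| <= e / 3 / C by apply: HK2; rewrite /= leq_maxr.
have WQ : W n K / J n @[n --> \oo] --> Q K.
  have E n : W n K / J n = \sum_(k < K) w k * (mv n k / J n).
    by rewrite /W mulr_suml; apply: eq_bigr => k _; rewrite mulrA.
  under eq_fun do rewrite E.
  by apply: cvg_bigsum => k; apply: cvgMr; exact: mvs.
have /cvgrPdist_le/(_ _ e3) HWQ := WQ.
near=> n.
have J0 : 0 < J n by near: n; exact: (cvg_pinfty_gt _ Joo).
have mvn k : mv n k <= C * s k * J n by move: k; near: n.
have h1 : `|Q K - W n K / J n| <= e / 3 by near: n.
have mono K' : (K <= K')%N -> W n K <= W n K' /\ W n K' - W n K <= C * J n * (Q K' - Q K).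
  move=> KK; rewrite /W /Q -!(big_mkord xpredT (fun k => w k * mv n k)) -!(big_mkord xpredT (fun k => w k * s k)).
  rewrite (big_cat_nat (leq0n K) KK)/= (big_cat_nat (F := fun k => w k * s k) (leq0n K) KK)/=.
  split; first by rewrite lerDl sumr_ge0// => k _; rewrite mulr_ge0.
  rewrite addrAC subrr add0r [X in _ * X]addrAC subrr add0r mulr_sumr; apply: ler_sum => k _.
  apply: le_trans (_ : w k * (C * s k * J n) <= _); first by rewrite ler_wpM2l.
  by rewrite le_eqVlt; apply/orP; left; apply/eqP; ring.
have h2 : W n K <= V n.
  apply: (ler_cvg_to (cvg_cst (W n K)) (WV n)); near=> K'.
  by apply: (mono K' _).1; near: K'; exact: nbhs_infty_ge.
have h3 : V n - W n K <= C * J n * (L - Q K).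
  have c1 : W n K' - W n K @[K' --> \oo] --> V n - W n K by apply: cvgB; [exact: WV|exact: cvg_cst].
  have c2 : C * J n * (Q K' - Q K) @[K' --> \oo] --> C * J n * (L - Q K).
    by apply: cvgMr; apply: cvgB; [exact: QL|exact: cvg_cst].
  apply: (ler_cvg_to c1 c2); near=> K'.
  by apply: (mono K' _).2; near: K'; exact: nbhs_infty_ge.
have h4 : 0 <= V n / J n - W n K / J n <= e / 3.
  rewrite -mulrBl divr_ge0 ?subr_ge0 ?(ltW J0)//= ler_pdivrMr//.
  apply: le_trans h3 _; have : L - Q K <= e / 3 / C by apply: le_trans (ler_norm _) LQ2.
  rewrite ler_pdivlMr// => h.
  rewrite (_ : C * J n * (L - Q K) = (L - Q K) * C * J n); last by ring.
  by rewrite ler_wpM2r ?(ltW J0).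
move: h4 h1 LQ1; rewrite !ler_norml => /andP[a1 a2] /andP[b1 b2] /andP[c1 c2].
move: (V n / J n) (W n K / J n) a1 a2 b1 b2 => A B a1 a2 b1 b2.
by apply/andP; split; lra.
Unshelve. all: by end_near. Qed.

End symmetric_sums.

Lemma realc_mulE (R : realType) (x y z : R) : x%:C * (y +i* z) = (x * y) +i* (x * z) :> R[i].
Proof. by apply/eqP; rewrite eq_complex/= !mul0r subr0 addr0 !eqxx. Qed.

Section variance_of_modes.
Variable R : realType.
Variable mu : {finite_measure set (measurableTypeR R) -> \bar R}.
Hypothesis mu_nonneg : mu `]-oo, 0%R[%classic = 0%E.
Hypothesis mu_no_atom0 : mu [set 0%R] = 0%E.
Hypothesis mu_nonzero : (0 < mu setT)%E.
Hypothesis mu_moments : forall xi : R, 0 <= xi -> (moment mu xi < +oo)%E.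

Variables (F : R -> R) (a b : nat -> R).
Hypothesis bF : bmeas F.
Hypothesis pF : periodic F (pi *+ 2).
Hypothesis b0 : b 0 = 0.
Hypothesis coefF : forall (m : nat) al,
  rmean (fun x => F x * cos (m%:R * x + al)) = a m * cos al - b m * sin al.
Let c k := a k ^+ 2 + b k ^+ 2.
Hypothesis parseval : (\sum_(k < N) mode_weight R k * c k) @[N --> \oo] --> rmean (fun x => F x ^+ 2).

Let e n := fun j : 'I_n => @monomial R mu j.

Lemma rho_sym j k : rho mu j k = rho mu k j.
Proof. by rewrite /rho addnC [X in Num.sqrt X]mulrC. Qed.

(** The complex Fourier coefficient of index j - k of a real function; negative indices give
    conjugates. *)
Definition signed_coef (j k : nat) : R[i] :=
  if (k <= j)%N then a (j - k) +i* b (j - k) else a (k - j) +i* (- b (k - j)).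

Lemma gram_signed_coef eps n (j k : 'I_n) :
  gram (radial_measure mu) (@e n) (fun z => (eps * F (carg z))%:C) j k =
  (rho mu j k * eps)%:C * signed_coef j k.
Proof.
pose W t := ((eps * F t)%:C : R[i]).
have [mF [B FB]] := bF.
have mW : cmeasurable (W : measurableTypeR R -> R[i]).
  by split; [exact: measurable_funM (measurable_cst _) mF|exact: measurable_cst].
have pW : periodic W (pi *+ 2) by move=> t; rewrite /W pF.
have WB : exists B, forall t, normc (W t) <= B.
  exists (`|eps| * B) => t; rewrite normcR normrM ler_wpM2l//.
rewrite (gram_monomial mu_nonneg mu_no_atom0 mu_moments mu_nonzero _ _ pW mW WB).
rewrite realcM -mulrA; congr (_ * _).
rewrite circle_mean_re.
have cis_re t x : complex.Re (cis t * (x%:C)) = cos t * x :> R by rewrite cisE/= mulr0 subr0.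
have cis_im t x : complex.Im (cis t * (x%:C)) = sin t * x :> R by rewrite cisE/= mulr0 add0r.
have coef (d : nat) al : rmean (fun t => cos (d%:R * t + al) * (eps * F t)) = eps * (a d * cos al - b d * sin al).
  rewrite -coefF -rmeanZ; last by apply: bmeasM => //; exact: bmeas_cos.
  by congr rmean; apply/funext => t; ring.
have re (d : nat) : rmean (fun t => cos (d%:R * t) * (eps * F t)) = eps * a d.
  have := coef d 0; rewrite cos0 sin0 mulr1 mulr0 subr0 => <-.
  by congr rmean; apply/funext => t; rewrite addr0.
have im (d : nat) : rmean (fun t => sin (d%:R * t) * (eps * F t)) = eps * b d.
  have := coef d (- (pi / 2)); rewrite cosN sinN cos_pihalf sin_pihalf mulr0 mulrN1 opprK add0r => <-.
  by congr rmean; apply/funext => t; rewrite cosBpihalf.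
rewrite /signed_coef; case: leqP => [kj|jk].
  have E t : t *+ j - t *+ k = (j - k)%N%:R * t :> R by rewrite -mulrnBr// mulr_natl.
  rewrite realc_mulE -re -im.
  by congr (_ +i* _); congr rmean; apply/funext => t; rewrite ?cis_re ?cis_im E.
have E t : t *+ j - t *+ k = - ((k - j)%N%:R * t) :> R by rewrite mulr_natl mulrnBr ?(ltnW jk)// opprB.
have bs : bmeas (fun t => sin ((k - j)%N%:R * t) * (eps * F t)).
  have := bmeasM (bmeas_cos ((k - j)%N%:R : R) (- (pi / 2))) (bmeasM (bmeas_cst eps) bF).
  by under eq_fun do rewrite cosBpihalf.
rewrite realc_mulE mulrN -re -im -[- rmean _]mulN1r -rmeanZ//.
congr (_ +i* _); congr rmean; apply/funext => t; rewrite ?cis_re ?cis_im E ?cosN//.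
by rewrite sinN mulN1r mulNr.
Qed.

Lemma trace_gram eps n :
  \tr (gram (radial_measure mu) (@e n) (fun z => (eps * F (carg z))%:C)) = (n%:R * (eps * a 0))%:C.
Proof.
rewrite /mxtrace (eq_bigr (fun=> (eps * a 0)%:C)); last first.
  move=> j _; rewrite gram_signed_coef /signed_coef leqnn subnn b0.
  rewrite (rho_diag mu_nonneg mu_no_atom0 mu_moments mu_nonzero) mul1r.
  by rewrite realc_mulE mulr0.
by rewrite -realc_sum sumr_const card_ord mulr_natl.
Qed.

(** The variance before scaling. Subtraction is truncated, so [(j - k) + (k - j)] is |j - k|. *)
Definition stat_variance n : R := n%:R * rmean (fun x => F x ^+ 2) -
  \sum_(j < n) \sum_(k < n) rho mu j k ^+ 2 * c ((j - k) + (k - j))%N.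

Lemma signed_coefM j k : signed_coef j k * signed_coef k j = (c ((j - k) + (k - j))%N)%:C.
Proof.
wlog kj : j k / (k <= j)%N => [H|].
  by case/orP: (leq_total j k) => /H //; rewrite mulrC addnC.
rewrite /signed_coef kj; move: (kj); rewrite leq_eqVlt => /predU1P[->|{}kj'].
  rewrite leqnn subnn addn0 b0 /c b0.
  by apply/eqP; rewrite eq_complex/= !mulr0 mul0r subr0 addr0 expr0n/= addr0 expr2 !eqxx.
have -> : (k - j = 0)%N by apply/eqP.
rewrite leqNgt kj'/= addn0 /c.
by apply/eqP; rewrite eq_complex/=; apply/andP; split; apply/eqP; ring.
Qed.

Lemma variance_form_stat eps n :
  variance_form (radial_measure mu) (@e n) (fun z => eps * F (carg z)) =
  (eps ^+ 2 * stat_variance n)%:C.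
Proof.
have [mF [B FB]] := bF.
pose W t := (((eps * F t)%:C : R[i]) ^+ 2).
have WE t : W t = ((eps * F t) ^+ 2)%:C by rewrite /W realcX.
have mW : cmeasurable (W : measurableTypeR R -> R[i]).
  split; under eq_fun do rewrite WE/=; last exact: measurable_cst.
  by apply: measurable_funX; exact: measurable_funM (measurable_cst _) mF.
have pW : periodic W (pi *+ 2) by move=> t; rewrite /W pF.
have WB : exists B, forall t, normc (W t) <= B.
  exists ((`|eps| * B) ^+ 2) => t; rewrite WE normcR normrX lerXn2r ?nnegrE//.
    by rewrite mulr_ge0// (le_trans (normr_ge0 _) (FB 0)).
  by rewrite normrM ler_wpM2l.
have T1 : \tr (gram (radial_measure mu) (@e n) (fun z => ((eps * F (carg z))%:C) ^+ 2)) =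
    (eps ^+ 2 * (n%:R * rmean (fun x => F x ^+ 2)))%:C.
  rewrite /mxtrace (eq_bigr (fun=> (eps ^+ 2 * rmean (fun x => F x ^+ 2))%:C)).
    by rewrite -realc_sum sumr_const card_ord -[X in X%:C]mulr_natl mulrCA.
  move=> j _; rewrite (gram_monomial mu_nonneg mu_no_atom0 mu_moments mu_nonzero _ _ pW mW WB).
  rewrite (rho_diag mu_nonneg mu_no_atom0 mu_moments mu_nonzero) mul1r circle_mean_re.
  have b2 : bmeas (fun x => F x ^+ 2) by under eq_fun do rewrite expr2; exact: bmeasM.
  rewrite -rmeanZ//; congr (_ +i* _).
    by congr rmean; apply/funext => t; rewrite subrr cis0 mul1r WE/= exprMn.
  rewrite -[RHS](rmean_cst 0); congr rmean; apply/funext => t.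
  by rewrite subrr cis0 mul1r WE.
have T2 : \tr (gram (radial_measure mu) (@e n) (fun z => (eps * F (carg z))%:C) *m
     gram (radial_measure mu) (@e n) (fun z => (eps * F (carg z))%:C)) =
    (eps ^+ 2 * \sum_(j < n) \sum_(k < n) rho mu j k ^+ 2 * c ((j - k) + (k - j))%N)%:C.
  rewrite /mxtrace mulr_sumr realc_sum; apply: eq_bigr => j _.
  rewrite mxE mulr_sumr realc_sum; apply: eq_bigr => k _.
  rewrite !gram_signed_coef mulrACA signed_coefM -!realcM; congr (_%:C).
  by rewrite (rho_sym k j); ring.
by rewrite /variance_form T1 T2 -realcN -realcD /stat_variance mulrBr.
Qed.

Lemma stat_varianceE n : stat_variance n = n%:R * rmean (fun x => F x ^+ 2) -
  \sum_(d < n) mode_weight R d * (c d * \sum_(j < n - d) rho mu j (j + d)%N ^+ 2).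
Proof.
rewrite /stat_variance; congr (_ - _).
rewrite (sum_symmetric (H := fun j k => rho mu j k ^+ 2 * c ((j - k) + (k - j))%N)); last first.
  by move=> j k; rewrite rho_sym addnC.
apply: eq_bigr => d _; congr (_ * _); rewrite mulr_sumr; apply: eq_bigr => j _.
have -> : (j - (j + d) = 0)%N by apply/eqP; rewrite subn_eq0 leq_addr.
by rewrite add0n addKn mulrC.
Qed.

Lemma mode_variance_rho n k : mode_variance (lnMo_diff2 mu) n k =
  n%:R - \sum_(j < n - k) rho mu j (j + k)%N ^+ 2.
Proof.
rewrite /mode_variance sumrB sumr_const card_ord addrA -natrD.
have -> : (minn n k + (n - k) = n)%N.
  by have [nk|kn] := leqP n k; [rewrite (eqP nk) addn0|rewrite subnKC// ltnW].
congr (_ - _); apply: eq_bigr => j _.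
by rewrite (rho_sqr mu_nonneg mu_no_atom0 mu_nonzero mu_moments).
Qed.

(** Parseval turns n times the mean of F^2 into a series over the modes, which is then combined with
    the finite sum of the rho^2. For k >= n there is no pair (j, j + k) below n, and the mode keeps
    the factor n. *)
Lemma stat_variance_modes n :
  (\sum_(k < K) mode_weight R k * c k * mode_variance (lnMo_diff2 mu) n k) @[K --> \oo] --> stat_variance n.
Proof.
pose T := \sum_(d < n) mode_weight R d * (c d * \sum_(j < n - d) rho mu j (j + d)%N ^+ 2).
have L : (n%:R * (\sum_(k < K) mode_weight R k * c k) - T) @[K --> \oo] --> stat_variance n.
  by rewrite stat_varianceE; apply: cvgB; [exact: cvgMr|exact: cvg_cst].
apply: cvg_trans L; apply: near_eq_cvg; near=> K.
have nK : (n <= K)%N by near: K; exact: nbhs_infty_ge.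
have -> : T = \sum_(d < K) mode_weight R d * (c d * \sum_(j < n - d) rho mu j (j + d)%N ^+ 2).
  pose G d := mode_weight R d * (c d * \sum_(j < n - d) rho mu j (j + d)%N ^+ 2).
  rewrite /T -!(big_mkord xpredT G) (big_cat_nat (leq0n n) nK)/=.
  have -> : \sum_(n <= d < K) G d = 0; last by rewrite addr0.
  by rewrite big_nat big1// => d /andP[nd _]; rewrite /G (eqP nd) big_ord0 !mulr0.
rewrite mulr_sumr -sumrB; apply: eq_bigr => k _.
by rewrite mode_variance_rho; ring.
Unshelve. all: by end_near. Qed.

End variance_of_modes.

(** * Convergence of the Laplace transform *)

Section laplace.
Variable R : realType.
Local Notation C := (R[i]).

(** D is written as (1 + eta) exp(s), and exp(s) is compared with exp(w). The constant c + 2 comes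
    from |exp(x) - 1| <= (c + 1) |x|^2 + |x| for |x| <= 1. *)
Lemma cexp_perturbation (D s w : C) : normc (s - w) <= 1 ->
  normc (D - cexp w) <= expR (normc w) *
    ((cexp_const R + 2) * normc (s - w) +
     normc (D * cexp (- s) - 1) * ((cexp_const R + 2) * normc (s - w) + 1)).
Proof.
set x := normc (s - w) => x1; set eta := D * cexp (- s) - 1.
have x0 : 0 <= x := normc_ge0 _.
have c0 := @cexp_const_ge0 R.
have h : normc (cexp (s - w) - 1) <= (cexp_const R + 2) * x.
  rewrite (_ : _ - 1 = (cexp (s - w) - (1 + (s - w))) + (s - w)); last by ring.
  apply: le_trans (le_normcD _ _) _; apply: le_trans (lerD (cexp_taylor1 x1) (lexx _)) _.
  rewrite -/x; have : x ^+ 2 <= x by rewrite expr2 ler_piMr.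
  have : 0 <= cexp_const R + 1 by lra.
  by move=> u v; have := ler_wpM2l u v; lra.
have DE : D = (1 + eta) * cexp s.
  by rewrite /eta addrC subrK -mulrA -cexpD addNr cexp0 mulr1.
have -> : D - cexp w = cexp w * ((cexp (s - w) - 1) + eta * ((cexp (s - w) - 1) + 1)).
  have sE : cexp s = cexp (s - w) * cexp w by rewrite -cexpD subrK.
  by rewrite DE sE; clear; move: (cexp (s - w)) (cexp w) eta => p q r; ring.
rewrite normcM; apply: ler_pM; rewrite ?normc_ge0//.
  by rewrite normc_cexp ler_expR (le_trans (ler_norm _))// norm_Re_le_normc.
apply: le_trans (le_normcD _ _) _; apply: lerD => //.
rewrite normcM ler_wpM2l ?normc_ge0//; apply: le_trans (le_normcD _ _) _.
by rewrite normc1 lerD2r.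
Qed.

Variable mu : {finite_measure set (measurableTypeR R) -> \bar R}.
Hypothesis mu_nonneg : mu `]-oo, 0%R[%classic = 0%E.
Hypothesis mu_no_atom0 : mu [set 0%R] = 0%E.
Hypothesis mu_nonzero : (0 < mu setT)%E.
Hypothesis mu_moments : forall xi : R, 0 <= xi -> (moment mu xi < +oo)%E.

Variables (F : R -> R) (a b : nat -> R).
Hypothesis bF : bmeas F.
Hypothesis pF : periodic F (pi *+ 2).
Hypothesis b0 : b 0 = 0.
Hypothesis coefF : forall (m : nat) al,
  rmean (fun x => F x * cos (m%:R * x + al)) = a m * cos al - b m * sin al.

Variables (J : nat -> R) (L : R).
Hypothesis Joo : J n @[n --> \oo] --> +oo_R.
Let V n := stat_variance mu F a b n.
Hypothesis VJ : V n / J n @[n --> \oo] --> L.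

Definition centred_stat n (z : n.-tuple C) : R :=
  (\sum_(k < n) F (carg (tnth z k)) - n%:R * a 0) / Num.sqrt (J n).

Let eps n : R := (Num.sqrt (J n))^-1.
Let u n (z : C) : R := eps n * F (carg z).
Let e n := fun j : 'I_n => @monomial R mu j.

Let mu_ n : measurable_fun setT (u n).
Proof.
by apply: measurable_funM => //; apply: measurableT_comp => //; [exact: bF.1|exact: measurable_carg].
Qed.

Lemma cexp_centred_stat zeta n (z : n.-tuple C) :
  cexp (zeta * (centred_stat z)%:C) =
  cexp (- (zeta * (n%:R * (eps n * a 0))%:C)) * \prod_k cexp (zeta * (u n (tnth z k))%:C).
Proof.
rewrite -cexp_sum -cexpD; congr cexp.
rewrite -mulr_sumr -realc_sum -mulrN -mulrDr -realcN -realcD; congr (_ * _%:C).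
by rewrite /centred_stat /u -mulr_sumr -/(eps n); ring.
Qed.

Let uB : exists2 B, 0 < B & forall n z, `|u n z| <= eps n * B.
Proof.
have [_ [B FB]] := bF; exists (B + 1).
  by rewrite ltr_wpDl// (le_trans (normr_ge0 _) (FB 0)).
move=> n z; rewrite /u normrM ger0_norm ?invr_ge0 ?sqrtr_ge0// ler_wpM2l ?invr_ge0 ?sqrtr_ge0//.
by rewrite (le_trans (FB _))// lerDl.
Qed.

Lemma cint_cexp_centred_stat zeta n :
  cintegrable (joint_law mu n) (fun z => cexp (zeta * (centred_stat z)%:C)) /\
  cint (joint_law mu n) (fun z => cexp (zeta * (centred_stat z)%:C)) =
  cexp (- (zeta * (n%:R * (eps n * a 0))%:C)) *
  \det (gram (radial_measure mu) (@e n) (fun z => cexp (zeta * (u n z)%:C))).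
Proof.
have [B B0 hB] := uB.
have mw : cmeasurable (fun z => cexp (zeta * (u n z)%:C)).
  apply: cmeasurable_cexp; apply: cmeasurableM; first exact: cmeasurable_cst.
  by split; [exact: mu_|exact: measurable_cst].
have wB : exists B, forall z, normc (cexp (zeta * (u n z)%:C)) <= B.
  exists (expR (normc zeta * (eps n * B))) => z.
  rewrite normc_cexp ler_expR (le_trans (ler_norm _))// (le_trans (norm_Re_le_normc _))//.
  by rewrite normcM normcR ler_wpM2l ?normc_ge0.
have [iw Ew] := joint_law_product mu_nonneg mu_no_atom0 mu_moments mu_nonzero n mw wB.
rewrite -Ew -(cintegrableZ _ iw).2.
have -> : (fun z => cexp (zeta * (centred_stat z)%:C)) =
  (fun z : n.-tuple C => cexp (- (zeta * (n%:R * (eps n * a 0))%:C)) * \prod_k cexp (zeta * (u n (tnth z k))%:C)).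
  by apply/funext => z; exact: cexp_centred_stat.
by split => //; exact: (cintegrableZ _ iw).1.
Qed.

(** In [bound], sup |u| is O(J^(-1/2)) and the scaled variance [v n] converges: [hh] bounds the
    Hilbert-Schmidt norm of S, [tt] the deviation of its trace from zeta^2 v / 2, and [y] the
    deviation from zeta^2 L / 2. *)
Lemma laplace_cvg zeta :
  normc (cint (joint_law mu n) (fun z => cexp (zeta * (@centred_stat n z)%:C)) -
         cexp (zeta ^+ 2 / 2%:R * L%:C)) @[n --> \oo] --> (0 : R).
Proof.
have [B B0 hB] := uB.
pose x n : R := normc zeta * (2 * (eps n * B)).
pose v n : R := V n / J n.
have eps0 : eps n @[n --> \oo] --> (0 : R).
  apply/cvgrPdist_le => d d0; near=> n; rewrite sub0r normrN.
  rewrite ger0_norm ?invr_ge0 ?sqrtr_ge0// -[leRHS]invrK lef_pV2 ?posrE ?invr_gt0//.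
    rewrite -[leLHS]ger0_norm ?invr_ge0 ?(ltW d0)// -sqrtr_sqr ler_wsqrtr// ltW//.
    by near: n; exact: (cvg_pinfty_gt _ Joo).
  by rewrite sqrtr_gt0; near: n; exact: (cvg_pinfty_gt _ Joo).
have e0 : 2 * (eps n * B) @[n --> \oo] --> (0 : R).
  rewrite -[X in _ --> X](mulr0 (2 : R)); apply: cvgMr.
  by rewrite -[X in _ --> X](mul0r B); apply: cvgMl.
have vL : v n @[n --> \oo] --> L := VJ.
have x0 : x n @[n --> \oo] --> (0 : R).
  by rewrite -[X in _ --> X](mulr0 (normc zeta)); apply: cvgMr.
pose c := cexp_const R.
pose hh n : R := (c + 1) ^+ 2 * normc zeta ^+ 4 * (2 * (eps n * B)) ^+ 2 * v n.
pose tt n : R := 2 * (c * normc zeta ^+ 3 * (2 * (eps n * B)) * v n).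
pose y n : R := tt n + normc (zeta ^+ 2 / 2%:R) * `|v n - L|.
pose bound n : R := expR (normc (zeta ^+ 2 / 2%:R * L%:C)) *
    ((c + 2) * y n + (expR ((2 * c + 3) * hh n) - 1) * ((c + 2) * y n + 1)).
have hh0 : hh n @[n --> \oo] --> (0 : R).
  rewrite -[X in _ --> X](mul0r L); apply: cvgM => //.
  rewrite -[X in _ --> X](mulr0 ((c + 1) ^+ 2 * normc zeta ^+ 4)); apply: cvgMr.
  by rewrite -[X in _ --> X](mulr0 (0 : R)); apply: cvgM.
have tt0 : tt n @[n --> \oo] --> (0 : R).
  rewrite -[X in _ --> X](mulr0 (2 : R)); apply: cvgMr.
  rewrite -[X in _ --> X](mul0r L); apply: cvgM => //.
  by rewrite -[X in _ --> X](mulr0 (c * normc zeta ^+ 3)); apply: cvgMr.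
have y0 : y n @[n --> \oo] --> (0 : R).
  rewrite -[X in _ --> X](addr0 (0 : R)); apply: cvgD => //.
  rewrite -[X in _ --> X](mulr0 (normc (zeta ^+ 2 / 2%:R))); apply: cvgMr.
  rewrite -[X in _ --> X](normr0 R); apply: cvg_norm.
  by rewrite -[X in _ --> X](subrr L); apply: cvgB => //; exact: cvg_cst.
have cy0 : (c + 2) * y n @[n --> \oo] --> (0 : R).
  by rewrite -[X in _ --> X](mulr0 (c + 2)); apply: cvgMr.
have ch0 : expR ((2 * c + 3) * hh n) - 1 @[n --> \oo] --> (0 : R).
  rewrite -[X in _ --> X](subrr (1 : R)); apply: cvgB; last exact: cvg_cst.
  rewrite -[X in _ --> X]expR0; apply: continuous_cvg; first exact: continuous_expR.
  by rewrite -[X in _ --> X](mulr0 (2 * c + 3)); apply: cvgMr.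
have bound0 : bound n @[n --> \oo] --> (0 : R).
  rewrite -[X in _ --> X](mulr0 (expR (normc (zeta ^+ 2 / 2%:R * L%:C)))); apply: cvgMr.
  rewrite -[X in _ --> X](addr0 (0 : R)); apply: cvgD => //.
  rewrite -[X in _ --> X](mul0r (0 + 1 : R)); apply: cvgM => //.
  by apply: cvgD => //; exact: cvg_cst.
apply: (squeeze_cvgr _ (cvg_cst 0) bound0); near=> n; rewrite normc_ge0/=.
have J0 : 0 < J n by near: n; exact: (cvg_pinfty_gt _ Joo).
have x1 : x n <= 1 by near: n; exact: (cvgr_le _ x0).
have y1 : y n <= 1 by near: n; exact: (cvgr_le _ y0).
have hh1 : hh n <= 1 by near: n; exact: (cvgr_le _ hh0).
have [V0 [VE V00 [S [detE S2 trS]]]] := det_cexp_estimate (L2c_monomial mu_nonneg mu_no_atom0 mu_moments)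
  (gram_monomial1 mu_nonneg mu_no_atom0 mu_moments mu_nonzero n) (mu_ n) (hB n) x1.
have V0E : V0 = v n.
  have := VE; rewrite (variance_form_stat mu_nonneg mu_no_atom0 mu_nonzero mu_moments bF pF b0 coefF).
  move=> /(congr1 (@complex.Re R)) /= <-.
  by rewrite /v /V exprVn sqr_sqrtr ?(ltW J0)// mulrC.
rewrite V0E in V00 S2 trS.
rewrite (cint_cexp_centred_stat zeta n).2 detE.
rewrite (trace_gram mu_nonneg mu_no_atom0 mu_nonzero mu_moments bF pF b0 coefF).
(* The trace of the compression equals the centring term exactly, so the exponential prefactor
   disappears. *)
rewrite mulrA -cexpD addNr cexp0 mul1r.
have sL : normc (\tr S - zeta ^+ 2 / 2%:R * L%:C) <= y n.
  rewrite -(subrKA (zeta ^+ 2 / 2%:R * (v n)%:C)); apply: le_trans (le_normcD _ _) _.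
  by apply: lerD => //; rewrite -mulrBr -realcN -realcD normcM normcR.
apply: le_trans (cexp_perturbation _ (le_trans sL y1)) _.
have cc0 : 0 <= c + 2 by have := @cexp_const_ge0 R; rewrite /c; lra.
rewrite /bound ler_wpM2l ?expR_ge0//; apply: lerD; first by rewrite ler_wpM2l.
apply: ler_pM; rewrite ?normc_ge0 ?addr_ge0 ?mulr_ge0 ?normc_ge0//.
  exact: det1D_near_cexp.
by rewrite lerD2r ler_wpM2l.
Unshelve. all: by end_near. Qed.

End laplace.

(** * Convergence in law for a bounded function *)

Section central_limit.
Variable R : realType.
Local Notation C := (R[i]).
Variable mu : {finite_measure set (measurableTypeR R) -> \bar R}.
Hypothesis mu_nonneg : mu `]-oo, 0%R[%classic = 0%E.
Hypothesis mu_no_atom0 : mu [set 0%R] = 0%E.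
Hypothesis mu_nonzero : (0 < mu setT)%E.
Hypothesis mu_moments : forall xi : R, 0 <= xi -> (moment mu xi < +oo)%E.

Variables (F : R -> R) (a b : nat -> R).
Hypothesis bF : bmeas F.
Hypothesis pF : periodic F (pi *+ 2).
Hypothesis b0 : b 0 = 0.
Hypothesis coefF : forall (m : nat) al,
  rmean (fun x => F x * cos (m%:R * x + al)) = a m * cos al - b m * sin al.

Variables (J : nat -> R) (L : R).
Hypothesis L_ge0 : 0 <= L.
Hypothesis Joo : J n @[n --> \oo] --> +oo_R.
Hypothesis VJ : stat_variance mu F a b n / J n @[n --> \oo] --> L.
Let X n (z : n.-tuple C) := centred_stat F a J z.

Lemma measurable_centred_stat n : measurable_fun setT (@X n).
Proof.
apply: measurable_funM => //; apply: measurable_funB => //; apply: measurable_sum => k.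
exact: (measurableT_comp bF.1 (measurableT_comp (@measurable_carg R) (measurable_tnth k))).
Qed.

(** The prefactor serves the characteristic function, with c = exp(i theta) and zeta = i t; c = 1
    with zeta = 1 or -1 gives the exponential moments. *)
Let Re_laplace_cvg c zeta :
  (forall n, rintegrable (joint_law mu n) (fun z => complex.Re (c * cexp (zeta * (X z)%:C)))) /\
  (\int[joint_law mu n]_z complex.Re (c * cexp (zeta * (X z)%:C))) @[n --> \oo] -->
  complex.Re (c * cexp (zeta ^+ 2 / 2%:R * L%:C)).
Proof.
have iX n := (cint_cexp_centred_stat mu_nonneg mu_no_atom0 mu_nonzero mu_moments a bF J zeta n).1.
split=> [n|]; first exact: (cintegrableZ c (iX n)).1.1.
have lim := laplace_cvg mu_nonneg mu_no_atom0 mu_nonzero mu_moments bF pF b0 coefF Joo VJ zeta.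
apply/cvgrPdist_lt => /= e e0.
have lim0 : normc c * normc (cint (joint_law mu n) (fun z => cexp (zeta * (X z)%:C)) -
    cexp (zeta ^+ 2 / 2%:R * L%:C)) @[n --> \oo] --> (0 : R).
  by rewrite -[X in _ --> X](mulr0 (normc c)); apply: cvgMr; exact: lim.
move/cvgrPdist_lt : lim0 => /(_ e e0); apply: filterS => n.
rewrite sub0r normrN; apply: le_lt_trans.
have -> : \int[joint_law mu n]_z complex.Re (c * cexp (zeta * (X z)%:C)) =
    complex.Re (c * cint (joint_law mu n) (fun z => cexp (zeta * (X z)%:C))).
  by rewrite -(cintegrableZ c (iX n)).2.
have ReB (x y : C) : complex.Re x - complex.Re y = complex.Re (x - y).
  by case: x y => [? ?] [? ?].
rewrite distrC ReB -mulrBr -normcM; apply: le_trans (norm_Re_le_normc _) _.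
exact: ler_norm.
Qed.

Theorem centred_stat_cvg (g : R -> R) (M : R) : continuous g -> (forall x, `|g x| <= M) ->
  (\int[joint_law mu n]_z g (X z)) @[n --> \oo] --> \int[gaussian 0 L]_x g x.
Proof.
have cosE (t theta x : R) : complex.Re (cexp (0 +i* theta) * cexp ((0 +i* t) * x%:C)) =
    cos (t * x + theta).
  by rewrite -cexpD /cexp /= !mul0r mulr0 subr0 !add0r expR0 mul1r addrC; congr cos; ring.
have expE (s : C) (x : R) : s = 1 \/ s = -1 -> complex.Re (1 * cexp (s * x%:C)) = expR (complex.Re s * x).
  by case=> ->; rewrite mul1r /cexp /= ?mul0r ?mulr0 ?oppr0 ?subr0 ?mul0r ?addr0 ?cos0 ?mulr1.
have half : (2%:R^-1 : C) = (2^-1)%:C by rewrite fmorphV rmorph_nat.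
have limE (s : C) : s = 1 \/ s = -1 -> complex.Re (1 * cexp (s ^+ 2 / 2%:R * L%:C)) = expR (2^-1 * L).
  by case=> ->; rewrite ?sqrrN expr1n !mul1r half -realcM /cexp /= cos0 mulr1.
have [ip lp] := Re_laplace_cvg 1 1.
have [im lm] := Re_laplace_cvg 1 (-1).
have i2 n : rintegrable (joint_law mu n) (fun z => expR (X z) + expR (- X z)) /\
   \int[joint_law mu n]_z (expR (X z) + expR (- X z)) = 
   \int[joint_law mu n]_z complex.Re (1 * cexp (1 * (X z)%:C)) +
   \int[joint_law mu n]_z complex.Re (1 * cexp (-1 * (X z)%:C)).
  have -> : (fun z : n.-tuple C => expR (X z) + expR (- X z)) =
      (fun z => complex.Re (1 * cexp (1 * (X z)%:C)) + complex.Re (1 * cexp (-1 * (X z)%:C))).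
    apply/funext => z; rewrite (expE 1); last by left.
    by rewrite (expE (-1)) ?mul1r /= ?mulN1r//; right.
  by split; [exact: (integrableD measurableT (ip n) (im n))|exact: (RintegralD measurableT (ip n) (im n))].
pose K0 := \int[gaussian 0 L]_x (expR x + expR (- x)).
pose K1 := expR (2^-1 * L) + expR (2^-1 * L).
(* One bound must serve both the limit law, whose exponential moment is K0, and the laws for large
   n, whose moments tend to K1. *)
move=> cg gM; apply: (@levy _ _ _ _ _ _ measurable_centred_stat _ (Num.max K0 (K1 + 1)) _ _ g M cg gM).
- move=> t theta; rewrite gaussian_char//.
  have [_] := Re_laplace_cvg (cexp (0 +i* theta)) (0 +i* t).
  under eq_fun do under eq_Rintegral do rewrite cosE.
  have -> // : complex.Re (cexp (0 +i* theta) * cexp ((0 +i* t) ^+ 2 / 2%:R * L%:C)) =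
    cos theta * expR (- (L * t ^+ 2 / 2)).
  have -> : (0 +i* t) ^+ 2 / 2%:R * L%:C = (- (L * t ^+ 2 / 2))%:C.
    have -> : (0 +i* t : C) ^+ 2 = (- t ^+ 2)%:C by rewrite expr2 /=; apply/eqP; rewrite eq_complex /= !mul0r !mulr0 sub0r addr0 expr2 !eqxx.
    by rewrite half -!realcM; congr _%:C; ring.
  by rewrite /cexp /= expR0 sin0 cos0 !mul1r !mulr1 !mulr0 subr0.
- have : (\int[joint_law mu n]_z (expR (X z) + expR (- X z))) @[n --> \oo] --> K1.
    under eq_fun do rewrite (i2 _).2.
    rewrite (limE 1) in lp; last by left.
    rewrite (limE (-1)) in lm; last by right.
    exact: cvgD lp lm.
  move=> /cvgr_le /(_ (K1 + 1)); rewrite ltrDl ltr01 => /(_ isT).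
  apply: filterS => n h; split; first exact: (i2 n).1.
  by rewrite le_max h orbT.
- by split; [exact: gaussian_cosh|rewrite le_max lexx].
Qed.

End central_limit.

(** * Null sets of angles *)

Section null_sets.
Variable R : realType.
Local Notation C := (R[i]).
Variable mu : {finite_measure set (measurableTypeR R) -> \bar R}.
Hypothesis mu_nonneg : mu `]-oo, 0%R[%classic = 0%E.
Hypothesis mu_no_atom0 : mu [set 0%R] = 0%E.
Hypothesis mu_nonzero : (0 < mu setT)%E.
Hypothesis mu_moments : forall xi : R, 0 <= xi -> (moment mu xi < +oo)%E.

(* The Gram matrix of [1 - \1_N] is the identity, so the expected product of the
   [1 - \1_N (z_k)] is 1. *)
Lemma joint_law_null n (N : set C) : measurable N -> radial_measure mu N = 0%E ->
  exists E : set (n.-tuple C), [/\ measurable E, joint_law mu n E = 0%E &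
    forall z, ~ E z -> forall k, ~ N (tnth z k)].
Proof.
move=> mN N0; pose w z : C := (1 - \1_N z)%:C.
have w1 z : ~ N z -> w z = 1.
  by move=> Nz; rewrite /w indicE memNset// subr0.
have mw0 : measurable_fun setT (fun z : C => 1 - \1_N z : R).
  by apply: measurable_funB => //; exact: measurable_indic.
have mw : cmeasurable w by split => //; exact: measurable_cst.
have wB : exists B, forall z, normc (w z) <= B.
  exists 1 => z; rewrite normcR indicE; case: (_ \in _); rewrite ?subrr ?normr0 ?subr0 ?normr1//.
have [iw Ew] := joint_law_product mu_nonneg mu_no_atom0 mu_moments mu_nonzero n mw wB.
have gramE : gram (radial_measure mu) (fun j : 'I_n => monomial mu j) w = 1%:M.
  rewrite -(gram_monomial1 mu_nonneg mu_no_atom0 mu_moments mu_nonzero n).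
  apply/matrixP => j k; rewrite !mxE.
  have lm (l : 'I_n) := L2c_monomial mu_nonneg mu_no_atom0 mu_moments l.
  have ic := cintegrable_cdot (lm j) (lm k).
  have mjk : cmeasurable (fun z => monomial mu j z * (monomial mu k z)^*).
    by apply: cmeasurableM; [exact: (lm j).1|apply: cmeasurable_conj; exact: (lm k).1].
  rewrite (cintegrable_ae mN N0 (cmeasurableM mjk mw) _ ic).2; last first.
    by move=> z Nz; rewrite w1// mulr1.
  by apply: eq_cint => z; rewrite mulr1.
rewrite gramE det1 in Ew.
pose A (z : n.-tuple C) : R := \prod_k (1 - \1_N (tnth z k)).
have AE z : (A z)%:C = \prod_k w (tnth z k) by rewrite /A rmorph_prod.
have iA : rintegrable (joint_law mu n) A /\ \int[joint_law mu n]_z A z = 1.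
  have -> : A = (fun z => complex.Re (\prod_k w (tnth z k))).
    by apply/funext => z; rewrite -AE.
  by split; [exact: iw.1|exact: (congr1 (@complex.Re R) Ew)].
have mA := rintegrable_measurable iA.1.
pose E := A @^-1` [set 0].
have mE : measurable E by rewrite -[E]setTI; exact: mA.
have A01 z : A z = 1 - \1_E z.
  rewrite [in RHS]indicE; have [/set_mem ->|/negP Ez] := boolP (z \in E); first by rewrite subrr.
  rewrite subr0 /A big1// => k _; rewrite indicE; have [Nk|] := boolP (_ \in N); last by rewrite subr0.
  case: Ez; apply/mem_set; rewrite /E /= /A (bigD1 k)//= indicE Nk.
  by rewrite [X in X * _]subrr mul0r.
exists E; split => // [|z Ez k Nk]; last first.
  by apply: Ez; rewrite /E /= /A (bigD1 k)//= indicE mem_set// [X in X * _]subrr mul0r.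
have : \int[joint_law mu n]_z (1 - A z) = 0.
  have i1 : rintegrable (joint_law mu n) (cst 1) by exact: finite_measure_integrable_cst.
  rewrite RintegralB//; [|exact: iA.1].
  by rewrite iA.2 Rintegral_cst// [X in fine X]probability_setT/= mulr1 subrr.
have -> : (fun z => 1 - A z) = \1_E.
  by apply/funext => z; rewrite A01 subKr.
rewrite /Rintegral integral_indic// setIT => PE0.
by have := congr1 EFin PE0; rewrite fineK// fin_num_measure.
Qed.

(** The argument in [0, 2 pi[, the period on which the almost everywhere identity for Fourier series
    is stated. *)
Definition carg2pi (z : C) : R := if carg z < 0 then carg z + pi *+ 2 else carg z.

Lemma carg2pi_itv z : 0 <= carg2pi z < pi *+ 2.
Proof.
have pi0 := pi_gt0 R; rewrite /carg2pi.
have [a0 api] : - pi <= carg z /\ carg z <= pi.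
  have z1 : -1 <= complex.Re z / normc z <= 1.
    rewrite -ler_norml normrM normfV (ger0_norm (normc_ge0 z)).
    have [->|z0] := eqVneq (normc z) 0; first by rewrite invr0 mulr0.
    by rewrite ler_pdivrMr ?lt_neqAle 1?eq_sym ?z0 ?normc_ge0// mul1r norm_Re_le_normc.
  have := acos_ge0 z1; have := acos_lepi z1.
  by rewrite /carg; case: ifP => _ h1 h2; lra.
by rewrite mulr2n; case: ltP => ?; lra.
Qed.

Lemma periodic_carg2pi (V : zmodType) (W : R -> V) z :
  periodic W (pi *+ 2) -> W (carg2pi z) = W (carg z).
Proof. by move=> pW; rewrite /carg2pi; case: ifP => // _; rewrite pW. Qed.

Lemma measurable_carg2pi : measurable_fun setT carg2pi.
Proof.
apply: measurable_fun_ifT; [|apply: measurable_funD => //|]; try exact: measurable_carg.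
by apply: measurable_fun_ltr => //; exact: measurable_carg.
Qed.

Lemma carg2pi_polar r t : 0 < r -> 0 <= t < pi *+ 2 -> carg2pi (polar (r, t)) = t.
Proof.
move=> r0 t2; have := carg2pi_itv (polar (r, t)).
set s := carg2pi _ => s2.
have cst : cos (s - t) = 1.
  have pW : periodic (fun s : R => cos (s - t)) (pi *+ 2).
    by move=> x /=; rewrite addrAC cosD2pi.
  by rewrite /s (periodic_carg2pi _ pW) (carg_polar_periodic t pW r0) subrr cos0.
have [k kE] := cos_eq1 cst.
have pi0 := pi_gt0 R.
have p2 : 0 < pi *+ 2 :> R by rewrite pmulrn_lgt0.
have : `|k%:~R : R| < 1.
  rewrite -(ltr_pM2l p2) mulr1 -[X in X * _]gtr0_norm// -normrM -kE ltr_norml.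
  by apply/andP; split; lra.
rewrite -intr_norm (_ : 1 = 1%:~R)// ltr_int => k1.
have k0 : k = 0 by apply/eqP; rewrite -normr_eq0; move: k1; case: `|k| (normr_ge0 k) => // -[].
by move: kE; rewrite k0 mulr0 => /eqP; rewrite subr_eq0 => /eqP.
Qed.

(** The preimage is taken under [polar]: apart from the null sets r <= 0 and t outside [0, 2 pi[,
    [carg2pi] returns the angle t. *)
Lemma radial_measure_carg2pi (N : set (measurableTypeR R)) : measurable N ->
  lebesgue_measure N = 0%E -> radial_measure mu (carg2pi @^-1` N) = 0%E.
Proof.
move=> mN N0; pose I : set (measurableTypeR R) := `[0, pi *+ 2[%classic.
have mI : measurable I by exact: measurable_itv.
pose B := N `|` ~` I.
have mB : measurable B by apply: measurableU => //; exact: measurableC.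
pose A : set (measurableTypeR R * measurableTypeR R) := [set p | p.1 <= 0] `|` setT `*` B.
have mA1 : measurable ([set p | p.1 <= 0] : set (measurableTypeR R * measurableTypeR R)).
  rewrite (_ : [set p | _] = `]-oo, 0%R]%classic `*` setT).
    by apply: measurableX => //; exact: measurable_itv.
  by apply/seteqP; split => [[x y]/= xy|[x y] [/=]]; rewrite ?in_itv//= in_itv/=.
have mA2 : measurable (setT `*` B : set (measurableTypeR R * measurableTypeR R)).
  exact: measurableX.
have mS : measurable (@polar R @^-1` (carg2pi @^-1` N)).
  rewrite -[X in measurable X]setTI; apply: measurable_polar => //.
  by rewrite -[X in measurable X]setTI; exact: measurable_carg2pi.
have B0 : (@angle_measure R) B = 0%E.
  apply: (subset_measure0 (mu := lebesgue_measure) _ mN _ N0).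
    exact: measurableI.
  by move=> x [[//|nI] xI]; case: nI.
have A0 : finite_product mu (@angle_measure R) A = 0%E.
  apply/eqP; rewrite -measure_le0; apply: le_trans (measureU2 _ mA1 mA2) _.
  rewrite [X in (X + _)%E](radial_ae_pos mu_nonneg mu_no_atom0) add0e.
  rewrite [X in (X <= _)%E](product_measure1E mu (@angle_measure R))//.
  by rewrite [X in (_ * X <= _)%E](_ : _ = 0%E) ?mule0.
apply: (subset_measure0 mS _ _ A0); first exact: measurableU.
move=> [r t] /= Nt; have [r0|r0] := leP r 0; first by left.
right; split => //=; have [tI|] := pselect (I t); last by right.
by left; rewrite carg2pi_polar// in Nt; move: tI; rewrite /I /= in_itv.
Qed.

End null_sets.

(** * Transfer from the continuous version back to [f] *)

Theorem theorem1p1 (R : realType)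
  (mu : {finite_measure set (measurableTypeR R) -> \bar R})
  (mu_nonneg : mu `]-oo, 0%R[%classic = 0%E)
  (mu_no_atom0 : mu [set 0%R] = 0%E)
  (mu_nonzero : (0 < mu setT)%E)
  (mu_moments : forall xi : R, 0 <= xi -> (moment mu xi < +oo)%E)
  (beta rho gamma : R)
  (beta_gt : 2^-1 < beta) (beta_le : beta <= 1)
  (rho_gt : 1 < rho) (gamma_gt : 1 < gamma)
  (h : R -> R)
  (h_diff : forall xi : R, 0 < xi -> derivable h xi 1)
  (h_ge0 : forall xi : R, 0 < xi -> 0 <= h xi)
  (ln_moment_h : derive1n 2 (ln_moment mu) = h +O_ (+oo_R) (fun xi => xi `^ (- rho)))
  (h_bigO : h =O_ (+oo_R) (fun xi => xi `^ (- beta)))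
  (dh_bigO : derive1 h =O_ (+oo_R) (fun xi => xi `^ (- gamma)))
  (iota_infty : iota_fun h x @[x --> +oo_R] --> +oo_R)
  (f : R -> R)
  (f_Fl2 : Fl2 (Num.max beta^-1 (3 / (2 * gamma))) f) :
  cvg_in_law (fun n => joint_law mu n) (fun n => @scaled_stat R h f n)
    (gaussian 0 (limit_variance f)).
Proof.
set sigma := Num.max _ _ in f_Fl2.
have beta_gt0 : 0 < beta by apply: lt_trans beta_gt; rewrite invr_gt0.
(* Because beta <= 1, the first entry of the maximum is at least 1. *)
have sigma_ge1 : 1 <= sigma by rewrite /sigma le_max invf_ge1 ?beta_le.
have [T abT] := fcos_bounded sigma_ge1 f_Fl2.
pose F := continuous_version f.
have bF : bmeas F := bmeas_continuous_version sigma_ge1 f_Fl2.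
have pF : periodic F (pi *+ 2) by exact: fourier_series_periodic.
have coefF := fourier_series_coef (fsin0 f) abT.
have parseval := fourier_series_parseval (fsin0 f) abT.
have power_ge0 k : 0 <= fpower f k by rewrite /fpower addr_ge0 ?sqr_ge0.
have weight_ge0 k : 0 <= mode_weight R k by case: k => *; rewrite /=.
have lim_ge0 : 0 <= limit_variance f.
  by rewrite fine_ge0// esum_ge0// => k _; rewrite lee_fin mulr_ge0 ?sqr_ge0.
have Joo := iota2_cvg iota_infty.
have VJ : stat_variance mu F (fcos f) (fsin f) n / iota2 h n @[n --> \oo] --> limit_variance f.
  apply: (@tannery _ (fun k => mode_weight R k * fpower f k)
    (fun n k => mode_variance (lnMo_diff2 mu) n k) _ _ (fun k => k%:R ^+ 2) _ 5) => //.
  - by move=> k; rewrite mulr_ge0.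
  - by move=> n k; apply: mode_variance_ge0; exact: lnMo_diff2_ge0.
  - by move=> n; exact: stat_variance_modes.
  - exact: (mode_variance_lnMo_le mu_nonneg mu_no_atom0 mu_nonzero mu_moments rho_gt gamma_gt h_diff ln_moment_h dh_bigO iota_infty).
  - have -> : (fun K => \sum_(k < K) mode_weight R k * fpower f k * k%:R ^+ 2) =
        (fun K => \sum_(k < K) mode_weight R k * (k%:R ^+ 2 * fpower f k)).
      by apply/funext => K; apply: eq_bigr => k _; rewrite -mulrA (mulrC (fpower f k)).
    exact: limit_variance_cvg sigma_ge1 f_Fl2.
  - move=> k; exact: (@mode_variance_lnMo_cvg _ _ mu_nonneg mu_no_atom0 mu_nonzero mu_moments _ _ _ _ beta_gt0 rho_gt gamma_gt h_diff ln_moment_h h_bigO dh_bigO iota_infty k).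
have pf : periodic f (pi *+ 2) := f_Fl2.1.1.
(* [f] is known to be measurable on one period only; composition with [carg2pi] stays inside it. *)
have mX n : measurable_fun setT (@scaled_stat R h f n).
  pose D : set (measurableTypeR R) := `[0, pi *+ 2]%classic.
  have mD : measurable D by exact: measurable_itv.
  have mf : measurable_fun setT (f \_ D).
    apply/(measurable_restrictT _ mD).
    by have /integrableP[/measurable_EFinP] := f_Fl2.1.2.
  have fE (z : R[i]) : f (carg z) = (f \_ D) (carg2pi z).
    have Dz : D (carg2pi z).
      by rewrite /D /= in_itv/=; have /andP[-> /ltW ->] := carg2pi_itv z.
    by rewrite -(periodic_carg2pi _ pf) patchE mem_set.
  apply: measurable_funM => //; apply: measurable_funB => //.
  apply: measurable_sum => k; under eq_fun do rewrite fE.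
  exact: (measurableT_comp mf (measurableT_comp (@measurable_carg2pi R) (measurable_tnth k))).
split => // g cg [M0 [_ gM0]].
pose M := M0 + 1.
have gM x : `|g x| <= M by apply: gM0 => //; rewrite /M ltrDl.
have mg : measurable_fun setT (g : measurableTypeR R -> R) by exact: continuous_measurable_fun.
have EE (d : measure_display) (T0 : measurableType d) (P : probability T0 R) (Y : T0 -> R) :
    measurable_fun setT Y -> ('E_P[g \o Y] = (\int[P]_t g (Y t))%R%:E)%E.
  move=> mY; rewrite unlock /Rintegral fineK//.
  apply: integrable_fin_num => //; apply: rintegrable_bounded; first exact: measurableT_comp.
  by exists M => x; exact: gM.
have -> : ('E_(gaussian 0 (limit_variance f))[g] = (\int[gaussian 0 (limit_variance f)]_x g x)%R%:E)%E.
  by have := EE _ _ (gaussian 0 (limit_variance f)) id (@measurable_id _ _ _).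
have -> : (fun n => 'E_(joint_law mu n)[g \o @scaled_stat R h f n])%E =
    (fun n => (\int[joint_law mu n]_z g (scaled_stat h f z))%R%:E).
  by apply/funext => n; exact: (EE _ _ (joint_law mu n) _ (mX n)).
apply: cvg_EFin; first by near=> n.
have lim := centred_stat_cvg mu_nonneg mu_no_atom0 mu_nonzero mu_moments bF pF (fsin0 f) coefF lim_ge0 Joo VJ cg gM.
apply: cvg_trans lim; apply: near_eq_cvg; near=> n => /=.
(* The limit is known for [F]. As [f] and [F] agree off a null set of angles, the two statistics
   agree off a null set of the joint law, so the expectations are equal for every n. *)
have [N [mN N0 fF]] := continuous_version_ae sigma_ge1 f_Fl2.
have mN' : measurable (@carg2pi R @^-1` N).
  by rewrite -[X in measurable X]setTI; exact: measurable_carg2pi.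
have [E [mE E0 EN]] := joint_law_null mu_nonneg mu_no_atom0 mu_nonzero mu_moments n
  mN' (radial_measure_carg2pi mu_nonneg mu_no_atom0 mN N0).
have mc := measurable_centred_stat (fcos f) bF (iota2 h) (n := n).
have ic : rintegrable (joint_law mu n) (fun z => g (centred_stat F (fcos f) (iota2 h) z)).
  by apply: rintegrable_bounded; [exact: (measurableT_comp mg mc)|exists M => z; exact: gM].
apply/esym; apply: (rintegrable_ae mE E0 (measurableT_comp mg (mX n)) _ ic).2 => z Ez.
rewrite /= /scaled_stat /centred_stat /lin_stat; congr (g ((_ - _) / _)).
apply: eq_bigr => k _; rewrite -(periodic_carg2pi _ pf) -(periodic_carg2pi _ pF).
by apply: fF; [exact: carg2pi_itv|exact: EN Ez k].
Unshelve. all: by end_near. Qed.
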